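(* There is a universal constant $C>0$ such that the following holds. Let $X$ be an $n\times n$ real symmetric random matrix with $X_{ij}=b_{ij}\xi_{ij}$ for $i\ne j$ and $X_{ii}=\sqrt{2}\,b_{ii}\xi_{ii}$, where $b_{ij}=b_{ji}\ge 0$ are arbitrary nonnegative scalars (not all zero), and $\xi_{ij}=\xi_{ji}$ are symmetrically distributed real random variables that are independent for $i\ge j$ and satisfy $\mathbf{E}[\xi_{ij}^{2p}]\le\mathbf{E}[g^{2p}]$ for all $i,j$ and all $p\in\mathbb{N}$, where $g\sim N(0,1)$. Let $$\sigma^2:=\max_{i\le n}\sum_{j\le n} b_{ij}^2,\qquad \sigma_*^2:=\max_{i,j\le n} b_{ij}^2.$$ Then $$\mathbf{P}\big[\|X\|>2\sigma+\sigma_*^{4/3}\sigma^{-1/3}t\big]\le\frac{n\sigma_*^2}{C\sigma^2}\,e^{-Ct^{3/2}}$$ for every $0\le t\le\frac{\sigma^{4/3}}{\sigma_*^{4/3}}$.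
   Context: $\|X\|$ is the spectral norm (largest singular value). $\sigma,\sigma_*$ denote the nonnegative square roots. A universal constant does not depend on any parameter of the problem ($n$, $b_{ij}$, laws of $\xi_{ij}$, $t$). ''Symmetrically distributed'' means that $\xi_{ij}$ and $-\xi_{ij}$ have the same law. *)

(* Defs.v *)
From HB Require Import structures.
From mathcomp Require Import all_boot all_order all_algebra.
From mathcomp Require Import finmap.
From mathcomp Require Import all_classical all_reals all_analysis.

Set Implicit Arguments.
Unset Strict Implicit.
Unset Printing Implicit Defensive.

Import Order.TTheory GRing.Theory Num.Theory.
Import numFieldNormedType.Exports.

Local Open Scope classical_set_scope.
Local Open Scope ring_scope.

Definition singular_value (R : realType) (n : nat) (A : 'M[R]_n) : set R :=
  [set s | 0 <= s /\ eigenvalue (A^T *m A) (s ^+ 2)].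

(* For n > 0 the set of singular values is finite and nonempty, so that this
   supremum is a maximum; for n = 0 it is 0 by convention. *)
Definition spectral_norm (R : realType) (n : nat) (A : 'M[R]_n) : R :=
  sup (singular_value A).

Definition symmetrically_distributed (d : measure_display)
    (T : measurableType d) (R : realType) (P : probability T R)
    (X : {RV P >-> R}) : Prop :=
  forall B : set R, measurable B ->
    distribution P X B = P ((fun w => - X w) @^-1` B).

(* Mutual independence of the subfamily (X i)_{i in D}. *)
Definition mutually_independent (d : measure_display) (T : measurableType d)
    (R : realType) (P : probability T R) (I : choiceType) (D : set I)
    (X : I -> {RV P >-> R}) : Prop :=
  forall (J : {fset I}) (B : I -> set R),
    [set` J] `<=` D ->
    (forall i, i \in J -> measurable (B i)) ->
    P (\bigcap_(i in [set` J]) X i @^-1` B i) =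
      (\prod_(i <- J) P (X i @^-1` B i))%E.

(* E[g^k] for g ~ N(0, 1). *)
Definition gaussian_moment (R : realType) (k : nat) : \bar R :=
  (\int[@normal_prob R 0 1]_x (x ^+ k)%:E)%E.

(* Since the entries are squares, the default value 0 of the maxima below is
   harmless. *)
Definition sigma (R : realType) (n : nat) (b : 'I_n -> 'I_n -> R) : R :=
  Num.sqrt (\big[Num.max/0]_(i < n) \sum_(j < n) b i j ^+ 2).

Definition sigma_star (R : realType) (n : nat) (b : 'I_n -> 'I_n -> R) : R :=
  Num.sqrt (\big[Num.max/0]_(i < n) \big[Num.max/0]_(j < n) b i j ^+ 2).

Definition random_matrix (d : measure_display) (T : measurableType d)
    (R : realType) (P : probability T R) (n : nat) (b : 'I_n -> 'I_n -> R)
    (xi : 'I_n -> 'I_n -> {RV P >-> R}) (w : T) : 'M[R]_n :=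
  \matrix_(i < n, j < n)
    (if i == j then Num.sqrt 2 * b i j * xi i j w else b i j * xi i j w).

(* Main.v *)
(* Markov's inequality is applied to Tr X^(2p), p to be chosen. Rescale so that
   sigma_* = 1 and let d = sigma^2 and m be the integer part of d plus one.
   Expanding the trace over closed walks, independence and the moment hypothesis
   bound the expectation of each word in the entries by the Wick (pairing) sum of
   the Gaussian matrix with the same variances. For a fixed pairing, only the
   steps to new vertices are free, and they contribute at most the row sums; hence
   the walks from one vertex are dominated by those of the m x m Gaussian
   orthogonal ensemble (GOE). Splitting off the first row and column of the GOE
   and rotating the row into a coordinate axis yields a recursion on m for the
   expected diagonal entry of the powers; a supersolution shows that, for some p
   between P and 2P, this entry is at most
   (4m)^p (8 / P^(3/2)) exp(12 + c P^3 / m^2). The factor P^(-3/2) is what produces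
   n sigma_*^2 / sigma^2 in place of n: P is chosen of order
   max(1, t)^(1/2) d^(2/3). *)

Require Import Defs.
From HB Require Import structures.
From mathcomp Require Import all_boot all_order all_algebra.
From mathcomp Require Import all_classical all_reals all_analysis.
From mathcomp Require Import measurable_realfun.
From mathcomp Require Import zify ring lra.

Set Implicit Arguments.
Unset Strict Implicit.
Unset Printing Implicit Defensive.

Import Order.TTheory GRing.Theory Num.Theory.
Import numFieldNormedType.Exports.

Local Open Scope classical_set_scope.
Local Open Scope ring_scope.

(** * Gaussian moments and the walk recursion *)

(** A walk of length 2p in the GOE is recorded level by level: [u] excursions into the next minor
    and [k] pairs of diagonal steps. Normalised by (4m)^p, the excursion counts form, up to the
    factor 2^r, a critical Galton-Watson process with geometric offspring, and p is its total
    progeny U plus the number of flat pairs. Finite-size corrections weight a path by the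
    exponential of a multiple of (sum of u^2) / m, for which there is no closed recursion. Jensen's
    inequality with weights u / U replaces it by 1 / U times a sum of single-level exponentials, and
    for those an explicit supersolution exists. The factor P^(-3/2) arises as follows: averaging
    over the P + 1 admissible p gives 1 / P; the division by U gives another 1 / P (paths with small
    U have many flat pairs, each costing a factor 2); the supersolution loses 1 / s, at most
    P^(1/2). No Gaussian measure on matrices is needed: everything is polynomial of bounded degree,
    so a signed quadrature rule with the right moments carries the rotation argument. *)

Section NegativeBinomial.
Variable R : realType.
Implicit Types (y : R) (r N : nat).

(** By Pascal's rule the truncated sums satisfy (1 - y) s_(r+1) <= s_r. At [r = 0] the truncated
    predecessor kills every term but [u = 0]. *)
Lemma negbin_sum_le r N y : 0 <= y < 1 ->
  \sum_(u < N) 'C((r + u).-1, u)%:R * y ^+ u <= (1 - y) ^- r.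
Proof.
move=> /andP[y0 y1]; have y1' : 0 < 1 - y by lra.
elim: r N => [|r IH] N.
  rewrite expr0 invr1; case: N => [|N]; first by rewrite big_ord0.
  rewrite big_ord_recl /= bin0 mul1r expr0 big1 ?addr0 // => i _.
  by rewrite /bump /= add1n add0n /= bin_small // mul0r.
rewrite exprS invfM -ler_pdivrMl ?invr_gt0// invrK.
set s := \sum_(u < N) _.
suff : s <= (1 - y) ^- r + y * s by lra.
apply: le_trans (_ : \sum_(u < N) 'C((r + u).-1, u)%:R * y ^+ u + y * s <= _);
  last by rewrite lerD2r.
rewrite /s; case: N {s} => [|N]; first by rewrite !big_ord0 mulr0 addr0.
rewrite [X in _ <= _ + y * X]big_ord_recr /= big_ord_recl [in leRHS]big_ord_recl /=.
rewrite !bin0 !expr0 mul1r -addrA lerD2l mulrDr mulr_sumr addrA -big_split /=.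
rewrite -[leLHS]addr0 lerD //; last by rewrite mulr_ge0// mulr_ge0 ?exprn_ge0.
apply: ler_sum => i _; rewrite /bump /= add1n addnS /= binS.
by rewrite natrD mulrDl lerD // exprS mulrCA.
Qed.

(** From u 'C(r + u - 1, u) = r 'C(r + u - 1, u - 1), the mean reduces to the series for [r + 1]. *)
Lemma negbin_mean_le r N y : 0 <= y < 1 ->
  \sum_(u < N) u%:R * ('C((r + u).-1, u)%:R * y ^+ u) <=
  r%:R * y * (1 - y) ^- r.+1.
Proof.
move=> yI; have /andP[y0 y1] := yI.
have rhs0 : 0 <= r%:R * y * (1 - y) ^- r.+1.
  by rewrite mulr_ge0 ?mulr_ge0 ?invr_ge0 ?exprn_ge0 //; lra.
case: N => [|N]; first by rewrite big_ord0.
rewrite big_ord_recl mul0r add0r.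
apply: le_trans (_ : r%:R * y *
   (\sum_(u < N) 'C((r.+1 + u).-1, u)%:R * y ^+ u) <= _); last first.
  by apply: ler_wpM2l; rewrite ?mulr_ge0 //; exact: negbin_sum_le.
rewrite mulr_sumr; apply: ler_sum => i _; rewrite lift0.
rewrite mulrA -natrM addnS /= mul_bin_left.
have -> : (r + i - i = r)%N by lia.
rewrite natrM exprS.
by rewrite le_eqVlt; apply/orP; left; apply/eqP; ring.
Qed.

End NegativeBinomial.

Section Moments.
Variable R : realType.

(* [gmom V n] is the [n]-th moment of N(0, V). *)
Fixpoint gmom (V : R) (n : nat) : R :=
  match n with
  | 0 => 1
  | 1 => 0
  | n'.+2 => n'.+1%:R * V * gmom V n'
  end.

(* [rho x u] is the [u]-th moment of a chi-squared variable with [x] degrees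
   of freedom. *)
Definition rho (x : R) (u : nat) : R := \prod_(j < u) (x + 2 * j%:R).

(* The moments [E [z^n] S^r], [S = sum_a z^a (X^a)_00], for the GOE matrix [X]
   of size [j + 1]. *)
Fixpoint Gn (j r n : nat) : R :=
  match j with
  | 0 => 'C((r + n).-1, n)%:R * gmom 2 n
  | j'.+1 => \sum_(u < n.+1) \sum_(f < n.+1 | (f + 2 * u <= n)%N)
      'C((r + u).-1, u)%:R * 'C((r + u + f).-1, f)%:R * gmom 2 f *
      rho j'.+1%:R u * Gn j' u (n - (f + 2 * u))
  end.

Lemma gmom_ge0 (V : R) n : 0 <= V -> 0 <= gmom V n.
Proof.
move=> V0; suff : 0 <= gmom V n /\ 0 <= gmom V n.+1 by case.
elim: n => [|n [IH1 IH2]] /=; first by rewrite ler01 lexx.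
by split => //; rewrite mulr_ge0 // mulr_ge0.
Qed.

Lemma gmom_odd (V : R) n : odd n -> gmom V n = 0.
Proof.
elim/ltn_ind: n => [[|[|n]] IH] //= /negPn on.
by rewrite IH ?mulr0.
Qed.

Lemma gmom2_even k : gmom 2 (2 * k) = ((2 * k)`!%:R / k`!%:R :> R).
Proof.
elim: k => [|k IH]; first by rewrite muln0 /= fact0 divr1.
have -> : (2 * k.+1 = (2 * k).+2)%N by lia.
rewrite [LHS]/= IH !factS !natrM.
have k0 : (k`!%:R : R) != 0 by rewrite pnatr_eq0 -lt0n fact_gt0.
have k1 : (k.+1%:R : R) != 0 by rewrite pnatr_eq0.
have -> : ((2 * k).+2%:R : R) = 2 * k.+1%:R by rewrite -natrM; congr (_%:R); lia.
by field; rewrite k0 nat1r k1.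
Qed.

Lemma rho_ge0 (x : R) u : 0 <= x -> 0 <= rho x u.
Proof. by move=> x0; apply: prodr_ge0 => i _; rewrite addr_ge0 ?mulr_ge0. Qed.

Lemma Gn_ge0 j r n : 0 <= Gn j r n.
Proof.
elim: j r n => [|j IH] r n /=; first by rewrite mulr_ge0 ?gmom_ge0.
apply: sumr_ge0 => u _; apply: sumr_ge0 => f _.
by rewrite !mulr_ge0 ?gmom_ge0 ?rho_ge0.
Qed.

(** Each factor is at most d (1 + 2 j / d) <= d exp(2 j / d), and the numbers 2 j for j < u add up
    to less than u^2 + 1. *)
Lemma rho_le (x d : R) u : 0 <= x <= d -> 0 < d ->
  rho x u <= d ^+ u * expR (u%:R ^+ 2 / d).
Proof.
move=> /andP[x0 xd] d0; elim: u => [|u IH].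
  by rewrite /rho big_ord0 expr0 mul1r expr0n mul0r expR0.
rewrite /rho big_ord_recr /= -/(rho x u).
apply: le_trans (_ : (d ^+ u * expR (u%:R ^+ 2 / d)) *
                     (d * expR (2 * u%:R / d)) <= _).
  apply: ler_pM => //; first exact: rho_ge0.
    by rewrite addr_ge0 ?mulr_ge0.
  apply: le_trans (_ : d * (1 + 2 * u%:R / d) <= _).
    by rewrite mulrDr mulr1 mulrC mulrA mulrAC mulfV ?gt_eqF// mul1r; lra.
  by rewrite ler_pM2l // expR_ge1Dx.
rewrite mulrACA -exprSr -expRD ler_pM2l ?exprn_gt0// ler_expR.
rewrite -mulrDl ler_pM2r ?invr_gt0// -[u.+1]addn1 natrD; lra.
Qed.

End Moments.

(** * Flat steps (diagonal entries) at one level *)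

Section FlatSteps.
Variable R : realType.
Variable d : R.
Hypothesis d0 : 0 < d.

(** Placements of [2 k] flat steps in [v] slots times the moment of N(0, 2) of order [2 k],
    normalised by (2 d)^k; a further factor 2^-k is kept aside in [wt]. *)
Definition psi (v k : nat) : R :=
  'C((v + 2 * k).-1, 2 * k)%:R * ((2 * k)`!%:R / k`!%:R) / (2 * d) ^+ k.

Lemma psi_ge0 v k : 0 <= psi v k.
Proof. by rewrite !mulr_ge0 ?invr_ge0 ?exprn_ge0 ?mulr_ge0// ltW. Qed.

(** The coefficients of (1 - z / 2)^(-2 y), whose sum at z = 1 is 4^y. *)
Let tau (y : R) k : R := \prod_(j < k) ((y + j%:R / 2) / j.+1%:R).

Let tau_sum y N : 0 <= y -> \sum_(k < N) tau y k <= expR (6 * y).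
Proof.
move=> y0.
have [A Ay1 Ay2] : exists2 A : nat, 2 * y <= A%:R & A%:R <= 2 * y + 1 :> R.
  have /truncn_itv/andP[A1 A2] : 0 <= 2 * y by lra.
  exists (Num.truncn (2 * y)).+1; first exact: ltW.
  by rewrite -natr1 lerD2r.
(* Rounding [2 y] up to [A] and pulling out the first factor [y] leaves a negative binomial series.
   The factor [y] matters: a bound exceeding 1 by a constant even for small [y] would be compounded
   over all levels. *)
have tS k : tau y k.+1 <= y * ('C((A.+1 + k).-1, k)%:R * (1 / 2) ^+ k).
  elim: k => [|k IH].
    by rewrite /tau big_ord1 bin0 expr0 mul0r addr0 divr1 !mulr1.
  rewrite /tau big_ord_recr /= -/(tau y k.+1).
  have -> : y * ('C((A.+1 + k.+1).-1, k.+1)%:R * (1 / 2) ^+ k.+1) =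
     (y * ('C((A.+1 + k).-1, k)%:R * (1 / 2) ^+ k)) *
     ((A%:R + k.+1%:R) / 2 / k.+1%:R).
    have k1 : (k.+1%:R : R) != 0 by rewrite pnatr_eq0.
    have H : (k.+1%:R * 'C(A + k.+1, k.+1)%:R =
              (A%:R + k.+1%:R) * 'C(A + k, k)%:R :> R).
      rewrite -natrM -natrD -natrM; congr (_%:R).
      by rewrite -mul_bin_diag addnS.
    rewrite !addSn /=.
    have -> : 'C(A + k.+1, k.+1)%:R =
      (A%:R + k.+1%:R) * 'C(A + k, k)%:R / k.+1%:R :> R by rewrite -H; field; rewrite nat1r k1.
    by rewrite exprS; field; rewrite nat1r k1.
  apply: ler_pM => //.
  - by apply: prodr_ge0 => j _; rewrite divr_ge0// addr_ge0// divr_ge0.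
  - by rewrite divr_ge0// addr_ge0// divr_ge0.
  - apply: ler_pM.
    + by rewrite addr_ge0// divr_ge0.
    + by rewrite invr_ge0.
    + by move: Ay1; rewrite -[k.+1]addn1 natrD; lra.
    + by rewrite lef_pV2 ?posrE// ler_nat.
case: N => [|N]; first by rewrite big_ord0 expR_ge0.
rewrite big_ord_recl {1}/tau big_ord0.
apply: le_trans (_ : 1 + 4 * y * expR (2 * y) <= _); last first.
  have -> : 6 * y = 4 * y + 2 * y by lra.
  rewrite expRD; apply: le_trans (_ : (1 + 4 * y) * expR (2 * y) <= _).
    have := expR_ge1Dx (2 * y); nra.
  by rewrite ler_pM2r ?expR_gt0 ?expR_ge1Dx.
rewrite lerD2l; apply: le_trans (_ : \sum_(k < N) (y * ('C((A.+1 + k).-1, k)%:R * (1 / 2) ^+ k)) <= _).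
  by apply: ler_sum => i _; exact: tS.
rewrite -mulr_sumr [4 * y]mulrC -mulrA ler_wpM2l //.
apply: le_trans (negbin_sum_le _ _ _) _; first by lra.
have -> : 1 - 1 / 2 = 2^-1 :> R by lra.
rewrite exprVn invrK exprS.
have e2 : 2 <= expR 1 :> R by have := expR_ge1Dx (1 : R); lra.
have : 2 ^+ A <= 2 * expR (2 * y); last by lra.
case: A Ay1 Ay2 {tS} => [|A] Ay1 Ay2.
  by rewrite expr0; have := expR_ge1Dx (2 * y); lra.
rewrite exprS ler_pM2l//.
apply: le_trans (_ : expR A%:R <= _).
  rewrite -[A%:R]mulr1 expRM_natl.
  by apply: lerXn2r; rewrite ?nnegrE ?expR_ge0.
by rewrite ler_expR; move: Ay2; rewrite -[A.+1]addn1 natrD; lra.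
Qed.

(** Ratios of consecutive terms are compared: (v + 2 k)(v + 2 k + 1) <= 8 v^2 + k d, because 8 k^2
    <= k d in this range. *)
Let psi_tau v k : (0 < v)%N -> k%:R <= d / 8 -> psi v k <= tau (4 * v%:R ^+ 2 / d) k.
Proof.
move=> v0; elim: k => [|k IH] kd.
  by rewrite /psi /tau big_ord0 muln0 bin0 fact0 expr0 !divr1 mul1r.
have kd' : k%:R <= d / 8 by move: kd; rewrite -[k.+1]addn1 natrD; lra.
rewrite /tau big_ord_recr /= -/(tau _ k).
have -> : psi v k.+1 = psi v k *
    ((v%:R + 2 * k%:R) * (v%:R + 2 * k%:R + 1) / (2 * d * k.+1%:R)).
  case: v v0 {IH} => // v _; rewrite /psi.
  have E w : ('C((v.+1 + 2 * w).-1, 2 * w)%:R * ((2 * w)`!%:R / w`!%:R) : R) =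
             ((v + 2 * w) ^_ (2 * w))%:R / w`!%:R.
    by rewrite mulrA -natrM addSn /= bin_ffact.
  rewrite !E.
  have -> : ((v + 2 * k.+1) ^_ (2 * k.+1) =
    (v.+1 + 2 * k + 1) * ((v.+1 + 2 * k) * (v + 2 * k) ^_ (2 * k)))%N.
    have -> : (2 * k.+1 = (2 * k).+2)%N by lia.
    by rewrite ffactnS ffactnS !addnS /= ?addn0.
  rewrite factS !natrM exprS.
  have -> : ((v.+1 + 2 * k)%:R : R) = v.+1%:R + 2 * k%:R by rewrite natrD natrM.
  have -> : ((v.+1 + 2 * k + 1)%:R : R) = v.+1%:R + 2 * k%:R + 1 by rewrite natrD natrD natrM.
  have k1 : (k.+1%:R : R) != 0 by rewrite pnatr_eq0.
  have k2 : (k`!%:R : R) != 0 by rewrite pnatr_eq0 -lt0n fact_gt0.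
  have k3 : (2 * d) ^+ k != 0 by rewrite expf_neq0// mulf_neq0// gt_eqF.
  field; rewrite k3 k2 nat1r k1 gt_eqF//.
apply: ler_pM; rewrite ?psi_ge0 ?IH //.
  rewrite divr_ge0 ?mulr_ge0 ?addr_ge0 ?mulr_ge0//; exact: ltW.
rewrite invfM mulrA ler_pM2r ?invr_gt0// ler_pdivrMr ?mulr_gt0//.
have -> : (4 * v%:R ^+ 2 / d + k%:R / 2) * (2 * d) = 8 * v%:R ^+ 2 + k%:R * d.
  by field; rewrite gt_eqF.
have v1 : 1 <= v%:R :> R by rewrite ler1n.
have k0 : 0 <= k%:R :> R by [].
have : 8 * k%:R ^+ 2 <= k%:R * d by rewrite expr2; nra.
have := sqr_ge0 (v%:R - 2 * k%:R : R); nra.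
Qed.

(** 24 = 6 * 4 comes from summing [tau] at y = 4 v^2 / d. At [v = 0] only [k = 0] survives, so a
    level that is not visited costs nothing. *)
Lemma psi_sum v N : N%:R <= d / 8 ->
  \sum_(k < N) psi v k <= expR (24 * v%:R ^+ 2 / d).
Proof.
move=> Nd; case: v => [|v].
  rewrite expr0n mulr0 mul0r expR0; case: N Nd => [|N] Nd; first by rewrite big_ord0.
  rewrite big_ord_recl big1; last first.
    by move=> i _; rewrite /psi add0n lift0 bin_small ?mul0r//; lia.
  by rewrite /psi muln0 bin0 fact0 expr0 !divr1 mul1r addr0.
apply: le_trans (_ : \sum_(k < N) tau (4 * v.+1%:R ^+ 2 / d) k <= _).
  apply: ler_sum => k _; apply: psi_tau => //; apply: le_trans Nd.
  by rewrite ler_nat ltnW.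
apply: le_trans (tau_sum _ _) _; first by rewrite divr_ge0 ?mulr_ge0 ?exprn_ge0// ltW.
by rewrite ler_expR; lra.
Qed.

End FlatSteps.

(** * Growth of the walk recursion *)

Section Profiles.
Variable R : realType.
Variable d : R.
Hypothesis d0 : 0 < d.
Variable M : nat.

(** Up to the factor 2^(r - u), the probability that [r] individuals with geometric offspring of
    mean 1 have [u] children. *)
Definition upw (r u : nat) : R := 'C((r + u).-1, u)%:R / 4 ^+ u.

(** The negative exponential makes the flat steps a subprobability in [k]; it is compensated in
    [energy]. *)
Definition kap (r u k : nat) : R :=
  upw r u * (psi d (r + u) k * expR (- (24 * (r + u)%:R ^+ 2 / d))).

(* Sum over the sequences of pairs (up-steps, pairs of flat steps) describing
   the successive levels of a walk, below a level with [r] up-steps. *)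
Fixpoint psum (j r : nat) (Phi : seq (nat * nat) -> R) : R :=
  match j with
  | 0 => Phi [::]
  | j'.+1 => \sum_(u < M) \sum_(k < M)
      kap r u k * psum j' u (fun l => Phi ((nat_of_ord u, nat_of_ord k) :: l))
  end.

Lemma upw_ge0 r u : 0 <= upw r u.
Proof. by rewrite divr_ge0 ?exprn_ge0. Qed.

Lemma kap_ge0 r u k : 0 <= kap r u k.
Proof. by apply: mulr_ge0 (upw_ge0 _ _) (mulr_ge0 (psi_ge0 d0 _ _) (expR_ge0 _)). Qed.

Lemma kap_sum r u : M%:R <= d / 8 -> \sum_(k < M) kap r u k <= upw r u.
Proof.
move=> Md; rewrite -mulr_sumr -[leRHS]mulr1 ler_wpM2l ?upw_ge0//.
rewrite -mulr_suml expRN ler_pdivrMr ?expR_gt0// mul1r.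
exact: psi_sum.
Qed.

Lemma psum_le j r Phi Psi : (forall l, Phi l <= Psi l) ->
  psum j r Phi <= psum j r Psi.
Proof.
elim: j r Phi Psi => [|j IH] r Phi Psi le_PP /=; first exact: le_PP.
apply: ler_sum => u _; apply: ler_sum => k _; rewrite ler_wpM2l ?kap_ge0//.
by apply: IH => l; exact: le_PP.
Qed.

Lemma psum_ge0 j r Phi : (forall l, 0 <= Phi l) -> 0 <= psum j r Phi.
Proof.
elim: j r Phi => [|j IH] r Phi Phi0 //=.
apply: sumr_ge0 => u _; apply: sumr_ge0 => k _; rewrite mulr_ge0 ?kap_ge0//.
by apply: IH => l; exact: Phi0.
Qed.

Lemma psumZ j r a Phi : psum j r (fun l => a * Phi l) = a * psum j r Phi.
Proof.
elim: j r Phi => [|j IH] r Phi //=.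
rewrite mulr_sumr; apply: eq_bigr => u _; rewrite mulr_sumr.
by apply: eq_bigr => k _; rewrite IH mulrCA.
Qed.

Lemma psum_eq j r Phi Psi : Phi =1 Psi -> psum j r Phi = psum j r Psi.
Proof. by move=> /funext->. Qed.

Lemma psum_sum j r (I : Type) (s : seq I) (P : pred I) (Phi : I -> seq (nat * nat) -> R) :
  psum j r (fun l => \sum_(i <- s | P i) Phi i l) = \sum_(i <- s | P i) psum j r (Phi i).
Proof.
elim: j r Phi => [|j IH] r Phi //=.
rewrite [RHS]exchange_big; apply: eq_bigr => u _ /=.
rewrite [RHS]exchange_big; apply: eq_bigr => k _ /=.
by rewrite IH mulr_sumr.
Qed.

Definition tot (l : seq (nat * nat)) : nat := \sum_(q <- l) (q.1 + q.2).
Definition ups (l : seq (nat * nat)) : nat := \sum_(q <- l) q.1.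
Definition flats (l : seq (nat * nat)) : nat := \sum_(q <- l) q.2.

(** The exponents paid along a path: u^2 for the row norms ([rho_le]), 24 (r + u)^2 for the
    normalisation of the flat steps in [kap]. *)
Fixpoint energy (r : nat) (l : seq (nat * nat)) : R :=
  if l is q :: l' then q.1%:R ^+ 2 + 24 * (r + q.1)%:R ^+ 2 + energy q.1 l' else 0.

Definition wt (r n : nat) (l : seq (nat * nat)) : R :=
  (tot l == n)%:R * (2 ^- flats l * expR (energy r l / d)).

Lemma wt_ge0 r n l : 0 <= wt r n l.
Proof. by rewrite !mulr_ge0 ?invr_ge0 ?exprn_ge0 ?expR_ge0. Qed.

(** One level of the recursion: (4 d)^(u + k) splits into 4^u for [upw], d^u for the row norm, and
    (2 d)^k 2^k for the flat steps. *)
Let Gn_step r u k q n (G : R) : (u + k <= q)%N -> 0 <= G ->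
  n = (q - (u + k))%N ->
  forall rh : R, 0 <= rh -> rh <= d ^+ u * expR (u%:R ^+ 2 / d) ->
  forall S : R, G <= (4 * d) ^+ n * S ->
  'C((r + u).-1, u)%:R * 'C((r + u + 2 * k).-1, 2 * k)%:R * gmom 2 (2 * k) *
   rh * G <=
  (4 * d) ^+ q * (kap r u k * (2 ^- k *
     expR ((u%:R ^+ 2 + 24 * (r + u)%:R ^+ 2) / d) * S)).
Proof.
move=> ukq G0 -> rh rh0 rhle S GS; set Z := 24 * (r + u)%:R ^+ 2.
rewrite gmom2_even.
have -> : (4 * d) ^+ q * (kap r u k * (2 ^- k * expR ((u%:R ^+ 2 + Z) / d) * S)) =
  'C((r + u).-1, u)%:R * 'C((r + u + 2 * k).-1, 2 * k)%:R * ((2 * k)`!%:R / k`!%:R) *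
  (d ^+ u * expR (u%:R ^+ 2 / d)) * ((4 * d) ^+ (q - (u + k)) * S).
  have -> : (4 * d) ^+ q = (4 * d) ^+ (q - (u + k)) * ((4 * d) ^+ u * (4 * d) ^+ k).
    by rewrite -exprD -exprD; congr (_ ^+ _); lia.
  rewrite [(_ + Z) / d]mulrDl expRD /kap /upw /psi expRN -/Z.
  have -> : (4 * d) ^+ k = 2 ^+ k * (2 * d) ^+ k.
    by rewrite -exprMn; congr (_ ^+ _); ring.
  rewrite [(4 * d) ^+ u]exprMn.
  have h1 : (2 * d) ^+ k != 0 by rewrite expf_neq0// mulf_neq0// gt_eqF.
  have h2 : (2 ^+ k : R) != 0 by rewrite expf_neq0.
  have h3 : (4 ^+ u : R) != 0 by rewrite expf_neq0.
  have h4 : expR (Z / d) != 0 by rewrite gt_eqF ?expR_gt0.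
  have h5 : (k`!%:R : R) != 0 by rewrite pnatr_eq0 -lt0n fact_gt0.
  by field; rewrite h1 h2 h3 h4 h5.
apply: ler_pM => //; first by rewrite !mulr_ge0 ?invr_ge0.
by apply: ler_wpM2l => //; rewrite !mulr_ge0 ?invr_ge0.
Qed.

Let sum_even (q : nat) (F : nat -> R) : (forall f, odd f -> F f = 0) ->
  \sum_(f < (2 * q).+1) F f = \sum_(k < q.+1) F (2 * k)%N.
Proof.
move=> Fodd; elim: q => [|q IH]; first by rewrite !big_ord1.
have -> : (2 * q.+1 = (2 * q).+2)%N by lia.
rewrite 2!big_ord_recr /= IH Fodd ?addr0; last by rewrite /=; lia.
rewrite [RHS]big_ord_recr /=; congr (_ + F _); lia.
Qed.

Let ler_sum_term (N : nat) (F : 'I_N -> R) i : (forall i, 0 <= F i) -> F i <= \sum_i F i.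
Proof. by move=> F0; rewrite (bigD1 i)//= lerDl sumr_ge0. Qed.

Let wt_cons r n u k l : (u + k <= n)%N ->
  wt r n ((u, k) :: l) = 2 ^- k *
     expR ((u%:R ^+ 2 + 24 * (r + u)%:R ^+ 2) / d) * wt u (n - (u + k)) l.
Proof.
move=> ukn; rewrite /wt /tot /flats !big_cons /= -/(tot l) -/(flats l).
rewrite mulrDl expRD exprD invfM.
have -> : ((u + k + tot l)%N == n) = (tot l == (n - (u + k))%N) by lia.
ring.
Qed.

(** Flat steps contribute only in even number and an excursion uses two steps, so half the length is
    the sum of [u + k] over the levels. As [q < M], no term of [Gn] is lost in the truncated
    sums. *)
Lemma Gn_psum j r q : j.+1%:R <= d -> (q < M)%N ->
  Gn R j r (2 * q) <= (4 * d) ^+ q * psum j.+1 r (wt r q).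
Proof.
have d4 n : 0 <= (4 * d) ^+ n by rewrite exprn_ge0 ?mulr_ge0// ltW.
have pos j' r' (u k : 'I_M) :
    0 <= kap r' u k * psum j' u (fun l => wt r' q ((nat_of_ord u, nat_of_ord k) :: l)).
  by rewrite mulr_ge0 ?kap_ge0// psum_ge0// => l; exact: wt_ge0.
elim: j r q pos => [|j IH] r q pos jd qM.
  have q0 : (0 < M)%N by apply: leq_ltn_trans qM.
  have S1 : (1 : R) <= d ^+ 0 * expR (0%:R ^+ 2 / d).
    by rewrite expr0n mul0r expR0 mulr1.
  have S2 : (1 : R) <= (4 * d) ^+ 0 * 1 by rewrite expr0 mul1r.
  have := @Gn_step r 0 q q 0 1 (leqnn _) ler01 _ 1 ler01 S1 1 S2.
  rewrite addn0 add0n subnn bin0 mul1r !mulr1 => /(_ erefl) H.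
  rewrite [Gn _ _ _ _]/=; apply: (le_trans H).
  rewrite ler_wpM2l//.
  (* A matrix of size 1 has no minor: only the term [u = 0], [k = q] is kept. *)
  apply: le_trans (@ler_sum_term _ _ (Ordinal q0) _); last first.
    by move=> u; apply: sumr_ge0 => k _; exact: (pos 0%N).
  apply: le_trans (@ler_sum_term _ _ (Ordinal qM) _); last first.
    by move=> k; exact: (pos 0%N).
  rewrite /= wt_cons ?add0n// subnn /wt /tot /flats !big_nil eqxx expr0 invr1 mul0r expR0.
  by rewrite addn0 !mulr1.
have dj : j.+1%:R <= d by apply: le_trans jd; rewrite ler_nat.
have -> : psum j.+2 r (wt r q) = \sum_(u < M) \sum_(k < M)
   kap r u k * psum j.+1 u (fun l => wt r q ((nat_of_ord u, nat_of_ord k) :: l)) by [].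
set T := fun u k : nat => kap r u k * psum j.+1 u (fun l => wt r q ((u, k) :: l)).
have T0 u k : 0 <= T u k.
  by rewrite /T mulr_ge0 ?kap_ge0// psum_ge0// => l; exact: wt_ge0.
rewrite [Gn _ _ _ _]/=.
apply: le_trans (_ : (4 * d) ^+ q *
   (\sum_(u < M) \sum_(k < q.+1 | (u + k <= q)%N) T u k) <= _); last first.
  rewrite ler_wpM2l//; apply: ler_sum => u _.
  rewrite -/(\sum_(k < M) T u k) -!(big_mkord xpredT) -(big_mkord (fun k => u + k <= q)%N).
  rewrite [leRHS](big_cat_nat (n := q.+1))//= -[leLHS]addr0 lerD//; last by rewrite sumr_ge0.
  by rewrite big_mkcond /=; apply: ler_sum => k _; case: ifP.
apply: le_trans (_ : \sum_(u < (2 * q).+1 | (u <= q)%N) \sum_(k < q.+1 | (u + k <= q)%N)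
    (4 * d) ^+ q * T u k <= _); last first.
  rewrite mulr_sumr -(big_mkord (fun u => u <= q)%N
     (fun u => \sum_(k < q.+1 | (u + k <= q)%N) (4 * d) ^+ q * T u k)).
  rewrite -(big_mkord xpredT
     (fun u => (4 * d) ^+ q * \sum_(k < q.+1 | (u + k <= q)%N) T u k)).
  rewrite (big_cat_nat (n := q.+1))//=; last by lia.
  rewrite [leRHS](big_cat_nat (n := q.+1))//=.
  rewrite lerD//; last first.
    rewrite big_nat_cond big_pred0; last by move=> i; lia.
    by apply: sumr_ge0 => u _; rewrite mulr_ge0// sumr_ge0.
  rewrite big_mkcond /=; apply: ler_sum => u _; case: ifP => _.
    by rewrite mulr_sumr.
  by rewrite mulr_ge0// sumr_ge0.
rewrite [leRHS]big_mkcond /=; apply: ler_sum => u _.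
set F := fun f : nat => 'C((r + u).-1, u)%:R * 'C((r + u + f).-1, f)%:R * gmom 2 f *
            rho j.+1%:R u * Gn R j u (2 * q - (f + 2 * u)).
rewrite -/(\sum_(f < (2 * q).+1 | (f + 2 * u <= 2 * q)%N) F f) big_mkcond /=.
rewrite (@sum_even q (fun f => if (f + 2 * u <= 2 * q)%N then F f else 0)); last first.
  by move=> f of_; case: ifP => // _; rewrite /F gmom_odd// mulr0 !mul0r.
have -> : (if (u <= q)%N then \sum_(k < q.+1 | (u + k <= q)%N) (4 * d) ^+ q * T u k else 0)
  = \sum_(k < q.+1 | (u + k <= q)%N) (4 * d) ^+ q * T u k.
  by case: ifP => // uq; rewrite big_pred0// => k; lia.
rewrite [leRHS]big_mkcond /=; apply: ler_sum => k _.
have -> : (2 * k + 2 * u <= 2 * q)%N = (u + k <= q)%N by lia.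
case: ifP => // ukq; rewrite /F /T.
under psum_eq do rewrite wt_cons//.
rewrite psumZ.
apply: (@Gn_step r u k q (q - (u + k))%N) => //.
- exact: Gn_ge0.
- exact: rho_ge0.
- by apply: rho_le => //; rewrite ler0n.
- have -> : (2 * q - (2 * k + 2 * u) = 2 * (q - (u + k)))%N by lia.
  apply: IH => //; last by lia.
  by move=> *; rewrite mulr_ge0 ?kap_ge0// psum_ge0// => l; exact: wt_ge0.
Qed.

(** 24 (r + u)^2 <= 48 r^2 + 48 u^2, so each [u] is charged 48 at its own level, 48 at the next, and
    1 for its own square. *)
Lemma energy_le r l :
  energy r l <= 48 * r%:R ^+ 2 + 97 * \sum_(q <- l) q.1%:R ^+ 2.
Proof.
elim: l r => [|q l IH] r /=; first by rewrite big_nil mulr0 addr0 mulr_ge0 ?exprn_ge0.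
rewrite big_cons natrD; have := IH q.1.
have : 24 * (r%:R + q.1%:R) ^+ 2 <= 48 * r%:R ^+ 2 + 48 * q.1%:R ^+ 2 :> R.
  by have := sqr_ge0 (r%:R - q.1%:R : R); nra.
by lra.
Qed.

(** Jensen's inequality with weights u / U, under which U u has mean the sum of squares; the proof
    uses the tangent to [expR] at that mean. An exponential of a sum over levels is traded for a sum
    of one-level exponentials. *)
Lemma jensen_expR (us : seq nat) (c : R) :
  (\sum_(u <- us) u)%N%:R * expR (c * \sum_(u <- us) u%:R ^+ 2) <=
  \sum_(u <- us) u%:R * expR (c * (\sum_(u <- us) u)%N%:R * u%:R).
Proof.
set U := (\sum_(u <- us) u)%N; set Q := \sum_(u <- us) _.
apply: le_trans (_ : \sum_(u <- us) u%:R * (expR (c * Q) * (1 + (c * U%:R * u%:R - c * Q))) <= _).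
  rewrite le_eqVlt; apply/orP; left; apply/eqP; symmetry.
  transitivity (expR (c * Q) * ((1 - c * Q) * \sum_(u <- us) u%:R +
                                (c * U%:R) * \sum_(u <- us) u%:R ^+ 2)).
    rewrite [X in _ = _ * (X + _)]mulr_sumr [X in _ = _ * (_ + X)]mulr_sumr.
    rewrite -big_split /= [RHS]mulr_sumr.
    by apply: eq_bigr => u _; ring.
  by rewrite -natr_sum -/U -/Q; ring.
apply: ler_sum => u _; rewrite ler_wpM2l//.
rewrite -[X in _ <= expR X](_ : c * Q + (c * U%:R * u%:R - c * Q) = _); last by ring.
by rewrite expRD ler_wpM2l ?expR_ge0 ?expR_ge1Dx.
Qed.

(** Summing over [n] removes the constraint on [tot l]. Jensen's inequality divides by [ups l + 1];
    when this is small, flat pairs make up for it, since (ups + 1)(flats + 1) >= P + 1 and 2^flats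
    >= flats + 1. The factor x^(ups - 2 P) >= 1 brings in the discount that makes the recursion
    subcritical. *)
Lemma sum_wt_le P (x : R) l : 0 < x <= 1 ->
  \sum_(P <= n < (2 * P).+1) wt 1 n l <=
  (P.+1%:R^-1 * x ^- (2 * P)) * (x ^+ ups l *
    (expR (97 * (2 * P).+1%:R / d) +
     \sum_(q <- l) q.1%:R * expR (97 * (2 * P).+1%:R / d * q.1%:R))).
Proof.
move=> /andP[x0 x1]; set lam := 97 * _ / d.
have rhs0 : 0 <= P.+1%:R^-1 * x ^- (2 * P) * (x ^+ ups l *
    (expR lam + \sum_(q <- l) q.1%:R * expR (lam * q.1%:R))).
  have S0 : 0 <= \sum_(q <- l) q.1%:R * expR (lam * q.1%:R).
    by apply: sumr_ge0 => q _; rewrite mulr_ge0 ?expR_ge0.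
  by rewrite !mulr_ge0 ?invr_ge0 ?exprn_ge0 ?(addr_ge0 (expR_ge0 _) S0)// ltW.
have [Hn|Hn] := boolP ((P <= tot l)%N && (tot l < (2 * P).+1)%N); last first.
  rewrite big_nat big1// => n Pn; rewrite /wt.
  by case: eqP Hn => [->|]; rewrite ?Pn ?mul0r.
have -> : \sum_(P <= n < (2 * P).+1) wt 1 n l = 2 ^- flats l * expR (energy 1 l / d).
  rewrite (bigD1_seq (tot l)) ?iota_uniq ?mem_index_iota//= /wt eqxx mul1r.
  by rewrite big1 ?addr0// => n /negPf; rewrite eq_sym => ->; rewrite mul0r.
have totE : (tot l = ups l + flats l)%N by rewrite /tot big_split.
have [U1 U2 U3] : [/\ (P.+1 <= (ups l).+1 * (flats l).+1)%N,
    ((ups l).+1 <= (2 * P).+1)%N & (ups l <= 2 * P)%N].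
  by clear -Hn totE; rewrite totE in Hn; case/andP: Hn; split; nia.
(* The leading 1 stands for the initial value [r = 1] in the energy and keeps the Jensen weights
   defined when [ups l = 0]. *)
set us := 1%N :: map fst l.
have Uus : (\sum_(u <- us) u = (ups l).+1)%N.
  by rewrite /us big_cons big_map add1n.
have Qus : \sum_(u <- us) u%:R ^+ 2 = 1 + \sum_(q <- l) q.1%:R ^+ 2 :> R.
  by rewrite /us big_cons big_map expr1n.
have := jensen_expR us (97 / d); rewrite /= Uus Qus {1}/us big_cons big_map.
set S := \sum_(q <- l) q.1%:R ^+ 2; rewrite mul1r mulr1 => HJ.
have E1 : expR (energy 1 l / d) <= expR (97 / d * (1 + S)).
  rewrite ler_expR [leRHS]mulrAC ler_pM2r ?invr_gt0//.
  by have := energy_le 1 l; rewrite -/S expr1n; lra.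
have E2 : 2 ^- flats l <= (ups l).+1%:R / P.+1%:R :> R.
  rewrite ler_pdivlMr ?ltr0n// mulrC ler_pdivrMr ?exprn_gt0//.
  rewrite -natrX -natrM ler_nat.
  apply: leq_trans (_ : (ups l).+1 * (flats l).+1 <= _)%N.
    exact: U1.
  by rewrite leq_mul2l ltn_expl ?orbT.
apply: le_trans (ler_pM _ _ E2 E1) _; rewrite ?invr_ge0 ?exprn_ge0 ?expR_ge0//.
rewrite mulrAC mulrC -[leRHS]mulrA.
apply: ler_wpM2l; first by rewrite invr_ge0.
apply: (le_trans HJ); rewrite mulrA.
set A := (X in X <= _); set B := (X in _ <= _ * X).
have A0 : 0 <= A.
  rewrite /A addr_ge0 ?expR_ge0//; apply: sumr_ge0 => q _.
  by rewrite mulr_ge0 ?expR_ge0.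
have lamle : 97 / d * (ups l).+1%:R <= lam.
  rewrite /lam mulrAC ler_pM2r ?invr_gt0// ler_pM2l// ler_nat.
  exact: U2.
have AB : A <= B.
  rewrite /A /B lerD ?ler_expR//; apply: ler_sum => q _.
  by rewrite ler_wpM2l// ler_expR ler_wpM2r.
rewrite -[leLHS]mul1r; apply: ler_pM => //.
rewrite mulrC ler_pdivlMr ?exprn_gt0// mul1r; apply: ler_wiXn2l => //; exact: ltW.
Qed.

(** * Supersolution of the discounted branching recursion *)

Section Supersolution.
Variables (s lam : R).
Hypothesis sI : 0 < s <= 1.
Hypothesis lamI : 0 <= lam <= s / 6.

(** [2 c] is the fixed point of g -> 1 / (1 - x g / 4), rational in [s] because x = 1 - s^2. The
    slightly larger [th] absorbs [expR lam] and is still a supersolution; [A] sums the geometric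
    series of ratio x th^2. *)
Let x := 1 - s ^+ 2.
Let c := (1 + s)^-1.
Let th := (1 + s / 2)^-1.
Let A := (1 - x * th ^+ 2)^-1.

Let x_ge0 : 0 <= x.
Proof. by rewrite /x; move: sI; nra. Qed.

Let th_gt0 : 0 < th. Proof. by rewrite /th invr_gt0; move: sI; lra. Qed.

Let c_gt0 : 0 < c. Proof. by rewrite /c invr_gt0; move: sI; lra. Qed.

(** The gap is linear in [s], although 1 - x is quadratic; hence [A <= 2 / s]. *)
Let A_gap : s / 2 <= 1 - x * th ^+ 2.
Proof.
have : th ^+ 2 <= (1 + s)^-1.
  by rewrite /th exprVn lef_pV2 ?posrE ?exprn_gt0; move: sI; nra.
have : (1 + s)^-1 <= 1 - s / 2.
  by rewrite -[leLHS]mul1r ler_pdivrMr; move: sI; nra.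
have := exprn_ge0 2 (ltW th_gt0); have := x_ge0.
by rewrite /x; move: sI; nra.
Qed.

Let A_gt0 : 0 < A.
Proof. by rewrite /A invr_gt0; move: A_gap sI; lra. Qed.

Let xc : 1 - x * c / 2 = (2 * c)^-1.
Proof. by rewrite /x /c; field; move: sI; lra. Qed.

Let c_expR : c * expR lam <= th.
Proof.
have [s0 s1] := andP sI; have [l0 l1] := andP lamI.
rewrite /c mulrC ler_pdivrMr; last lra.
have : expR lam <= (1 - lam)^-1.
  rewrite -[expR lam]invrK -expRN lef_pV2 ?posrE ?expR_gt0//; last by lra.
  exact: expR_ge1Dx.
move=> /le_trans; apply; rewrite -[leLHS]mul1r ler_pdivrMr; last lra.
have -> : th * (1 + s) * (1 - lam) = (1 + s) * (1 - lam) / (1 + s / 2) by rewrite /th; ring.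
by rewrite ler_pdivlMr; nra.
Qed.

Let xth1 : 0 <= x * th / 2 < 1.
Proof.
have [s0 s1] := andP sI.
rewrite divr_ge0 ?mulr_ge0 ?(ltW th_gt0)//=.
have : x * th <= 1; last by lra.
rewrite /th ler_pdivrMr /x; last by lra.
by nra.
Qed.

Let xth : (1 - x * th / 2)^-1 <= 2 * th.
Proof.
have [s0 s1] := andP sI; have [xt0 xt1] := andP xth1.
rewrite -[leLHS]mul1r ler_pdivrMr; last lra.
have -> : 2 * th * (1 - x * th / 2) = 2 * th - x * th ^+ 2 by field.
rewrite -subr_ge0.
have -> : 2 * th - x * th ^+ 2 - 1 = 3 / 4 * s ^+ 2 * th ^+ 2.
  by rewrite /x /th; field; lra.
by rewrite mulr_ge0 ?sqr_ge0// mulr_ge0 ?sqr_ge0.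
Qed.

Let xc1 : 0 <= x * c / 2 < 1.
Proof.
rewrite divr_ge0 ?mulr_ge0 ?(ltW c_gt0)//=.
have : 0 < (2 * c)^-1 by rewrite invr_gt0 mulr_gt0.
by rewrite -xc; lra.
Qed.

(* The right-hand side is a supersolution of the recursion defining [psum]. *)
Lemma psum_super j r a : M%:R <= d / 8 -> 0 <= a ->
  psum j r (fun l => x ^+ ups l * (a + \sum_(q <- l) q.1%:R * expR (lam * q.1%:R))) <=
  (2 * c) ^+ r * a + A * r%:R * (2 * th) ^+ r.
Proof.
move=> Md; elim: j r a => [|j IH] r a a0.
  rewrite /= /ups !big_nil expr0 mul1r addr0 -[leLHS]addr0 lerD//.
    rewrite -[leLHS]mul1r ler_wpM2r// exprn_ege1// /c ler_pdivlMr; last by move: sI; lra.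
    by move: sI; lra.
  by rewrite !mulr_ge0 ?exprn_ge0 ?mulr_ge0// ltW.
apply: le_trans (_ : \sum_(u < M) upw r u * (x ^+ u *
   ((2 * c) ^+ u * (a + u%:R * expR (lam * u%:R)) + A * u%:R * (2 * th) ^+ u)) <= _).
  rewrite [leLHS]/=; apply: ler_sum => u _.
  apply: le_trans (_ : \sum_(k < M) kap r u k * (x ^+ u *
   ((2 * c) ^+ u * (a + u%:R * expR (lam * u%:R)) + A * u%:R * (2 * th) ^+ u)) <= _).
    apply: ler_sum => k _; rewrite ler_wpM2l ?kap_ge0//.
    (* The term of the current level joins the constant [a], and the induction hypothesis is used
       with this new constant. *)
    apply: le_trans (_ : x ^+ u * psum j u (fun l => x ^+ ups l *
        ((a + u%:R * expR (lam * u%:R)) + \sum_(q <- l) q.1%:R * expR (lam * q.1%:R))) <= _).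
      rewrite -psumZ le_eqVlt; apply/orP; left; apply/eqP; apply: psum_eq => l.
      by rewrite /ups !big_cons /= exprD -mulrA addrA.
    by rewrite ler_wpM2l ?exprn_ge0// IH// addr_ge0// mulr_ge0 ?expR_ge0.
  rewrite -mulr_suml ler_wpM2r ?kap_sum// mulr_ge0 ?exprn_ge0// addr_ge0//.
    by rewrite mulr_ge0 ?exprn_ge0 ?addr_ge0 ?mulr_ge0 ?expR_ge0// ltW.
  by rewrite !mulr_ge0 ?exprn_ge0 ?mulr_ge0// ltW.
apply: le_trans (_ : a * \sum_(u < M) 'C((r + u).-1, u)%:R * (x * c / 2) ^+ u +
   (1 + A) * \sum_(u < M) u%:R * ('C((r + u).-1, u)%:R * (x * th / 2) ^+ u) <= _).
  rewrite !mulr_sumr -big_split /=; apply: ler_sum => u _.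
  rewrite /upw.
  have e4 : (4 ^+ u : R) != 0 by rewrite expf_neq0.
  have -> : (x * c / 2) ^+ u = x ^+ u * (2 * c) ^+ u / 4 ^+ u.
    rewrite -exprMn -expr_div_n; congr (_ ^+ _); lra.
  have -> : (x * th / 2) ^+ u = x ^+ u * (2 * th) ^+ u / 4 ^+ u.
    rewrite -exprMn -expr_div_n; congr (_ ^+ _); lra.
  have H : (2 * c) ^+ u * expR (lam * u%:R) <= (2 * th) ^+ u.
    rewrite expRM_natr -exprMn; apply: lerXn2r; rewrite ?nnegrE.
    - by rewrite !mulr_ge0 ?expR_ge0// ltW.
    - by rewrite mulr_ge0// ltW.
    - by rewrite -mulrA ler_pM2l// c_expR.
  set C0 : R := 'C(_, _)%:R.
  have H2 : 0 <= C0 / 4 ^+ u * x ^+ u * u%:R by rewrite !mulr_ge0 ?invr_ge0 ?exprn_ge0.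
  have := ler_wpM2l H2 H.
  set X := (2 * c) ^+ u; set Y := (2 * th) ^+ u; set E := expR _.
  by move=> H3; lra.
apply: lerD.
  rewrite mulrC ler_wpM2r//; apply: le_trans (negbin_sum_le _ _ xc1) _.
  by rewrite xc exprVn invrK.
apply: le_trans (_ : (1 + A) * (r%:R * (x * th / 2) * (2 * th) ^+ r.+1) <= _).
  rewrite ler_wpM2l//; first by move: A_gt0; lra.
  apply: le_trans (negbin_mean_le _ _ xth1) _.
  have [xt0 xt1] := andP xth1.
  apply: ler_wpM2l; first by rewrite mulr_ge0.
  rewrite -exprVn; apply: lerXn2r xth; rewrite nnegrE.
    by rewrite invr_ge0; lra.
  by rewrite mulr_ge0// ltW.
have -> : (1 + A) * (r%:R * (x * th / 2) * (2 * th) ^+ r.+1) =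
  ((1 + A) * (x * th ^+ 2)) * (r%:R * (2 * th) ^+ r) by rewrite exprS; field.
rewrite -[leRHS]mulrA ler_wpM2r//; first by rewrite mulr_ge0 ?exprn_ge0 ?mulr_ge0// ltW.
(* The choice of [A] closes the induction: (1 + A) x th^2 = A - 1 / A <= A. *)
have AE : A * (1 - x * th ^+ 2) = 1.
  by rewrite /A mulVf// gt_eqF//; move: A_gap sI; lra.
by move: A_gap AE sI; lra.
Qed.

Lemma psum_super1 j : M%:R <= d / 8 ->
  psum j 1 (fun l => x ^+ ups l * (expR lam + \sum_(q <- l) q.1%:R * expR (lam * q.1%:R))) <=
  8 / s.
Proof.
move=> Md; have [s0 s1] := andP sI.
apply: le_trans (psum_super j 1 Md (expR_ge0 lam)) _.
rewrite !expr1 mulr1.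
have th1 : th <= 1 by rewrite /th invf_le1; lra.
have As : A <= 2 / s.
  rewrite /A -[2 / s]invrK lef_pV2 ?posrE ?invr_gt0 ?divr_gt0//.
    by rewrite invf_div.
  by move: A_gap; lra.
have A1 : 1 <= 2 / s by rewrite ler_pdivlMr; lra.
have -> : 8 / s = 4 * (2 / s) by field; rewrite gt_eqF.
have : c * expR lam <= 1 by apply: le_trans th1.
have := A_gt0; have := th_gt0; nra.
Qed.

End Supersolution.

End Profiles.

(** Pigeonhole: if the bound failed for every [p] between [P] and [2 P], the sum over [p] would
    exceed the supersolution. The size condition gives [lam <= 1 / 20]; 291 = 3 * 97 comes from 2 P
    + 1 <= 3 P. *)
Lemma Gn_exists (R : realType) j P : (9 <= P)%N -> (100 * (60 * P) <= j.+1)%N ->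
  exists2 p, (P <= p <= 2 * P)%N &
  Gn R j 1 (2 * p) <= (4 * j.+1%:R) ^+ p * (8 / (P%:R * Num.sqrt P%:R) *
    expR (12 + 432 * P%:R * (291 * P%:R / j.+1%:R) ^+ 2)).
Proof.
move=> P9 Pj; set d : R := j.+1%:R.
have d0 : 0 < d by rewrite ltr0n.
have P9R : 9 <= P%:R :> R by rewrite (ler_nat _ 9).
have PdR : 100 * (60 * P%:R) <= d by rewrite -!natrM ler_nat.
pose M := (2 * P).+1.
have ME : M%:R = 2 * P%:R + 1 :> R by rewrite /M -natr1 natrM.
have Md : M%:R <= d / 8 by rewrite ME; lra.
pose lam : R := 97 * M%:R / d.
set y : R := Num.sqrt P%:R.
have y2 : y ^+ 2 = P%:R by rewrite sqr_sqrtr.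
have y0 : 0 <= y by apply: sqrtr_ge0.
have y3 : 3 <= y by move: y2 y0 P9R; nra.
have yV : y^-1 <= 1 / 3.
  by rewrite div1r lef_pV2 ?posrE//; lra.
have yV0 : 0 < y^-1 by rewrite invr_gt0; lra.
have yVP : P%:R * (y^-1) ^+ 2 = 1.
  by rewrite -y2 -exprMn mulfV ?expr1n// gt_eqF//; lra.
have lam0 : 0 <= lam by rewrite /lam !mulr_ge0 ?invr_ge0 1?ltW.
have lamP : lam <= 291 * P%:R / d.
  by rewrite /lam ler_pM2r ?invr_gt0// ME; lra.
have lam1 : lam <= 1 / 20.
  by apply: (le_trans lamP); rewrite ler_pdivrMr//; lra.
(* [6 lam] is what the supersolution requires; P^(-1/2) balances the loss [8 / s] against x^(-2 P),
   which is at most exp(4 P s^2). *)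
pose s := 6 * lam + y^-1.
have sI : 0 < s <= 1 by rewrite /s; apply/andP; split; lra.
have lamI : 0 <= lam <= s / 6 by rewrite /s; apply/andP; split; lra.
have s2 : s ^+ 2 <= 1 / 2.
  have : s <= 2 / 3 by rewrite /s; lra.
  by move: sI => /andP[]; nra.
pose x := 1 - s ^+ 2.
have s2p : 0 <= s ^+ 2 by apply: sqr_ge0.
have x0 : 0 < x by rewrite /x; lra.
have xI : 0 < x <= 1 by rewrite x0 /x; lra.
set EE := expR _.
pose B := 8 / (P%:R * y) * EE.
apply: contrapT => noex.
have {}noex p : (P <= p <= 2 * P)%N -> (4 * d) ^+ p * B < Gn R j 1 (2 * p).
  by move=> pI; rewrite ltNge; apply/negP => H; apply: noex; exists p.
have d4 n : 0 < (4 * d) ^+ n by rewrite exprn_gt0 ?mulr_gt0.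
have B0 : 0 < B.
  have Py : 0 < P%:R * y by apply: mulr_gt0; lra.
  by rewrite /B mulr_gt0 ?expR_gt0// divr_gt0.
have low : B * P.+1%:R <= \sum_(P <= p < M) psum d M j.+1 1 (wt d 1 p).
  have -> : B * P.+1%:R = \sum_(P <= p < M) B.
    by rewrite sumr_const_nat mulr_natr /M mul2n -addnn -addSn addnK.
  apply: ler_sum_nat => p pI.
  rewrite -(ler_pM2l (d4 p)); apply: le_trans (ltW (noex p _)) _; first by move: pI; rewrite /M ltnS.
  by apply: Gn_psum => //; case/andP: pI.
have up : \sum_(P <= p < M) psum d M j.+1 1 (wt d 1 p) <=
    (P.+1%:R^-1 * x ^- (2 * P)) * (8 / s).
  rewrite -psum_sum; apply: le_trans (_ : psum d M j.+1 1 (fun l => (P.+1%:R^-1 * x ^- (2 * P)) *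
     (x ^+ ups l * (expR lam + \sum_(q <- l) q.1%:R * expR (lam * q.1%:R)))) <= _).
    by apply: psum_le => // l; apply: sum_wt_le.
  rewrite psumZ ler_wpM2l//; first by rewrite mulr_ge0 ?invr_ge0 ?exprn_ge0// ltW.
  exact: psum_super1.
have xE : x ^- (2 * P) <= EE.
  have x1 : x^-1 <= expR (2 * s ^+ 2).
    rewrite -[leLHS]mul1r ler_pdivrMr//.
    have := expR_ge1Dx (2 * s ^+ 2).
    by rewrite /x; nra.
  rewrite -exprVn; apply: le_trans (_ : expR (2 * s ^+ 2) ^+ (2 * P) <= _).
    by apply: lerXn2r => //; rewrite nnegrE ?expR_ge0// invr_ge0 ltW.
  rewrite -expRM_natl ler_expR natrM.
  have : s ^+ 2 <= 72 * lam ^+ 2 + 2 * (y^-1) ^+ 2.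
    by rewrite /s; have := sqr_ge0 (6 * lam - y^-1); nra.
  have : lam ^+ 2 <= (291 * P%:R / d) ^+ 2.
    by move: lamP lam0; set v := 291 * _ / _ => /[swap]; clear; nra.
  set Z := (291 * P%:R / d) ^+ 2 => H1 H2.
  have H3 : s ^+ 2 <= 72 * Z + 2 * y^-1 ^+ 2 by lra.
  have PZ : 0 <= P%:R * Z by rewrite mulr_ge0// sqr_ge0.
  have := ler_wpM2l (ler0n R P) H3.
  have -> : P%:R * (72 * Z + 2 * y^-1 ^+ 2) = 72 * (P%:R * Z) + 2 * (P%:R * y^-1 ^+ 2) by ring.
  rewrite yVP.
  have -> : 2 * P%:R * (2 * s ^+ 2) = 4 * (P%:R * s ^+ 2) :> R by ring.
  have -> : 432 * P%:R * Z = 432 * (P%:R * Z) :> R by ring.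
  by move: PZ; lra.
have := le_trans low up; apply/negP; rewrite -ltNge.
have sV : 8 / s <= 8 * y.
  rewrite ler_pM2l// -[y]invrK lef_pV2 ?posrE//; first by rewrite /s; lra.
  by case/andP: sI.
apply: le_lt_trans (_ : P.+1%:R^-1 * EE * (8 * y) < _).
  apply: ler_pM => //.
  - by rewrite mulr_ge0 ?invr_ge0 ?exprn_ge0// ltW.
  - by rewrite divr_ge0//; case/andP: sI => /ltW.
  - by rewrite ler_wpM2l ?invr_ge0.
rewrite /B.
have P1 : P.+1%:R = P%:R + 1 :> R by rewrite -natr1.
have EE0 : 0 < EE by apply: expR_gt0.
have -> : P.+1%:R^-1 * EE * (8 * y) = (8 * EE) * (y / (P%:R + 1)) by rewrite P1; field; lra.
have -> : 8 / (P%:R * y) * EE * P.+1%:R = (8 * EE) * ((P%:R + 1) / (P%:R * y)).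
  by rewrite P1; field; lra.
rewrite ltr_pM2l ?mulr_gt0//.
rewrite ltr_pdivrMr; last lra.
rewrite mulrAC ltr_pdivlMr; last by apply: mulr_gt0; lra.
have -> : y * (P%:R * y) = P%:R * P%:R by rewrite mulrCA -expr2 y2.
by clear -P9R; nra.
Qed.

(** * Pairings *)

Definition delk (T : Type) k (s : seq T) := take k s ++ drop k.+1 s.

Lemma size_delk T k (s : seq T) : (k < size s)%N -> size (delk k s) = (size s).-1.
Proof. by move=> ks; rewrite size_cat size_drop size_takel; lia. Qed.

Lemma map_delk T T' (f : T -> T') k s : map f (delk k s) = delk k (map f s).
Proof. by rewrite map_cat map_take map_drop. Qed.

Lemma delk_cons0 T (x : T) s : delk 0 (x :: s) = s.
Proof. by rewrite /delk take0 /= drop0. Qed.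

Lemma delk_consS T (x : T) k s : delk k.+1 (x :: s) = x :: delk k s.
Proof. by []. Qed.

Lemma perm_delk (T : eqType) x k (s : seq T) : (k < size s)%N ->
  perm_eq s (nth x s k :: delk k s).
Proof.
move=> ks; rewrite -{1}(cat_take_drop k s) (drop_nth x ks) /delk.
by rewrite -cat1s perm_catCA.
Qed.

Lemma subseq_delk (T : eqType) k (s : seq T) : subseq (delk k s) s.
Proof.
elim: s k => [|x s IH] [|k] //; first by rewrite delk_cons0 subseq_cons.
by rewrite delk_consS /= eqxx.
Qed.

Section Wick.
Variable R : realType.

(* Isserlis' recursion for the moments of a centered Gaussian family with
   covariance [C], with [n] as fuel. *)
Fixpoint wk (L : Type) (C : L -> L -> R) (n : nat) (s : seq L) : R :=
  if s is e :: s' then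
    if n is n'.+1 then \sum_(k < size s') C e (nth e s' k) * wk C n' (delk k s')
    else 0
  else 1.

Definition wick (L : Type) (C : L -> L -> R) (s : seq L) : R := wk C (size s) s.

Lemma wk_wick L (C : L -> L -> R) n s : (size s <= n)%N -> wk C n s = wick C s.
Proof.
rewrite /wick; have [m] := ubnP (size s).
elim: m n s => // m IH [|n] [|e s] //=; rewrite !ltnS => sm sn.
apply: eq_bigr => k _; have ks : (size (delk k s) = (size s).-1)%N by rewrite size_delk.
have kl := ltn_ord k.
by rewrite [wk C n _]IH ?ks; [rewrite [wk C (size s) _]IH ?ks| |] => //; lia.
Qed.

Lemma wick_nil L (C : L -> L -> R) : wick C [::] = 1.
Proof. by []. Qed.

Lemma wick_cons L (C : L -> L -> R) e s :
  wick C (e :: s) = \sum_(k < size s) C e (nth e s k) * wick C (delk k s).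
Proof.
rewrite {1}/wick /=; apply: eq_bigr => k _; rewrite wk_wick// size_delk//; lia.
Qed.

Lemma wick_map L L' (C : L -> L -> R) (f : L' -> L) s :
  wick C (map f s) = wick (fun a b => C (f a) (f b)) s.
Proof.
have [m] := ubnP (size s); elim: m s => // m IH [|e s] //=; rewrite ltnS => sm.
rewrite !wick_cons size_map; apply: eq_bigr => k _.
rewrite -map_delk (nth_map e)// IH// size_delk//; lia.
Qed.

Lemma wick_ext L (C C' : L -> L -> R) s : (forall a b, C a b = C' a b) ->
  wick C s = wick C' s.
Proof.
by move=> CC'; congr wick; apply/funext => a; apply/funext => b.
Qed.

(** Letters pair only within a class of [key], and within one class the pairing recursion is that of
    [gmom]. *)
Lemma wick_count (L : eqType) (K : finType) (key : L -> K) (V : K -> R) s :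
  wick (fun e f => V (key e) * (key e == key f)%:R) s =
  \prod_a gmom (V a) (count (fun e => key e == a) s).
Proof.
pose C (e f : L) : R := V (key e) * (key e == key f)%:R; rewrite -[wick _ s]/(wick C s).
have [m] := ubnP (size s); elim: m s => // m IH [|e s] /=; rewrite ltnS => sm.
  by rewrite wick_nil big1.
rewrite wick_cons.
rewrite [RHS](bigD1 (key e))//= eqxx add1n.
set P := \prod_(i | i != key e) _; set c := count _ s.
have -> : \sum_(k < size s) C e (nth e s k) * wick C (delk k s) =
  \sum_(k < size s) (key e == key (nth e s k))%:R * (V (key e) * gmom (V (key e)) c.-1 * P).
  apply: eq_bigr => k _; rewrite /C; case: eqP => [kk|]; last by rewrite mulr0 !mul0r.
  rewrite mulr1 mul1r -mulrA; congr (_ * _).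
  rewrite IH; last by rewrite size_delk//; lia.
  have cnt a : count (fun e => key e == a) s =
     ((key e == a) + count (fun e => key e == a) (delk k s))%N.
    by have /permP-> := perm_delk e (ltn_ord k); rewrite /= kk.
  rewrite (bigD1 (key e))//= /c cnt eqxx add1n /=; congr (_ * _).
  apply: eq_bigr => a; rewrite eq_sym => /negPf ae.
  by rewrite cnt ae !add0n.
rewrite -mulr_suml -natr_sum.
have -> : (\sum_(i < size s) (key e == key (nth e s i)) = c)%N.
  rewrite /c -sum1_count (big_nth e) big_mkord [in RHS]big_mkcond /=.
  by apply: eq_bigr => i _; rewrite eq_sym; case: eqP.
rewrite !mulrA; congr (_ * _).
  by case: c => [|c] /=; rewrite ?mul0r// mulrA.
Qed.

(** A product of linear forms [cs] expanded by multilinearity, [E] being applied to the resulting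
    words. *)
Fixpoint lin (L : finType) (cs : seq (L -> R)) (E : seq L -> R) : R :=
  if cs is c :: cs' then \sum_l c l * lin cs' (fun s => E (l :: s)) else E [::].

Lemma eq_lin (L : finType) (cs : seq (L -> R)) E E' :
  (forall s, size s = size cs -> E s = E' s) -> lin cs E = lin cs E'.
Proof.
elim: cs E E' => [|c cs IH] E E' EE' /=; first exact: EE'.
by apply: eq_bigr => l _; congr (_ * _); apply: IH => s ss; rewrite EE'//= ss.
Qed.

Lemma linZ (L : finType) (cs : seq (L -> R)) a E : lin cs (fun s => a * E s) = a * lin cs E.
Proof.
elim: cs E => [|c cs IH] E //=; rewrite mulr_sumr.
by apply: eq_bigr => l _; rewrite IH mulrCA.
Qed.

Lemma linD (L : finType) (cs : seq (L -> R)) E E' :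
  lin cs (fun s => E s + E' s) = lin cs E + lin cs E'.
Proof.
elim: cs E E' => [|c cs IH] E E' //=; rewrite -big_split /=.
by apply: eq_bigr => l _; rewrite IH mulrDr.
Qed.

(** A contraction at one position factors out of the expansion; [wick_cons] is a sum of such
    contractions. *)
Lemma lin_delk (L : finType) (cs : seq (L -> R)) (D : L -> R) E e0 c0 :
  lin cs (fun s => \sum_(k < size cs) D (nth e0 s k) * E (delk k s)) =
  \sum_(k < size cs) (\sum_l nth c0 cs k l * D l) * lin (delk k cs) E.
Proof.
elim: cs E => [|c cs IH] E /=; first by rewrite !big_ord0.
have H l : lin cs (fun s => \sum_(k < (size cs).+1) D (nth e0 (l :: s) k) * E (delk k (l :: s))) =
    D l * lin cs E + lin cs (fun s => \sum_(k < size cs) D (nth e0 s k) * E (l :: delk k s)).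
  rewrite -linZ -linD; apply: eq_lin => s _.
  by rewrite big_ord_recl /= delk_cons0.
under eq_bigr do rewrite H mulrDr.
rewrite big_split /= [RHS]big_ord_recl; congr (_ + _).
  by rewrite /= delk_cons0 mulr_suml; apply: eq_bigr => l _; rewrite mulrA.
transitivity (\sum_l c l * \sum_(k < size cs)
   (\sum_l nth c0 cs k l * D l) * lin (delk k cs) (fun s => E (l :: s))).
  by apply: eq_bigr => l _; congr (_ * _); exact: IH.
under eq_bigr do rewrite mulr_sumr.
rewrite exchange_big /=; apply: eq_bigr => k _.
rewrite mulr_sumr; apply: eq_bigr => l _; ring.
Qed.

(** Wick's formula commutes with linear substitutions, the covariance being transported bilinearly;
    rotation invariance rests on this. *)
Lemma lin_wick (L : finType) (C : L -> L -> R) (cs : seq (L -> R)) :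
  lin cs (wick C) =
  wick (fun c c' => \sum_l \sum_l' c l * c' l' * C l l') cs.
Proof.
have [m] := ubnP (size cs); elim: m cs => // m IH [|c cs] //=; rewrite ltnS => sm.
rewrite wick_cons.
transitivity (\sum_l c l * \sum_(k < size cs)
   (\sum_l' nth c cs k l' * C l l') * lin (delk k cs) (wick C)).
  apply: eq_bigr => l _; congr (_ * _); rewrite -(@lin_delk _ _ _ _ l).
  by apply: eq_lin => s ss; rewrite wick_cons ss.
under eq_bigr do rewrite mulr_sumr.
rewrite exchange_big /=; apply: eq_bigr => k _.
rewrite -IH ?size_delk//; last lia.
rewrite mulr_suml; apply: eq_bigr => l _.
rewrite mulrA; congr (_ * _).
by rewrite mulr_sumr; apply: eq_bigr => l' _; rewrite mulrA.
Qed.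

End Wick.

(** * Comparison of closed walks *)

Section Pairings.
Variable R : realType.

(* Pairings of the letters of a word, each pair carrying an orientation. *)
Fixpoint prs (n : nat) (s : seq nat) : seq (seq (nat * nat * bool)) :=
  if s is a :: s' then
    if n is n'.+1 then
      [seq (a, nth a s' ke.1, ke.2) :: t |
         ke <- [seq (k, e) | k <- iota 0 (size s'), e <- [:: false; true]],
         t <- prs n' (delk ke.1 s')]
    else [::]
  else [:: [::]].

(** The two terms of the covariance become the two orientations of a pair. *)
Lemma wk_prs (W : nat -> R) (D : bool -> nat -> nat -> R) n s :
  wk (fun a b => W a * (D false a b + D true a b)) n s =
  \sum_(t <- prs n s) \prod_(q <- t) (W q.1.1 * D q.2 q.1.1 q.1.2).
Proof.
elim: n s => [|n IH] [|a s].
- by rewrite /= big_seq1 big_nil.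
- by rewrite /= big_nil.
- by rewrite /= big_seq1 big_nil.
have -> : prs n.+1 (a :: s) = [seq (a, nth a s ke.1, ke.2) :: t |
     ke <- [seq (k, e) | k <- iota 0 (size s), e <- [:: false; true]],
     t <- prs n (delk ke.1 s)] by [].
rewrite big_allpairs_dep big_allpairs_dep [LHS]/=.
have iotaE m : iota 0 m = index_iota 0 m by rewrite /index_iota subn0.
rewrite [in RHS]iotaE big_mkord.
apply: eq_bigr => k _; rewrite big_cons big_seq1 /=.
under eq_bigr do rewrite big_cons /=.
under [X in _ = _ + X]eq_bigr do rewrite big_cons /=.
by rewrite -!mulr_sumr -!IH; ring.
Qed.

Lemma prs_cons n a s t : t \in prs n.+1 (a :: s) ->
  exists k e t', [/\ (k < size s)%N, t' \in prs n (delk k s) &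
                     t = (a, nth a s k, e) :: t'].
Proof.
move=> /allpairsPdep[[k e] [t' [ke t't ->]]]; exists k, e, t'.
have /allpairsPdep[k' [e' [k'1 _ [E _]]]] := ke.
by move: k'1; rewrite -E mem_iota.
Qed.

Lemma prs_ltn n s t : sorted ltn s -> t \in prs n s ->
  all (fun q => [&& (q.1.1 < q.1.2)%N, q.1.1 \in s & q.1.2 \in s]) t.
Proof.
elim: n s t => [|n IH] [|a s] t //.
- by rewrite mem_seq1 => _ /eqP->.
- by rewrite mem_seq1 => _ /eqP->.
move=> /= as_ /prs_cons[k [e [t' [ks t't ->]]]] /=.
have nths : nth a s k \in s by rewrite mem_nth.
rewrite mem_head inE nths orbT.
have as2 : {in s, forall y, (a < y)%N}.
  by apply/allP; apply: order_path_min as_; exact: ltn_trans.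
rewrite as2//=; have := IH _ _ _ t't.
have sub := subseq_delk k s.
move=> /(_ (subseq_sorted ltn_trans sub (path_sorted as_))).
apply: sub_all => q /and3P[-> q1 q2] /=.
by rewrite !inE !(mem_subseq sub) ?orbT.
Qed.

Lemma prs_prod n s t (g : nat -> R) : t \in prs n s ->
  \prod_(k <- s) g k = \prod_(q <- t) (g q.1.1 * g q.1.2).
Proof.
elim: n s t => [|n IH] [|a s] t //.
- by rewrite mem_seq1 => /eqP->; rewrite !big_nil.
- by rewrite mem_seq1 => /eqP->; rewrite !big_nil.
move=> /prs_cons[k [e [t' [ks t't ->]]]]; rewrite !big_cons/= -(IH _ _ t't).
by rewrite (perm_big _ (perm_delk a ks)) /= big_cons mulrA.
Qed.

End Pairings.

Section WalkSums.
Variable R : realType.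

Fixpoint wsum (T : finType) (N : nat) (h : seq T) (Phi : seq T -> R) : R :=
  if N is N'.+1 then \sum_z wsum N' (rcons h z) Phi else Phi h.

Lemma wsum_le (T : finType) N (h : seq T) Phi Psi :
  (forall w, size w = N -> Phi (h ++ w) <= Psi (h ++ w)) ->
  wsum N h Phi <= wsum N h Psi.
Proof.
elim: N h => [|N IH] h H /=; first by have := H [::] erefl; rewrite cats0.
apply: ler_sum => z _; apply: IH => w wN.
by rewrite cat_rcons; apply: H; rewrite /= wN.
Qed.

Lemma eq_wsum (T : finType) N (h : seq T) Phi Psi :
  (forall w, size w = N -> Phi (h ++ w) = Psi (h ++ w)) ->
  wsum N h Phi = wsum N h Psi.
Proof. by move=> H; apply: le_anti; rewrite !wsum_le// => w /H->. Qed.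

Lemma wsumZ (T : finType) N (h : seq T) a Phi :
  wsum N h (fun s => a * Phi s) = a * wsum N h Phi.
Proof.
elim: N h => [|N IH] h //=; rewrite mulr_sumr.
by apply: eq_bigr => z _; rewrite IH.
Qed.

Lemma wsum_sum (T : finType) N (h : seq T) (I : Type) (r : seq I) (P : pred I) Phi :
  wsum N h (fun s => \sum_(i <- r | P i) Phi i s) =
  \sum_(i <- r | P i) wsum N h (Phi i).
Proof.
elim: N h => [|N IH] h //=; rewrite exchange_big /=.
by apply: eq_bigr => z _; rewrite IH.
Qed.

Lemma wsum_ge0 (T : finType) N (h : seq T) Phi :
  (forall s, 0 <= Phi s) -> 0 <= wsum N h Phi.
Proof.
by move=> H; elim: N h => [|N IH] h //=; apply: sumr_ge0.
Qed.

Section Equations.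
Variable eqs : seq (nat * nat).

Definition sat (T : eqType) (x : T) (h : seq T) : bool :=
  all (fun e => nth x h e.1 == nth x h e.2) eqs.

(** The equivalence generated by the equations, defined semantically so that no chains need
    handling. Labels in a finite type reduce to numbers by [pickle] in [sat_eqv]. *)
Definition eqv (k l : nat) : bool :=
  `[< forall f : nat -> nat, {in eqs, forall e, f e.1 = f e.2} -> f k = f l >].

Lemma eqv_sym k l : eqv k l -> eqv l k.
Proof. by move=> /asboolP H; apply/asboolP => f /H. Qed.

Lemma eqv_trans k l j : eqv k l -> eqv l j -> eqv k j.
Proof.
by move=> /asboolP H1 /asboolP H2; apply/asboolP => f H; rewrite H1// H2.
Qed.

Lemma eqs_eqv e : e \in eqs -> eqv e.1 e.2.
Proof. by move=> ee; apply/asboolP => f; apply. Qed.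

Lemma sat_eqv (T : finType) (x : T) h k l :
  sat x h -> eqv k l -> nth x h k = nth x h l.
Proof.
move=> /allP sath /asboolP /(_ (fun k => pickle (nth x h k))) H.
apply: (pcan_inj pickleK); apply: H => e /sath /eqP ee; by rewrite ee.
Qed.

(** The least positions of the classes: the only free choices when a walk is built from left to
    right. *)
Definition fresh (k : nat) : bool := ~~ has (eqv^~ k) (iota 0 k).

(** Unlike [sat], suited to an initial segment of a walk: it tests all consequences between the
    positions present, even those derived through later positions. *)
Definition compat (T : eqType) (x : T) (h : seq T) : bool :=
  all (fun k => all (fun l => eqv k l ==> (nth x h k == nth x h l))
                    (iota 0 (size h))) (iota 0 (size h)).

Lemma compatP (T : eqType) (x : T) h :
  reflect (forall k l, (k < size h)%N -> (l < size h)%N -> eqv k l -> nth x h k = nth x h l)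
          (compat x h).
Proof.
apply: (iffP allP) => [H k l ks ls kl|H k].
  have /allP/(_ l) : all (fun l => eqv k l ==> (nth x h k == nth x h l)) (iota 0 (size h)).
    by apply: H; rewrite mem_iota.
  by rewrite mem_iota => /(_ ls); rewrite kl => /eqP.
rewrite mem_iota => ks; apply/allP => l; rewrite mem_iota => ls.
by apply/implyP => kl; apply/eqP; exact: H.
Qed.

Lemma freshPn k : ~~ fresh k -> exists2 l, (l < k)%N & eqv l k.
Proof. by rewrite negbK => /hasP[l]; rewrite mem_iota => lk H; exists l. Qed.

Lemma freshN l k : (l < k)%N -> eqv l k -> fresh k = false.
Proof. by move=> lk H; apply/negbTE; rewrite negbK; apply/hasP; exists l; rewrite ?mem_iota. Qed.

(** A fresh vertex is summed against a row of [B]; any other position must repeat an earlier label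
    and carries weight 1. *)
Lemma wsum_compat_le (T : finType) (x : T) (B : T -> T -> R) (m : R) N h :
  (forall y z, 0 <= B y z) -> (forall y, \sum_z B y z <= m) -> 0 <= m ->
  (0 < size h)%N ->
  wsum N h (fun h' => (compat x h')%:R * \prod_(k <- iota (size h) N)
    (if fresh k then B (nth x h' k.-1) (nth x h' k) else 1)) <=
  m ^+ count fresh (iota (size h) N).
Proof.
move=> B0 Bm m0; elim: N h => [|N IH] h h0 /=.
  by rewrite big_nil expr0 mulr1; case: compat.
set Psi := fun h' => (compat x h')%:R * \prod_(k <- iota (size h).+1 N)
   (if fresh k then B (nth x h' k.-1) (nth x h' k) else 1).
have Psi0 h' : 0 <= Psi h'.
  by rewrite mulr_ge0//; apply: prodr_ge0 => k _; case: ifP.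
have IHz z : wsum N (rcons h z) Psi <= m ^+ count fresh (iota (size h).+1 N).
  by have := IH (rcons h z); rewrite size_rcons => /(_ isT).
have [fr|/freshPn[l ls lE]] := boolP (fresh (size h)).
  rewrite exprD expr1.
  apply: le_trans (_ : \sum_z B (nth x h (size h).-1) z * m ^+ count fresh (iota (size h).+1 N) <= _);
    last by rewrite -mulr_suml ler_wpM2r ?exprn_ge0.
  apply: ler_sum => z _; apply: le_trans (ler_wpM2l (B0 _ _) (IHz z)).
  rewrite -wsumZ; apply: wsum_le => w wN.
  rewrite big_cons fr cat_rcons !nth_cat ltnn subnn /=.
  have -> : ((size h).-1 < size h)%N by lia.
  by rewrite /Psi mulrCA.
rewrite add0n; set z0 := nth x h l.
apply: le_trans (_ : \sum_z (z == z0)%:R * m ^+ count fresh (iota (size h).+1 N) <= _); last first.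
  rewrite -mulr_suml (bigD1 z0)//= eqxx big1 ?addr0 ?mul1r//.
  by move=> z /negPf->.
apply: ler_sum => z _; apply: le_trans (ler_wpM2l (ler0n _ _) (IHz z)).
rewrite -wsumZ; apply: wsum_le => w wN; rewrite big_cons.
rewrite (freshN ls lE) mul1r -/(Psi (rcons h z ++ w)).
case: (eqVneq z z0) => [_|zz0]; first by rewrite mul1r.
rewrite mul0r /Psi; case: (compatP x (rcons h z ++ w)) => [cp|_]; last by rewrite mul0r.
have := cp l (size h); rewrite cat_rcons size_cat /= !nth_cat ltnn subnn ls /=.
have -> : (l < size h + (size w).+1)%N by lia.
have -> : (size h < size h + (size w).+1)%N by lia.
by move=> /(_ isT isT lE) E; rewrite -E /z0 eqxx in zz0.
Qed.

Lemma compat_rcons (T : eqType) (x : T) h z : compat x h ->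
  (forall l, (l < size h)%N -> eqv l (size h) -> nth x h l = z) ->
  compat x (rcons h z).
Proof.
move=> /compatP ch hz; apply/compatP => k l; rewrite size_rcons !ltnS => ks ls kl.
have nthE i : (i <= size h)%N -> nth x (rcons h z) i = if (i < size h)%N then nth x h i else z.
  by rewrite nth_rcons; case: ltngtP.
rewrite !nthE//; case: (ltnP k) => ks'; case: (ltnP l) => ls' //.
- exact: ch.
- by apply: hz => //; have -> : size h = l by lia.
- have kE : size h = k by lia.
  by symmetry; apply: hz => //; rewrite kE; exact: eqv_sym.
Qed.

(** A fresh position takes any label and the others copy an earlier one, so the exponent is the same
    as in [wsum_compat_le]. *)
Lemma wsum_compat_ge (T : finType) (x : T) N h : compat x h ->
  #|T|%:R ^+ count fresh (iota (size h) N) <= wsum N h (fun h' => (compat x h')%:R) :> R.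
Proof.
elim: N h => [|N IH] h ch /=; first by rewrite ch expr0.
have [fr|/freshPn[l ls lE]] := boolP (fresh (size h)).
  rewrite exprD expr1.
  apply: le_trans (_ : \sum_(z : T) #|T|%:R ^+ count fresh (iota (size h).+1 N) <= _).
    by rewrite sumr_const mulr_natl.
  apply: ler_sum => z _; have := IH (rcons h z); rewrite size_rcons; apply.
  apply: compat_rcons => // l ls lE; case/negP: fr; apply/hasP.
  by exists l; rewrite ?mem_iota.
rewrite add0n (bigD1 (nth x h l))//=.
have := IH (rcons h (nth x h l)); rewrite size_rcons => H.
rewrite -[leLHS]addr0 lerD//; last first.
  by apply: sumr_ge0 => z _; apply: wsum_ge0.
apply: H; apply: compat_rcons => // l' l's l'E.
by move/compatP: ch; apply => //; apply: eqv_trans l'E (eqv_sym lE).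
Qed.

Lemma compat_sat (T : eqType) (x : T) h :
  all (fun e => (e.1 < size h)%N && (e.2 < size h)%N) eqs -> compat x h -> sat x h.
Proof.
move=> /allP eqsh /compatP ch; apply/allP => e ee.
by have /andP[e1 e2] := eqsh e ee; apply/eqP; apply: ch => //; exact: eqs_eqv.
Qed.

End Equations.

Definition edges (T : Type) (x : T) (h : seq T) (N : nat) : seq (T * T) :=
  [seq (nth x h k, nth x h k.+1) | k <- iota 0 N].

(* Covariance of the entries of a symmetric Gaussian matrix with variance
   profile [B], doubled on the diagonal. *)
Definition gcov (T : eqType) (B : T -> T -> R) (e f : T * T) : R :=
  B e.1 e.2 * ((e == f)%:R + (e == (f.2, f.1))%:R).

Let pair_eqs (q : nat * nat * bool) : seq (nat * nat) :=
  if q.2 then [:: (q.1.1, q.1.2.+1); (q.1.1.+1, q.1.2)]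
  else [:: (q.1.1, q.1.2); (q.1.1.+1, q.1.2.+1)].

Let orient (T : eqType) (x : T) (h : seq T) (e : bool) (a b : nat) : R :=
  (sat (pair_eqs (a, b, e)) x h)%:R.

Let gcov_edges (T : finType) (B : T -> T -> R) x h N :
  wick (gcov B) (edges x h N) =
  \sum_(t <- prs N (iota 0 N)) \prod_(q <- t)
    (B (nth x h q.1.1) (nth x h q.1.1.+1) * orient x h q.2 q.1.1 q.1.2).
Proof.
rewrite /edges wick_map -(wk_prs (fun a => B (nth x h a) (nth x h a.+1)) (orient x h)).
rewrite wk_wick ?size_iota//; apply: wick_ext => a b.
rewrite /gcov /orient /sat /= !andbT !xpair_eqE; congr (_ * (_ + _)).
Qed.

(** Both sides are sums over the same oriented pairings, and a pairing imposes the same vertex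
    equations on both. They are compared pairing by pairing through the number [nu] of fresh
    positions. *)
Theorem walk_compare (n m N : nat) (B : 'I_n -> 'I_n -> R) (x : 'I_n) :
  (forall y z, 0 <= B y z <= 1) -> (forall y, \sum_z B y z <= m.+1%:R) ->
  wsum N [:: x] (fun h => (nth x h N == x)%:R * wick (gcov B) (edges x h N)) <=
  wsum N [:: ord0 : 'I_m.+1] (fun h => (nth ord0 h N == ord0)%:R *
     wick (gcov (fun _ _ => 1)) (edges ord0 h N)).
Proof.
move=> B01 Bm.
have expand (T : finType) (C : T -> T -> R) (y : T) :
    (fun h => (nth y h N == y)%:R * wick (gcov C) (edges y h N)) =
    (fun h => \sum_(t <- prs N (iota 0 N)) (nth y h N == y)%:R * \prod_(q <- t)
      (C (nth y h q.1.1) (nth y h q.1.1.+1) * orient y h q.2 q.1.1 q.1.2)).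
  by apply/funext => h; rewrite gcov_edges mulr_sumr.
rewrite !expand {expand}.
rewrite !wsum_sum big_seq [leRHS]big_seq; apply: ler_sum => t tN.
(* The pair [(N, 0)] closes the walk. *)
pose eqs := (N, 0%N) :: flatten [seq pair_eqs q | q <- t].
have satE (T : finType) (y : T) w :
   (nth y (y :: w) N == y)%:R * \prod_(q <- t) orient y (y :: w) q.2 q.1.1 q.1.2 =
   (sat eqs y (y :: w))%:R :> R.
  rewrite /eqs /sat /= -mulnb natrM; congr (_ * _).
  elim: (t) => [|[[a b] e] t' IH]; first by rewrite big_nil.
  by rewrite big_cons IH /= all_cat -mulnb natrM.
have tlt := prs_ltn (iota_ltn_sorted 0 N) tN.
have eqsN : all (fun e => (e.1 < N.+1)%N && (e.2 < N.+1)%N) eqs.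
  rewrite /eqs /= ltnSn ltn0Sn /=.
  elim: (t) tlt => [|[[a b] e] t' IH] //= /andP[/and3P[ab]].
  rewrite !mem_iota /= add0n => aN bN /IH H.
  by rewrite all_cat H andbT /pair_eqs; case: e => /=; lia.
set nu := count (fresh eqs) (iota 1 N).
apply: le_trans (_ : m.+1%:R ^+ nu <= _); last first.
  apply: le_trans (_ : wsum N [:: ord0 : 'I_m.+1] (fun h' => (compat eqs ord0 h')%:R) <= _).
    rewrite -[X in X%:R ^+ _](card_ord m.+1).
    apply: (@wsum_compat_ge eqs 'I_m.+1 ord0 N [:: ord0]).
    by apply/compatP => [[|k]] [|l].
  apply: wsum_le => w wN; rewrite cat1s big_split /= big1// mul1r satE.
  have : compat eqs ord0 (ord0 :: w) -> sat eqs ord0 (ord0 :: w).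
    by apply: compat_sat; rewrite /= wN.
  by case: compat => // /(_ isT)->.
apply: le_trans (@wsum_compat_le eqs _ x B m.+1%:R N [:: x] _ Bm (ler0n _ _) isT); last first.
  by move=> y z; case/andP: (B01 y z).
apply: wsum_le => w wN; rewrite cat1s big_split /= mulrCA satE mulrC.
have [sth|_] := boolP (sat eqs x (x :: w)); last first.
  rewrite mul0r mulr_ge0//; apply: prodr_ge0 => k _; case: ifP => // _.
  by case/andP: (B01 (nth x (x :: w) k.-1) (nth x (x :: w) k)).
have -> : compat eqs x (x :: w) by apply/compatP => k l _ _; exact: sat_eqv.
rewrite !mul1r.
set g := fun k => if fresh eqs k.+1 then B (nth x (x :: w) k) (nth x (x :: w) k.+1) else 1.
have -> : \prod_(k <- iota 1 N) (if fresh eqs k then B (nth x (x :: w) k.-1) (nth x (x :: w) k) else 1)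
   = \prod_(k <- iota 0 N) g k.
  by rewrite -[1%N]addn0 iotaDl big_map; apply: eq_bigr.
rewrite (prs_prod g tN) [leLHS]big_seq [leRHS]big_seq; apply: ler_prod => q qt.
have /andP[W0 W1] := B01 (nth x (x :: w) q.1.1) (nth x (x :: w) q.1.1.+1).
rewrite W0 /=.
(* The second edge of a pair ends at a vertex already met on the first edge, so it is not fresh. The
   weight of the first edge is used if that edge ends at a fresh position and bounded by 1
   otherwise. *)
have -> : g q.1.2 = 1.
  have /allP/(_ q qt)/and3P[ab _ _] := tlt.
  have sube e : e \in pair_eqs q -> e \in eqs.
    by move=> eq; rewrite inE; apply/orP; right; apply/flatten_mapP; exists q.
  case: q ab {qt W0 W1} sube => [[a b] [|]] /= ab sube; rewrite /g.
    rewrite (@freshN _ a)//=; first exact: ltnW.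
    by apply: (@eqs_eqv eqs (a, b.+1)); apply: sube; rewrite mem_head.
  rewrite (@freshN _ a.+1)//=.
  by apply: (@eqs_eqv eqs (a.+1, b.+1)); apply: sube; rewrite !inE eqxx orbT.
by rewrite mulr1 /g; case: ifP.
Qed.

End WalkSums.

(** * The Gaussian orthogonal ensemble as a moment functional *)

Section WeightedPoints.
Variable R : realType.

(* Finite signed combinations of point evaluations stand for Gaussian
   expectations: they agree with them on polynomials of degree at most [D], and
   make every exchange of sums and expectations algebraic. *)
Definition wE (T : Type) (s : seq (R * T)) (f : T -> R) : R := \sum_(p <- s) p.1 * f p.2.

Lemma eq_wE T (s : seq (R * T)) f g : (forall x, f x = g x) -> wE s f = wE s g.
Proof. by move=> /funext->. Qed.

Lemma wEZ T (s : seq (R * T)) a f : wE s (fun x => a * f x) = a * wE s f.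
Proof. by rewrite /wE mulr_sumr; apply: eq_bigr => p _; rewrite mulrCA. Qed.

Lemma wEZr T (s : seq (R * T)) a f : wE s (fun x => f x * a) = wE s f * a.
Proof. by rewrite mulrC -wEZ; congr wE; apply/funext => x; rewrite mulrC. Qed.

Lemma wE_sum T (s : seq (R * T)) (I : Type) (r : seq I) (P : pred I) (f : I -> T -> R) :
  wE s (fun x => \sum_(i <- r | P i) f i x) = \sum_(i <- r | P i) wE s (f i).
Proof.
rewrite /wE exchange_big /=; apply: eq_bigr => p _.
by rewrite mulr_sumr.
Qed.

Lemma wE_lin T (s : seq (R * T)) (L : finType) (cs : seq (L -> R)) (E : T -> seq L -> R) :
  wE s (fun x => lin cs (E x)) = lin cs (fun w => wE s (fun x => E x w)).
Proof.
elim: cs E => [|c cs IH] E //=; rewrite wE_sum.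
by apply: eq_bigr => l _; rewrite wEZ IH.
Qed.

Lemma wE_allpairs T T' T'' (s : seq (R * T)) (s' : seq (R * T')) (g : T -> T' -> T'') f :
  wE [seq (p.1 * q.1, g p.2 q.2) | p <- s, q <- s'] f =
  wE s (fun x => wE s' (fun y => f (g x y))).
Proof.
rewrite /wE big_allpairs_dep; apply: eq_bigr => p _ /=.
by rewrite mulr_sumr; apply: eq_bigr => q _; rewrite mulrA.
Qed.

(** For any [D + 1] distinct nodes the weights solve an invertible Vandermonde system. *)
Lemma gauss_nodes (D : nat) : exists s : seq (R * R),
  forall k, (k <= D)%N -> wE s (fun y => y ^+ k) = gmom 1 k.
Proof.
pose a : 'rV[R]_D.+1 := \row_j j%:R.
pose V := Vandermonde D.+1 a.
have uV : V \in unitmx.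
  rewrite unitmxE det_Vandermonde unitfE; apply/prodf_neq0 => i _.
  apply/prodf_neq0 => j ij; rewrite !mxE subr_eq0 eqr_nat.
  by rewrite gtn_eqF.
pose c : 'cV[R]_D.+1 := \col_i gmom 1 i.
pose w := invmx V *m c.
exists [seq (w i 0, a 0 i) | i <- enum 'I_D.+1] => k kD.
rewrite /wE big_map big_enum /=.
have : (V *m w) (Ordinal (kD : (k < D.+1)%N)) 0 = gmom 1 k by rewrite mulKVmx// mxE.
by rewrite mxE => <-; apply: eq_bigr => i _; rewrite [in RHS]mxE mulrC.
Qed.

Lemma gmom_scale (a : R) k : gmom (a ^+ 2) k = a ^+ k * gmom 1 k.
Proof.
suff : gmom (a ^+ 2) k = a ^+ k * gmom 1 k /\ gmom (a ^+ 2) k.+1 = a ^+ k.+1 * gmom 1 k.+1.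
  by case.
elim: k => [|k [IH1 IH2]]; first by rewrite /= expr0 mul1r mulr0.
by split => //; rewrite [LHS]/= IH1 [gmom 1 k.+2]/= !exprS; ring.
Qed.

Lemma rhoS (x : R) u : rho x u.+1 = rho x u * (x + 2 * u%:R).
Proof. by rewrite /rho big_ord_recr. Qed.

(** A Chu-Vandermonde identity: the moments of a sum of two independent chi-squared variables. *)
Lemma rhoD (x y : R) u :
  rho (x + y) u = \sum_(k < u.+1) 'C(u, k)%:R * (rho x (u - k) * rho y k).
Proof.
elim: u => [|u IH].
  by rewrite big_ord1 /rho !big_ord0 bin0 !mulr1.
rewrite rhoS IH.
have S1 : \sum_(k < u.+1) 'C(u, k)%:R * (rho x (u - k).+1 * rho y k) =
  \sum_(k < u.+2) 'C(u, k)%:R * (rho x (u.+1 - k) * rho y k).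
  rewrite [RHS]big_ord_recr /= bin_small// mul0r addr0.
  by apply: eq_bigr => k _; rewrite subSn// -ltnS.
rewrite [RHS]big_ord_recl bin0 mul1r subn0.
under [in RHS]eq_bigr do rewrite lift0 binS natrD mulrDl.
rewrite big_split /= addrA.
have -> : rho x u.+1 * rho y 0 + \sum_(i < u.+1) 'C(u, i.+1)%:R * (rho x (u.+1 - i.+1) * rho y i.+1)
  = \sum_(k < u.+1) 'C(u, k)%:R * (rho x (u - k).+1 * rho y k).
  by rewrite S1 [RHS]big_ord_recl bin0 mul1r subn0.
rewrite -big_split /= mulr_suml; apply: eq_bigr => k _.
rewrite !rhoS subSS natrB; last by rewrite -ltnS.
ring.
Qed.

Lemma rho1 k : rho 1 k = gmom 1 (2 * k) :> R.
Proof.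
elim: k => [|k IH]; first by rewrite /rho big_ord0.
have -> : (2 * k.+1 = (2 * k).+2)%N by lia.
have E : (2 * k).+1%:R = 1 + 2 * k%:R :> R by rewrite -natr1 natrM addrC.
by rewrite rhoS IH [RHS]/= E mulr1 mulrC.
Qed.

Section BlockEntries.
Variables (m : nat) (a : R) (v w : 'rV[R]_m) (X : 'M[R]_m).

Lemma row_mx_lift0 : (row_mx a%:M v : 'rV[R]_(1 + m)) 0 ord0 = a.
Proof.
have -> : ord0 = lshift m (ord0 : 'I_1) by apply: val_inj.
by rewrite row_mxEl mxE eqxx.
Qed.

Lemma row_mx_liftS j : (row_mx a%:M v : 'rV[R]_(1 + m)) 0 (lift ord0 j) = v 0 j.
Proof.
have -> : lift ord0 j = rshift 1 j by apply: val_inj.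
by rewrite row_mxEr.
Qed.

Let B : 'M[R]_(1 + m) := block_mx a%:M v w^T X.

Lemma block_mx00 : B ord0 ord0 = a.
Proof.
have -> : ord0 = lshift m (ord0 : 'I_1) by apply: val_inj.
by rewrite /B block_mxEul mxE eqxx.
Qed.

Lemma block_mx0S j : B ord0 (lift ord0 j) = v 0 j.
Proof.
have -> : lift ord0 j = rshift 1 j by apply: val_inj.
have -> : ord0 = lshift m (ord0 : 'I_1) by apply: val_inj.
by rewrite /B block_mxEur.
Qed.

Lemma block_mxS0 j : B (lift ord0 j) ord0 = w 0 j.
Proof.
have -> : lift ord0 j = rshift 1 j by apply: val_inj.
have -> : ord0 = lshift m (ord0 : 'I_1) by apply: val_inj.
by rewrite /B block_mxEdl mxE.
Qed.

Lemma block_mxSS i j : B (lift ord0 i) (lift ord0 j) = X i j.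
Proof.
have -> : lift ord0 j = rshift 1 j by apply: val_inj.
have -> : lift ord0 i = rshift 1 i by apply: val_inj.
by rewrite /B block_mxEdr.
Qed.

End BlockEntries.

Section Functional.
Variables (D : nat) (G1 : seq (R * R)).
Hypothesis G1E : forall k, (k <= D)%N -> wE G1 (fun y => y ^+ k) = gmom 1 k.

Fixpoint Gv (m : nat) : seq (R * 'rV[R]_m) :=
  if m is m'.+1 then
    [seq (p.1 * q.1, row_mx p.2%:M q.2 : 'rV[R]_(1 + m')) | p <- G1, q <- Gv m']
  else [:: (1, 0)].

(* Quadrature for the GOE of size [m], built by adjoining one row at a time. *)
Fixpoint Gm (m : nat) : seq (R * 'M[R]_m) :=
  if m is m'.+1 then
    [seq (p.1 * q.1, block_mx (Num.sqrt 2 * p.2)%:M q.2.1 (q.2.1)^T q.2.2 : 'M[R]_(1 + m')) |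
      p <- G1, q <- [seq (v.1 * x.1, (v.2, x.2)) | v <- Gv m', x <- Gm m']]
  else [:: (1, 0)].

Lemma wE_GvS m f : wE (Gv m.+1) f =
  wE G1 (fun y => wE (Gv m) (fun v => f (row_mx y%:M v))).
Proof. exact: wE_allpairs. Qed.

Lemma wE_GmS m f : wE (Gm m.+1) f =
  wE G1 (fun y => wE (Gv m) (fun v => wE (Gm m) (fun X =>
    f (block_mx (Num.sqrt 2 * y)%:M v v^T X)))).
Proof.
etransitivity.
  exact: (wE_allpairs _ _ (fun (y : R) (q : 'rV[R]_m * 'M[R]_m) =>
    block_mx (Num.sqrt 2 * y)%:M q.1 q.1^T q.2 : 'M[R]_(1 + m))).
apply: eq_wE => y.
exact: (wE_allpairs _ _ (fun (v : 'rV[R]_m) (x : 'M[R]_m) => (v, x))).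
Qed.

Lemma Gv_words m (s : seq 'I_m) : (size s <= D)%N ->
  wE (Gv m) (fun v => \prod_(j <- s) v 0 j) = \prod_j gmom 1 (count_mem j s).
Proof.
elim: m s => [|m IH] s sD.
  by case: s sD => [|[]//] _; rewrite /wE big_seq1 /= big_nil mulr1 big_ord0.
rewrite wE_GvS; set s' := pmap (unlift ord0) s.
have E y v : \prod_(j <- s) (row_mx (y%:M : 'M[R]_1) v : 'rV[R]_(1 + m)) 0 j =
   y ^+ count_mem ord0 s * \prod_(j <- s') v 0 j.
  rewrite /s' {sD}; elim: (s) => [|j t IHt]; first by rewrite !big_nil mulr1.
  rewrite big_cons IHt [count_mem _ _]/= [pmap _ (_ :: _)]/=.
  case: unliftP => [j'|] ->; last by rewrite row_mx_lift0 exprS mulrA.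
  by rewrite row_mx_liftS big_cons mulrCA.
transitivity (wE G1 (fun y => y ^+ count_mem ord0 s *
    wE (Gv m) (fun v => \prod_(j <- s') v 0 j))).
  by apply: eq_wE => y; rewrite -wEZ; apply: eq_wE => v; exact: E.
have szE : (size s' <= D)%N.
  by apply: leq_trans sD; rewrite size_pmap count_size.
rewrite wEZr IH// G1E; last by apply: leq_trans sD; apply: count_size.
rewrite [RHS]big_ord_recl; congr (_ * _).
apply: eq_bigr => j _; congr (gmom 1 _).
rewrite /s' {szE sD E IH s'}; elim: s => [|i t IHt] //=.
case: unliftP => [i'|] -> /=; last by rewrite IHt.
by rewrite IHt (inj_eq lift_inj).
Qed.

Let V m (a : 'I_m * 'I_m) : R := if a.1 == a.2 then 2 else 1.
Let key m (e : 'I_m * 'I_m) : 'I_m * 'I_m :=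
  if (e.1 <= e.2)%N then e else (e.2, e.1).

Let gcov_key m (e f : 'I_m * 'I_m) :
  gcov (fun _ _ => 1) e f = V (key e) * (key e == key f)%:R :> R.
Proof.
have VE (p : 'I_m * 'I_m) : V p = (1 + (p.1 == p.2))%:R by rewrite /V; case: ifP.
rewrite VE /gcov mul1r -natrD -natrM; congr (_%:R).
case: e f => [a b] [c d]; rewrite /key /=.
case: (leqP a b) => ab; case: (leqP c d) => cd; rewrite !xpair_eqE -!val_eqE /=; lia.
Qed.

Let offdiag m (e : 'I_m.+1 * 'I_m.+1) : option 'I_m :=
  match unlift ord0 e.1, unlift ord0 e.2 with
  | None, Some j => Some j | Some j, None => Some j | _, _ => None
  end.

Let minor m (e : 'I_m.+1 * 'I_m.+1) : option ('I_m * 'I_m) :=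
  match unlift ord0 e.1, unlift ord0 e.2 with
  | Some i, Some j => Some (i, j) | _, _ => None
  end.

(** Peeling off the first row splits a word into a power of the corner, a word in the row and a word
    in the minor; these are the classes (0,0), (0,j) and (i,j) in the product of [wick_count]. *)
Lemma Gm_words m (s : seq ('I_m * 'I_m)) : (size s <= D)%N ->
  wE (Gm m) (fun X => \prod_(e <- s) X e.1 e.2) = wick (gcov (fun _ _ => 1)) s.
Proof.
move=> sD; rewrite (wick_ext s (@gcov_key m)) wick_count.
elim: m s sD => [|m IH] s sD.
  case: s sD => [_|[[]//]]; rewrite /wE big_seq1 /= big_nil mulr1 big1//.
rewrite wE_GmS; set sv := pmap (@offdiag m) s; set sX := pmap (@minor m) s.
set c := count (fun e => key e == (ord0, ord0)) s.
have E y v X : \prod_(e <- s) (block_mx (Num.sqrt 2 * y)%:M v v^T X : 'M[R]_(1 + m)) e.1 e.2 =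
   (Num.sqrt 2 * y) ^+ c * ((\prod_(j <- sv) v 0 j) * \prod_(e <- sX) X e.1 e.2).
  rewrite /sv /sX /c {sD}; elim: (s) => [|[i j] t IHt]; first by rewrite !big_nil !mulr1.
  rewrite big_cons IHt [count _ (_ :: _)]/= [pmap (@offdiag m) (_ :: _)]/=.
  rewrite [pmap (@minor m) (_ :: _)]/= /offdiag /minor /key /=.
  case: (unliftP ord0 i) => [i'|] ->; case: (unliftP ord0 j) => [j'|] ->.
  - rewrite block_mxSS big_cons.
    by case: ifP => _; rewrite xpair_eqE /= add0n; ring.
  - by rewrite block_mxS0 big_cons xpair_eqE /= add0n; ring.
  - by rewrite block_mx0S big_cons xpair_eqE /= add0n; ring.
  - by rewrite block_mx00 eqxx /= exprS; ring.
transitivity (wE G1 (fun y => (Num.sqrt 2 * y) ^+ c *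
    (wE (Gv m) (fun v => \prod_(j <- sv) v 0 j) *
     wE (Gm m) (fun X => \prod_(e <- sX) X e.1 e.2)))).
  apply: eq_wE => y; rewrite -wEZr -wEZ; apply: eq_wE => v.
  by rewrite -wEZ -wEZ; apply: eq_wE => X; exact: E.
have svD : (size sv <= D)%N by apply: leq_trans sD; rewrite size_pmap count_size.
have sXD : (size sX <= D)%N by apply: leq_trans sD; rewrite size_pmap count_size.
rewrite wEZr Gv_words// IH//.
have -> : wE G1 (fun y => (Num.sqrt 2 * y) ^+ c) = gmom 2 c.
  rewrite -[in RHS](sqr_sqrtr (_ : 0 <= 2 :> R))// gmom_scale.
  rewrite -G1E; last by apply: leq_trans sD; apply: count_size.
  by rewrite -wEZ; apply: eq_wE => y; rewrite exprMn.
rewrite -(pair_bigA _ (fun i j => gmom (V (i, j)) (count (fun e => key e == (i, j)) s))) /=.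
rewrite -(pair_bigA _ (fun i j => gmom (V (i, j)) (count (fun e => key e == (i, j)) sX))) /=.
rewrite [RHS]big_ord_recl [X in _ = X * _]big_ord_recl /= -mulrA; congr (_ * (_ * _)).
  apply: eq_bigr => j _; congr (gmom 1 _).
  rewrite /sv {E IH sD svD sXD sv sX c}; elim: s => [|[i k] t IHt] //=; rewrite /offdiag /key /=.
  case: (unliftP ord0 i) => [i'|] ->; case: (unliftP ord0 k) => [k'|] -> /=; rewrite ?IHt //.
  by case: ifP.
apply: eq_bigr => i _; rewrite [RHS]big_ord_recl.
have -> : count (fun e => key e == (lift ord0 i, ord0)) s = 0%N.
  apply/eqP; rewrite -leqn0 leqNgt -has_count; apply/hasPn => [[a b]] _.
  rewrite /key /=; case: ifP => ab; rewrite xpair_eqE; apply/negP => /andP[/eqP E1 /eqP E2].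
    by rewrite E1 E2 in ab.
  by rewrite E1 E2 in ab.
rewrite mul1r; apply: eq_bigr => j _.
have -> : V (lift ord0 i, lift ord0 j) = V (i, j) by rewrite /V /= (inj_eq lift_inj).
congr (gmom _ _).
have keyS (a b : 'I_m) :
    key (lift ord0 a, lift ord0 b) = (lift ord0 (key (a, b)).1, lift ord0 (key (a, b)).2).
  by rewrite /key /= leq_bump2; case: ifP.
rewrite /sX {E IH sD svD sXD sv sX c}; elim: s => [|[a b] t IHt] //=; rewrite /minor /=.
case: (unliftP ord0 a) => [a'|] ->; case: (unliftP ord0 b) => [b'|] ->.
- rewrite keyS [pmap _ _]/= [LHS]/= IHt xpair_eqE !(inj_eq lift_inj).
  by rewrite -xpair_eqE -surjective_pairing.
- by rewrite IHt.
- by rewrite IHt.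
- by rewrite IHt.
Qed.

Lemma Gv_norm m u : (2 * u <= D)%N ->
  wE (Gv m) (fun v => (\sum_j v 0 j ^+ 2) ^+ u) = rho m%:R u.
Proof.
elim: m u => [|m IH] u uD.
  rewrite /wE big_seq1 /= mul1r big_ord0; case: u uD => [|u] _.
    by rewrite expr0 /rho big_ord0.
  by rewrite expr0n /rho big_ord_recl !mulr0n mulr0 addr0 mul0r.
rewrite wE_GvS -natr1 rhoD.
transitivity (wE G1 (fun y => \sum_(k < u.+1) 'C(u, k)%:R *
   (wE (Gv m) (fun v => (\sum_j v 0 j ^+ 2) ^+ (u - k)) * y ^+ (2 * k)))).
  apply: eq_wE => y.
  transitivity (wE (Gv m) (fun v => \sum_(k < u.+1) ('C(u, k)%:R * y ^+ (2 * k)) *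
      (\sum_j v 0 j ^+ 2) ^+ (u - k))).
    apply: eq_wE => v; rewrite big_ord_recl.
    rewrite row_mx_lift0 addrC exprDn.
    have -> : \sum_(i < m) row_mx (y%:M : 'M[R]_1) v 0 (lift ord0 i) ^+ 2 = \sum_j v 0 j ^+ 2.
      by apply: eq_bigr => j _; rewrite row_mx_liftS.
    by apply: eq_bigr => k _; rewrite -mulr_natl -exprM; ring.
  rewrite wE_sum; apply: eq_bigr => k _; rewrite wEZ; ring.
rewrite wE_sum; apply: eq_bigr => k _; rewrite wEZ wEZ G1E; last by have := ltn_ord k; lia.
by rewrite rho1 IH//; lia.
Qed.
End Functional.
End WeightedPoints.

(** * Rotation invariance *)

Section PolynomialFunctions.
Variables (R : realType) (m : nat).
Implicit Types (F G : 'M[R]_m -> R).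

(** The degree bound is what makes the quadrature exact on [F]. *)
Definition polyf (D : nat) F : Prop := exists t : seq (R * seq ('I_m * 'I_m)),
  all (fun p => (size p.2 <= D)%N) t /\
  forall M, F M = \sum_(p <- t) p.1 * \prod_(e <- p.2) M e.1 e.2.

Lemma polyf_const D c : polyf D (fun=> c).
Proof.
by exists [:: (c, [::])]; split => // M; rewrite big_seq1 /= big_nil mulr1.
Qed.

Lemma polyf_entry i j : polyf 1 (fun M => M i j).
Proof.
by exists [:: (1, [:: (i, j)])]; split => // M; rewrite big_seq1 /= big_seq1 mul1r.
Qed.

Lemma polyf_mono D D' F : (D <= D')%N -> polyf D F -> polyf D' F.
Proof.
move=> DD' [t [tD FE]]; exists t; split => //.
by apply: sub_all tD => p /leq_trans; apply.
Qed.

Lemma polyfD D F G : polyf D F -> polyf D G -> polyf D (fun M => F M + G M).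
Proof.
move=> [t [tD FE]] [t' [t'D GE]]; exists (t ++ t'); split.
  by rewrite all_cat tD.
by move=> M; rewrite FE GE big_cat.
Qed.

Lemma polyf_sum D (I : Type) (r : seq I) (F : I -> 'M[R]_m -> R) :
  (forall i, polyf D (F i)) -> polyf D (fun M => \sum_(i <- r) F i M).
Proof.
move=> HF; elim: r => [|i r IH].
  have -> : (fun M => \sum_(i <- [::]) F i M) = fun=> 0.
    by apply/funext => M; rewrite big_nil.
  exact: polyf_const.
have -> : (fun M => \sum_(j <- i :: r) F j M) = fun M => F i M + \sum_(j <- r) F j M.
  by apply/funext => M; rewrite big_cons.
exact: polyfD.
Qed.

Lemma polyfM D D' F G : polyf D F -> polyf D' G -> polyf (D + D') (fun M => F M * G M).
Proof.
move=> [t [/allP tD FE]] [t' [/allP t'D GE]].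
exists [seq (p.1 * q.1, p.2 ++ q.2) | p <- t, q <- t']; split.
  apply/allP => _ /allpairsP[[p q] /= [pt qt ->]] /=.
  by rewrite size_cat leq_add ?tD ?t'D.
move=> M; rewrite FE GE big_allpairs_dep mulr_suml; apply: eq_bigr => p _.
rewrite mulr_sumr; apply: eq_bigr => q _ /=; rewrite big_cat /=; ring.
Qed.

Lemma polyf_exp a i j : polyf a (fun M : 'M[R]_m => (M ^+ a) i j).
Proof.
elim: a i j => [|a IH] i j.
  have -> : (fun M : 'M[R]_m => (M ^+ 0) i j) = fun=> (1 : 'M[R]_m) i j by [].
  exact: polyf_const.
have -> : (fun M : 'M[R]_m => (M ^+ a.+1) i j) = fun M => \sum_k M i k * (M ^+ a) k j.
  by apply/funext => M; rewrite exprS mxE.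
apply: polyf_sum => k; rewrite -add1n; apply: polyfM => //; exact: polyf_entry.
Qed.

End PolynomialFunctions.

Section Rotation.
Variables (R : realType) (D : nat) (G1 : seq (R * R)).
Hypothesis G1E : forall k, (k <= D)%N -> wE G1 (fun y => y ^+ k) = gmom 1 k.

(** On words of length at most [D] the functional is the Wick sum, determined by the covariance, and
    [gcov] with constant profile is invariant under orthogonal conjugation. *)
Lemma rotation m (Q : 'M[R]_m) F : Q *m Q^T = 1%:M -> polyf D F ->
  wE (Gm G1 m) (fun M => F (Q *m M *m Q^T)) = wE (Gm G1 m) F.
Proof.
move=> OO [t [/allP tD FE]].
have -> : F = fun M => \sum_(p <- t) p.1 * \prod_(e <- p.2) M e.1 e.2 by apply/funext.
rewrite !wE_sum big_seq [RHS]big_seq; apply: eq_bigr => p pt; rewrite !wEZ; congr (_ * _).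
have {tD} sD := tD p pt; move: (p.2) sD => {p pt} s sD.
pose c (e l : 'I_m * 'I_m) := Q e.1 l.1 * Q e.2 l.2.
have ent (M : 'M[R]_m) e : (Q *m M *m Q^T) e.1 e.2 = \sum_l c e l * M l.1 l.2.
  rewrite mxE.
  transitivity (\sum_j \sum_i Q e.1 i * Q e.2 j * M i j).
    apply: eq_bigr => j _; rewrite [_ e.1 j]mxE mulr_suml; apply: eq_bigr => i _.
    by rewrite [Q^T _ _]mxE; ring.
  by rewrite exchange_big pair_bigA.
have E M : \prod_(e <- s) (Q *m M *m Q^T) e.1 e.2 =
    lin [seq c e | e <- s] (fun w => \prod_(l <- w) M l.1 l.2).
  elim: s {sD} => [|e s IH]; first by rewrite /= !big_nil.
  rewrite big_cons IH ent /= mulr_suml; apply: eq_bigr => l _.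
  rewrite -mulrA -linZ; congr (_ * _); apply: eq_lin => w _.
  by rewrite big_cons.
under eq_wE do rewrite E.
rewrite wE_lin (eq_lin (E' := wick (gcov (fun _ _ => 1)))); last first.
  by move=> w; rewrite size_map => ws; rewrite (Gm_words G1E)// ws.
rewrite lin_wick wick_map (Gm_words G1E)//; apply: wick_ext => e e'.
have dotO i j : \sum_k Q i k * Q j k = (i == j)%:R.
  have /matrixP/(_ i j) := OO; rewrite !mxE => <-.
  by apply: eq_bigr => k _; rewrite mxE.
transitivity (\sum_l (c e l * c e' l + c e l * c e' (l.2, l.1))).
  apply: eq_bigr => l _; rewrite /gcov.
  under eq_bigr do rewrite mul1r mulrDr.
  rewrite big_split /=; congr (_ + _).
    rewrite (bigD1 l)//= eqxx mulr1 big1 ?addr0// => l' /negPf l'l.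
    by rewrite eq_sym l'l mulr0.
  rewrite (bigD1 (l.2, l.1))//= -surjective_pairing eqxx mulr1 big1 ?addr0// => l' l'l.
  case: eqP => [le|]; last by rewrite mulr0.
  by rewrite le /= -surjective_pairing eqxx in l'l.
rewrite big_split /gcov mul1r /=; congr (_ + _).
  transitivity (\sum_k \sum_l (Q e.1 k * Q e'.1 k) * (Q e.2 l * Q e'.2 l)).
    by rewrite pair_bigA; apply: eq_bigr => l _; rewrite /c; ring.
  under eq_bigr do rewrite -mulr_sumr dotO.
  by rewrite -mulr_suml dotO -natrM mulnb -xpair_eqE -!surjective_pairing.
transitivity (\sum_k \sum_l (Q e.1 k * Q e'.2 k) * (Q e.2 l * Q e'.1 l)).
  by rewrite pair_bigA; apply: eq_bigr => l _; rewrite /c /=; ring.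
under eq_bigr do rewrite -mulr_sumr dotO.
by rewrite -mulr_suml dotO -natrM mulnb -xpair_eqE -!surjective_pairing.
Qed.

End Rotation.

Section Householder.
Variable R : realType.

Let dot m (x y : 'rV[R]_m) : R := (x *m y^T) 0 0.

Let dotE m (x y : 'rV[R]_m) : x *m y^T = (dot x y)%:M.
Proof. exact: mx11_scalar. Qed.

Let dotC m (x y : 'rV[R]_m) : dot x y = dot y x.
Proof. by rewrite /dot !mxE; apply: eq_bigr => i _; rewrite !mxE mulrC. Qed.

Let dot_sqr m (x : 'rV[R]_m) : dot x x = \sum_j x 0 j ^+ 2.
Proof. by rewrite /dot mxE; apply: eq_bigr => i _; rewrite mxE expr2. Qed.

Let dotBl m (x y z : 'rV[R]_m) : dot (x - y) z = dot x z - dot y z.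
Proof. by rewrite /dot mulmxBl [LHS]mxE [X in _ + X]mxE. Qed.

Let dotBr m (x y z : 'rV[R]_m) : dot z (x - y) = dot z x - dot z y.
Proof. by rewrite dotC dotBl !(dotC z). Qed.

(** The Householder reflection exchanging the first basis vector [e] with u / |u|. The identity
    serves in the degenerate cases u = 0 and u / |u| = e. *)
Lemma orthogonal_row m (u : 'rV[R]_m.+1) :
  exists2 Q : 'M[R]_m.+1, Q *m Q^T = 1%:M &
    u = Num.sqrt (\sum_j u 0 j ^+ 2) *: row 0 Q.
Proof.
set c := Num.sqrt _.
have S0 : 0 <= \sum_j u 0 j ^+ 2 by apply: sumr_ge0 => j _; exact: sqr_ge0.
have c2 : c ^+ 2 = dot u u by rewrite sqr_sqrtr// dot_sqr.
have [c0|c0] := eqVneq c 0.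
  exists 1%:M; first by rewrite trmx1 mulmx1.
  rewrite c0 scale0r; apply/rowP => j; rewrite mxE; apply/eqP; rewrite -sqrf_eq0.
  move: c2; rewrite c0 expr0n dot_sqr => /esym/eqP.
  by rewrite psumr_eq0; [move=> /allP/(_ j (mem_index_enum _))|move=> *; exact: sqr_ge0].
pose e : 'rV[R]_m.+1 := delta_mx 0 0.
pose u' := c^-1 *: u.
have uu : u = c *: u' by rewrite scalerA mulfV// scale1r.
have dot_u' : dot u' u' = 1.
  rewrite /dot /u' -scalemxAl linearZ /= -scalemxAr dotE !mxE eqxx mulr1n -c2.
  by field.
pose w := u' - e.
have ee : dot e e = 1.
  by rewrite dot_sqr (bigD1 ord0)//= big1 ?addr0; [rewrite mxE eqxx expr1n|
    move=> j /negPf j0; rewrite mxE j0 andbF expr0n].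
(* For unit vectors, e . (u' - e) = - |u' - e|^2 / 2; so the reflection maps [e] to [e + w = u']. *)
have ew : dot e w = - (dot w w / 2).
  have -> : dot e w = dot e u' - 1.
    by rewrite dotBr ee.
  have -> : dot w w = 2 - 2 * dot e u'.
    rewrite /w dotBl !dotBr dot_u' ee (dotC u' e).
    ring.
  by field.
have [w0|w0] := eqVneq w 0.
  exists 1%:M; first by rewrite trmx1 mulmx1.
  by rewrite {1}uu rowE mulmx1 -/e; congr (_ *: _); apply/eqP; rewrite -subr_eq0 -/w w0.
have dw : dot w w != 0.
  apply: contra w0 => /eqP; rewrite dot_sqr => /eqP H; apply/eqP/rowP => j; rewrite [RHS]mxE.
  apply/eqP; rewrite -sqrf_eq0; move: H.
  by rewrite psumr_eq0; [move=> /allP/(_ j (mem_index_enum _))|move=> *; exact: sqr_ge0].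
pose H : 'M[R]_m.+1 := 1%:M - (2 / dot w w) *: (w^T *m w).
exists H.
  have -> : H^T = H by rewrite /H linearB /= trmx1 linearZ /= trmx_mul trmxK.
  have WW : (w^T *m w) *m (w^T *m w) = dot w w *: (w^T *m w).
    by rewrite mulmxA -[w^T *m w *m w^T]mulmxA dotE mul_mx_scalar -scalemxAl.
  rewrite /H; move: (w^T *m w) WW => A WW.
  rewrite mulmxBl mul1mx mulmxBr mulmx1 -scalemxAl -scalemxAr WW !scalerA.
  have -> : 2 / dot w w * (2 / dot w w) * dot w w = 2 / dot w w + 2 / dot w w by field.
  rewrite scalerDl; set B := _ *: A.
  have -> : B - (B + B) = - B by rewrite opprD addrA subrr sub0r.
  by rewrite opprK subrK.
rewrite {1}uu rowE -/e /H mulmxBr mulmx1 -scalemxAr mulmxA dotE mul_scalar_mx scalerA ew.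
have -> : 2 / dot w w * - (dot w w / 2) = -1 by field.
by rewrite scaleN1r opprK /w addrC subrK.
Qed.

End Householder.

(** * Closed walks of the Gaussian orthogonal ensemble *)

Section FirstReturn.
Variables (R : realType) (D : nat).

Let Mc (r f u : nat) : R := 'C((r + u).-1, u)%:R * 'C((r + u + f).-1, f)%:R.

(** Pascal's rule twice: the coefficient form of S^(r+1) = S^r + a z S^(r+1) + z^2 s S^(r+1). *)
Let McS r f u : Mc r.+1 f u = Mc r f u + (if f is f'.+1 then Mc r.+1 f' u else 0)
   + (if u is u'.+1 then Mc r.+1 f u' else 0).
Proof.
rewrite /Mc; case: u => [|u]; case: f => [|f]; rewrite ?addn0 ?bin0 ?addr0 //.
- by rewrite !mul1r !addSn !addnS /= binS natrD.
- by rewrite !mulr1 !addSn !addnS /= binS natrD.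
rewrite !(addSn, addnS) /= (binS (r + u) u) (binS (r + u + f).+1 f) !natrD.
by ring.
Qed.

Variables (s S : {poly R}) (a : R).
Hypothesis SE : forall n, (n <= D)%N ->
  (S - 1 - a *: ('X * S) - 'X^2 * (s * S))`_n = 0.

Let cf n f u j : R := if (f + 2 * u <= n)%N then (s ^+ (u + j))`_(n - (f + 2 * u)) else 0.

(* Expansion of [s^j (1 - a z - z^2 s)^(-r)]. *)
Lemma expand_power K j r n : (n < K)%N -> (n <= D)%N ->
  (s ^+ j * S ^+ r)`_n = \sum_(u < K) \sum_(f < K)
    'C((r + u).-1, u)%:R * 'C((r + u + f).-1, f)%:R * a ^+ f *
    (if (f + 2 * u <= n)%N then (s ^+ (u + j))`_(n - (f + 2 * u)) else 0).
Proof.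
rewrite -[RHS]/(\sum_(u < K) \sum_(f < K) Mc r f u * a ^+ f * cf n f u j).
elim/ltn_ind: n j r K => n IH j r K nK nD.
elim: r => [|r IHr].
  rewrite expr0 mulr1; case: K nK => // K nK.
  have M0S u f : Mc 0 f u.+1 = 0 by rewrite /Mc add0n /= bin_small ?mul0r.
  have M00 f : Mc 0 f.+1 0 = 0 by rewrite /Mc !add0n [in X in _ * X]bin_small ?mulr0.
  rewrite big_ord_recl [X in _ + X]big1 ?addr0; last first.
    by move=> u _; apply: big1 => f _; rewrite lift0 M0S !mul0r.
  rewrite big_ord_recl [X in _ + X]big1 ?addr0; last first.
    by move=> f _; rewrite lift0 M00 !mul0r.
  by rewrite /Mc /cf !bin0 expr0 !mul1r add0n subn0.
(* The relation for [S], multiplied by s^j S^r. It holds for the truncated series only up to degree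
   [D], so its error [E] does not reach the coefficient [n]. *)
have -> : (s ^+ j * S ^+ r.+1)`_n = (s ^+ j * S ^+ r)`_n +
    (if n is n'.+1 then a * (s ^+ j * S ^+ r.+1)`_n' else 0) +
    (if n is n'.+2 then (s ^+ j.+1 * S ^+ r.+1)`_n' else 0).
  set E := S - 1 - a *: ('X * S) - 'X^2 * (s * S).
  have SD : S = 1 + a *: ('X * S) + 'X^2 * (s * S) + E by rewrite /E; ring.
  have PE : s ^+ j * S ^+ r.+1 = s ^+ j * S ^+ r + a *: ('X * (s ^+ j * S ^+ r.+1)) +
     'X^2 * (s ^+ j.+1 * S ^+ r.+1) + (s ^+ j * S ^+ r) * E.
    rewrite -!mul_polyC [S ^+ r.+1]exprS [s ^+ j.+1]exprS.
    rewrite -{1}[S]/(S) {1}SD -!mul_polyC; ring.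
  rewrite [in LHS]PE !coefD coefZ coefXM coefXnM.
  have -> : (s ^+ j * S ^+ r * E)`_n = 0.
    rewrite coefM big1// => i _; rewrite SE ?mulr0//.
    by apply: leq_trans nD; exact: leq_subr.
  rewrite addr0; case: (n) => [|[|n']] /=; rewrite ?mulr0 ?addr0 //.
  by rewrite !subSS subn0.
have cf1 n' f u j' : cf n'.+1 f.+1 u j' = cf n' f u j' by rewrite /cf addSn ltnS subSS.
have cf2 n' f u j' : cf n'.+2 f u.+1 j' = cf n' f u j'.+1.
  rewrite /cf; have -> : (f + 2 * u.+1 = (f + 2 * u).+2)%N by lia.
  by rewrite !ltnS !subSS addSnnS.
rewrite IHr; symmetry.
transitivity (\sum_(u < K) \sum_(f < K) Mc r f u * a ^+ f * cf n f u j +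
   \sum_(u < K) \sum_(f < K) (if nat_of_ord f is f'.+1 then Mc r.+1 f' u else 0) * a ^+ f * cf n f u j +
   \sum_(u < K) \sum_(f < K) (if nat_of_ord u is u'.+1 then Mc r.+1 f u' else 0) * a ^+ f * cf n f u j).
  rewrite -!big_split; apply: eq_bigr => u _; rewrite -!big_split; apply: eq_bigr => f _.
  by rewrite McS !mulrDl.
case: K nK {IHr} => // K nK; congr (_ + _ + _).
  transitivity (\sum_(u < K.+1) \sum_(f < K) Mc r.+1 f u * a ^+ f.+1 * cf n f.+1 u j).
    apply: eq_bigr => u _; rewrite big_ord_recl !mul0r add0r.
    by apply: eq_bigr.
  case: n IH nK nD => [|n] IH nK nD.
    by rewrite big1// => u _; rewrite big1// => f _; rewrite /cf mulr0.
  rewrite (IH n _ j r.+1 K.+1)//; [|lia|lia].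
  rewrite mulr_sumr; apply: eq_bigr => u _; rewrite mulr_sumr [RHS]big_ord_recr /=.
  have -> : cf n K u j = 0 by rewrite /cf leqNgt; case: ltnP => //; lia.
  rewrite !mulr0 addr0; apply: eq_bigr => f _; rewrite cf1 exprS; ring.
rewrite big_ord_recl big1 ?add0r; last by move=> f _; rewrite !mul0r.
transitivity (\sum_(u < K) \sum_(f < K.+1) Mc r.+1 f u * a ^+ f * cf n f u.+1 j).
  by apply: eq_bigr => u _; apply: eq_bigr.
case: n IH nK nD => [|[|n]] IH nK nD.
- by rewrite big1// => u _; rewrite big1// => f _; rewrite /cf ifF ?mulr0//; lia.
- by rewrite big1// => u _; rewrite big1// => f _; rewrite /cf ifF ?mulr0//; lia.
rewrite (IH n _ j.+1 r.+1 K.+1)//; [|lia|lia].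
rewrite [RHS]big_ord_recr /= [X in _ = _ + X]big1 ?addr0; last first.
  by move=> f _; rewrite /cf ifF ?mulr0//; lia.
by apply: eq_bigr => u _; apply: eq_bigr => f _; rewrite cf2.
Qed.

End FirstReturn.

Section BlockPowers.
Variables (R : realType) (m : nat) (a : R) (v : 'rV[R]_m) (X : 'M[R]_m).

Let B : 'M[R]_(1 + m) := block_mx a%:M v v^T X.

Let q n : R := (B ^+ n) ord0 ord0.
Let col n : 'cV[R]_m := \col_i (B ^+ n) (lift ord0 i) ord0.

Let colS n : col n.+1 = q n *: v^T + X *m col n.
Proof.
apply/colP => i; rewrite [LHS]mxE exprS [LHS]mxE big_ord_recl block_mxS0.
rewrite [RHS]mxE [X in _ = X + _]mxE [v^T _ _]mxE [X in _ = _ + X]mxE mulrC; congr (_ + _).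
by apply: eq_bigr => k _; rewrite block_mxSS [in RHS]mxE.
Qed.

Let colE n : col n = \sum_(b < n) q (n.-1 - b) *: (X ^+ b *m v^T).
Proof.
elim: n => [|n IH].
  by rewrite big_ord0; apply/colP => i; rewrite mxE expr0 [LHS]mxE [RHS]mxE.
rewrite colS IH big_ord_recl expr0 mul1mx subn0; congr (_ + _).
rewrite mulmx_sumr; apply: eq_bigr => b _; rewrite -scalemxAr mulmxA.
have -> : X *m X ^+ b = X ^+ b.+1 by rewrite exprS.
by rewrite lift0; congr (q _ *: _); lia.
Qed.

Lemma block_pow0 : (B ^+ 0) ord0 ord0 = 1.
Proof. by rewrite expr0 mxE eqxx. Qed.

(** First return to the vertex 0: either the diagonal step, or an excursion of length b + 2 with b
    steps in the minor. *)
Lemma block_powS n : (B ^+ n.+1) ord0 ord0 = a * (B ^+ n) ord0 ord0 +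
  \sum_(b < n) (v *m X ^+ b *m v^T) 0 0 * (B ^+ (n.-1 - b)) ord0 ord0.
Proof.
rewrite exprS mxE big_ord_recl block_mx00; congr (_ + _).
transitivity ((v *m col n) 0 0).
  by rewrite mxE; apply: eq_bigr => j _; rewrite block_mx0S [in RHS]mxE.
rewrite colE mulmx_sumr summxE; apply: eq_bigr => b _.
by rewrite -scalemxAr mxE mulmxA mulrC.
Qed.

End BlockPowers.

Section Recursion.
Variables (R : realType) (D : nat) (G1 : seq (R * R)).
Hypothesis G1E : forall k, (k <= D)%N -> wE G1 (fun y => y ^+ k) = gmom 1 k.

Definition Qp m (M : 'M[R]_m.+1) : {poly R} := \poly_(b < D.+1) (M ^+ b) ord0 ord0.

Let sp m (v : 'rV[R]_m) (X : 'M[R]_m) : {poly R} :=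
  \poly_(b < D.+1) (v *m X ^+ b *m v^T) 0 0.

Let Qp_block m a (v : 'rV[R]_m) (X : 'M[R]_m) (B := block_mx a%:M v v^T X : 'M[R]_(1 + m)) n :
  (n <= D)%N ->
  (Qp B - 1 - a *: ('X * Qp B) - 'X^2 * (sp v X * Qp B))`_n = 0.
Proof.
move=> nD; rewrite !coefB coefZ coefXM coefXnM coef1 coef_poly ltnS nD.
case: n nD => [|n] nD; first by rewrite block_pow0 mulr0 !subr0 subrr.
rewrite block_powS /= subr0 coef_poly ltnS (ltnW nD) [X in X - _]addrAC subrr add0r.
case: n nD => [|n] nD; first by rewrite big_ord0 subr0.
rewrite /= !subSS subn0 coefM; apply/eqP; rewrite subr_eq0; apply/eqP.
apply: eq_bigr => b _; rewrite !coef_poly.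
have -> : (b < D.+1)%N by have := ltn_ord b; lia.
by have -> : (n - b < D.+1)%N by lia.
Qed.

(** Conjugating the minor by an orthogonal matrix with first row v / |v| turns v X^b v^T into |v|^2
    (X^b)_00 for all b at once, and leaves the expectation unchanged. *)
Let sp_rot m (v : 'rV[R]_m.+1) u k : (k <= D)%N ->
  wE (Gm G1 m.+1) (fun X => (sp v X ^+ u)`_k) =
  (\sum_j v 0 j ^+ 2) ^+ u * wE (Gm G1 m.+1) (fun X => (Qp X ^+ u)`_k).
Proof.
move=> kD; have [Q QQ vE] := orthogonal_row v.
set N2 := \sum_j _ in vE *.
have N20 : 0 <= N2 by apply: sumr_ge0 => j _; exact: sqr_ge0.
have QQ' : Q^T *m Q = 1%:M by apply: mulmx1C.
have powQ (X : 'M[R]_m.+1) b : (Q *m X *m Q^T) ^+ b = Q *m X ^+ b *m Q^T.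
  elim: b => [|b IH]; first by rewrite !expr0 mulmx1 QQ.
  rewrite !exprS IH -!mulmxE -!mulmxA; congr (_ *m (_ *m _)).
  by rewrite mulmxA QQ' mul1mx.
have spE X : sp v X = N2 *: Qp (Q *m X *m Q^T).
  apply/polyP => b; rewrite coefZ !coef_poly; case: ifP => _; last by rewrite mulr0.
  rewrite powQ vE -!scalemxAl linearZ /= -scalemxAr scalerA mxE -expr2 sqr_sqrtr//.
  congr (_ * _); rewrite -row_mul mxE [RHS]mxE; apply: eq_bigr => i _.
  by congr (_ * _); [rewrite [LHS]mxE|rewrite !mxE].
have -> : (fun X => (sp v X ^+ u)`_k) =
   fun X => N2 ^+ u * (Qp (Q *m X *m Q^T) ^+ u)`_k.
  by apply/funext => X; rewrite spE exprZn coefZ.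
rewrite wEZ; congr (_ * _).
apply: (rotation G1E (F := fun X => (Qp X ^+ u)`_k)) => //; apply: (polyf_mono kD).
elim: u k kD => [|u IH] k kD.
  by under eq_fun do rewrite expr0 coef1; exact: polyf_const.
have -> : (fun X : 'M[R]_m.+1 => (Qp X ^+ u.+1)`_k) =
  fun X => \sum_(i < k.+1) (X ^+ i) ord0 ord0 * (Qp X ^+ u)`_(k - i).
  apply/funext => X; rewrite exprS coefM; apply: eq_bigr => i _.
  by rewrite coef_poly; have -> : (i < D.+1)%N by have := ltn_ord i; lia.
apply: polyf_sum => i.
apply: (@polyf_mono _ _ (i + (k - i))); first by have := ltn_ord i; lia.
apply: polyfM; first exact: polyf_exp.
by apply: IH; apply: leq_trans kD; exact: leq_subr.
Qed.

(** The first-return expansion, integrated over the corner, whose moments are those of N(0, 2); the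
    row and the minor are left. *)
Let sp_coef0 m r n (c := fun u f => 'C((r + u).-1, u)%:R * 'C((r + u + f).-1, f)%:R : R) :
  (n <= D)%N ->
  wE (Gm G1 m.+1) (fun M => (Qp M ^+ r)`_n) =
  \sum_(u < n.+1) \sum_(f < n.+1 | (f + 2 * u <= n)%N) c u f * gmom 2 f *
     wE (Gv G1 m) (fun v => wE (Gm G1 m) (fun X => (sp v X ^+ u)`_(n - (f + 2 * u)))).
Proof.
move=> nD; rewrite wE_GmS.
pose h u f (v : 'rV[R]_m) (X : 'M[R]_m) : R := if (f + 2 * u <= n)%N then (sp v X ^+ u)`_(n - (f + 2 * u)) else 0.
pose w u f := wE (Gv G1 m) (fun v => wE (Gm G1 m) (fun X => h u f v X)).
transitivity (wE G1 (fun y => \sum_(u < n.+1) \sum_(f < n.+1)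
   (c u f * w u f) * (Num.sqrt 2 * y) ^+ f)).
  apply: eq_wE => y.
  transitivity (wE (Gv G1 m) (fun v => \sum_(u < n.+1) \sum_(f < n.+1)
     (c u f * (Num.sqrt 2 * y) ^+ f) * wE (Gm G1 m) (fun X => h u f v X))).
    apply: eq_wE => v.
    transitivity (wE (Gm G1 m) (fun X => \sum_(u < n.+1) \sum_(f < n.+1)
      (c u f * (Num.sqrt 2 * y) ^+ f) * h u f v X)).
      apply: eq_wE => X; rewrite -[_ ^+ r]mul1r.
      rewrite (expand_power (Qp_block _ v X) 0 r (ltnSn n) nD).
      by apply: eq_bigr => u _; apply: eq_bigr => f _; rewrite addn0.
    rewrite wE_sum; apply: eq_bigr => u _; rewrite wE_sum; apply: eq_bigr => f _.
    by rewrite wEZ.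
  rewrite wE_sum; apply: eq_bigr => u _; rewrite wE_sum; apply: eq_bigr => f _.
  by rewrite wEZ mulrAC.
rewrite wE_sum; apply: eq_bigr => u _; rewrite wE_sum [RHS]big_mkcond /=.
apply: eq_bigr => f _; rewrite wEZ.
have -> : wE G1 (fun y => (Num.sqrt 2 * y) ^+ f) = gmom 2 f.
  rewrite -[in RHS](sqr_sqrtr (_ : 0 <= 2 :> R))// gmom_scale.
  rewrite -G1E; last by apply: leq_trans nD; rewrite -ltnS.
  by rewrite -wEZ; apply: eq_wE => y; rewrite exprMn.
rewrite /w /h; case: ifP => _; first by rewrite mulrAC.
rewrite (_ : wE _ _ = 0) ?mulr0 ?mul0r//.
by rewrite /wE big1// => p _; rewrite big1 ?mulr0// => q _; rewrite mulr0.
Qed.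

(** After the rotation the row enters only through powers of its squared norm, whose chi-squared
    moments are [rho]. *)
Lemma Gm_Gn j r n : (n <= D)%N ->
  wE (Gm G1 j.+1) (fun M => (Qp M ^+ r)`_n) = Gn R j r n.
Proof.
elim: j r n => [|j IH] r n nD; rewrite sp_coef0//.
  have sp0 (v : 'rV[R]_0) X : sp v X = 0.
    by apply/polyP => i; rewrite coef_poly coef0 mxE big_ord0 if_same.
  rewrite big_ord_recl [X in _ + X]big1 ?addr0; last first.
    move=> u _; apply: big1 => f _.
    rewrite [wE _ _](_ : _ = 0) ?mulr0// /wE !big_seq1 sp0 lift0 exprS mul0r coef0.
    by rewrite !mulr0.
  rewrite big_mkcond (bigD1 ord_max)//= big1 ?addr0; last first.
    move=> f fn; case: ifP => // _.
    rewrite [wE _ _](_ : _ = 0) ?mulr0// /wE !big_seq1 sp0 expr0 coef1.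
    rewrite [_ == _](_ : _ = false) ?mulr0//.
    by move: fn (ltn_ord f); rewrite -val_eqE /=; lia.
  rewrite muln0 addn0 leqnn subnn /wE !big_seq1 expr0 coef1 eqxx !mul1r !mulr1 addn0.
  by rewrite bin0 mul1r.
apply: eq_bigr => u _; apply: eq_bigr => f fu; rewrite -!mulrA; do 3! congr (_ * _).
transitivity (wE (Gv G1 j.+1) (fun v => (\sum_i v 0 i ^+ 2) ^+ u *
    wE (Gm G1 j.+1) (fun X => (Qp X ^+ u)`_(n - (f + 2 * u))))).
  by apply: eq_wE => v; rewrite sp_rot//; lia.
by rewrite wEZr (Gv_norm G1E)// ?IH//; lia.
Qed.

End Recursion.

Lemma mxpow_wsum (R : realType) n (X : 'M[R]_n) N x z :
  (X ^+ N) x z = wsum N [:: x] (fun h => (nth x h N == z)%:R *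
    \prod_(e <- edges x h N) X e.1 e.2).
Proof.
suff H h y : (0 < size h)%N -> nth x h (size h).-1 = y ->
  (X ^+ N) y z = wsum N h (fun h' => (nth x h' (size h + N).-1 == z)%:R *
     \prod_(k <- iota (size h).-1 N) X (nth x h' k) (nth x h' k.+1)).
  rewrite (H [:: x] x)//=; apply: eq_wsum => w _.
  by rewrite /edges big_map.
elim: N h y => [|N IH] h y h0 hy.
  by rewrite /= big_nil mulr1 addn0 hy expr0 mxE.
rewrite exprS mxE /=; apply: eq_bigr => t _.
rewrite (IH (rcons h t) t); rewrite ?size_rcons ?nth_rcons ?ltnn ?eqxx//.
rewrite -wsumZ; apply: eq_wsum => w wN.
have hE : (size h).-1.+1 = size h by lia.
rewrite big_cons addSnnS /= hE cat_rcons mulrCA; congr (_ * (_ * _)).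
rewrite !nth_cat ltnn subnn /=.
by have -> : ((size h).-1 < size h)%N; [lia|rewrite hy].
Qed.

(** Both sides are the expectation of the corner entry of the [N]-th power, computed with a
    quadrature exact up to degree [N]. *)
Lemma goe_walks (R : realType) m N :
  wsum N [:: ord0 : 'I_m.+1] (fun h => (nth ord0 h N == ord0)%:R *
    wick (gcov (fun _ _ => 1 : R)) (edges ord0 h N)) = Gn R m 1 N.
Proof.
have [G1 G1E] := gauss_nodes R N.
rewrite -(Gm_Gn G1E)//.
transitivity (wE (Gm G1 m.+1) (fun M => (M ^+ N) ord0 ord0)); last first.
  by apply: eq_wE => M; rewrite expr1 coef_poly ltnSn.
have wE_wsum N' h (Phi : 'M[R]_m.+1 -> seq 'I_m.+1 -> R) :
   wE (Gm G1 m.+1) (fun M => wsum N' h (Phi M)) =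
   wsum N' h (fun s => wE (Gm G1 m.+1) (fun M => Phi M s)).
  by elim: N' h => [|N' IH] h //=; rewrite wE_sum; apply: eq_bigr => z _; exact: IH.
under eq_wE do rewrite mxpow_wsum.
rewrite wE_wsum; apply: eq_wsum => w _.
by rewrite wEZ (Gm_words G1E)// /edges size_map size_iota.
Qed.

(** * Gaussian and mixed moments *)

Section Density.
Local Open Scope ereal_scope.
Context d d' (T : measurableType d) (Y : measurableType d') (R : realType).
Variables (mu : {measure set T -> \bar R}) (nu : {measure set Y -> \bar R}).
Variables (X : T -> Y) (Z : T -> R).
Hypothesis mX : measurable_fun setT X.
Hypothesis mZ : measurable_fun setT Z.
Hypothesis Z0 : forall x, (0 <= Z x)%R.
Hypothesis nuE : forall B, measurable B ->
  \int[mu]_x (\1_B (X x) * Z x)%:E = nu B.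

Import HBNNSimple.

(** From indicators to nonnegative functions by simple approximation and monotone convergence. It
    serves for the normal density, for the law of -X, and for one factor of an independent product,
    the others acting as the density [Z]. *)
Lemma integral_density (g : Y -> R) : measurable_fun setT g ->
  (forall y, 0 <= g y)%R ->
  \int[mu]_x (g (X x) * Z x)%:E = \int[nu]_y (g y)%:E.
Proof.
move=> mg g0.
have mg' : measurable_fun [set: Y] (fun y => (g y)%:E) by exact/measurable_EFinP.
pose h := nnsfun_approx measurableT mg'.
have hcvg y : (h n y)%:E @[n --> \oo] --> (g y)%:E.
  by apply: (@cvg_nnsfun_approx _ _ _ _ measurableT _ mg' _ y) => // t _; rewrite lee_fin.
have mhX n : measurable_fun setT (fun x => h n (X x) * Z x)%R.
  by apply: measurable_funM => //; exact: measurableT_comp.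
transitivity (limn (fun n => \int[nu]_y (h n y)%:E)); last first.
  rewrite -monotone_convergence//.
  - by apply: eq_integral => y _; apply/cvg_lim.
  - by move=> n; exact/measurable_EFinP.
  - by move=> n y _; rewrite lee_fin.
  - by move=> y _ m n mn; rewrite lee_fin; exact/lefP/nd_nnsfun_approx.
transitivity (limn (fun n => \int[mu]_x (h n (X x) * Z x)%:E)).
  rewrite -monotone_convergence//.
  - apply: eq_integral => x _; apply/esym/cvg_lim => //.
    rewrite EFinM; under eq_fun do rewrite EFinM.
    by apply: cvgeM; [|exact: hcvg|exact: cvg_cst].
  - by move=> n; exact/measurable_EFinP.
  - by move=> n x _; rewrite lee_fin mulr_ge0.
  - move=> x _ m n mn; rewrite lee_fin ler_wpM2r//.
    exact/lefP/nd_nnsfun_approx.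
congr (limn _); apply/funext => n.
rewrite integralT_nnsfun sintegralE.
transitivity (\sum_(y \in range (h n)) \int[mu]_x (y%:E *
    (\1_(h n @^-1` [set y]) (X x) * Z x)%:E)).
  rewrite -ge0_integral_fsum//; last 2 first.
  - move=> y; apply: emeasurable_funM => //; apply/measurable_EFinP.
    by apply: measurable_funM => //; exact: measurableT_comp.
  - move=> y x _; rewrite -EFinM lee_fin mulrA mulr_ge0//.
    exact: nnfun_muleindic_ge0.
  apply: eq_integral => x _; rewrite fimfunE mulr_fsuml -fsumEFin//.
  by apply: eq_fsbigr => y _; rewrite -EFinM mulrA.
apply: eq_fsbigr => y /set_mem [t _ <-].
rewrite ge0_integralZl//.
- by rewrite nuE.
- apply/measurable_EFinP; apply: measurable_funM => //; exact: measurableT_comp.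
- by move=> x _; rewrite lee_fin mulr_ge0.
- by rewrite lee_fin.
Qed.

End Density.

Section GaussianMoments.
Variable R : realType.
Notation mu := (@lebesgue_measure R).

Lemma gaussian_moment_pdf p : gaussian_moment R (2 * p) =
  (\int[mu]_x (x ^+ (2 * p) * normal_pdf 0 1 x)%:E)%E.
Proof.
rewrite /gaussian_moment; symmetry.
apply: (@integral_density _ _ _ _ R mu (@normal_prob R 0 1) id (normal_pdf 0 1)) => //.
- exact: measurable_normal_pdf.
- by move=> x; exact: normal_pdf_ge0.
- move=> B mB; rewrite /normal_prob [RHS]integral_mkcond; apply: eq_integral => x _.
  rewrite /patch indicE; case: ifP => _; by rewrite ?mul1r ?mul0r.
- by move=> x; rewrite exprM exprn_ge0// sqr_ge0.
Qed.

Let pdf (x : R) : R := normal_pdf 0 1 x.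

Let pdfE x : pdf x = normal_peak 1 * expR (- x ^+ 2 / 2).
Proof. by rewrite /pdf normal_pdfE ?oner_neq0// /normal_fun subr0 expr1n. Qed.

Let is_derive_pdf (x : R) : is_derive x (1 : R) (fun x : R => - pdf x) (x * pdf x).
Proof.
have -> : (fun x => - pdf x) = (fun x => - (normal_peak 1 * expR (- x ^+ 2 / 2))).
  by apply/funext => y; rewrite pdfE.
rewrite pdfE; apply: is_derive_eq.
by rewrite /GRing.scale /=; field.
Qed.

Let is_derive_pow p (x : R) :
  is_derive x (1 : R) (fun x : R => x ^+ p.+1) (p.+1%:R * x ^+ p).
Proof.
have -> : (fun x : R => x ^+ p.+1) = horner 'X^(p.+1) by apply/funext => y; rewrite hornerXn.
have -> : p.+1%:R * x ^+ p = (('X^(p.+1))^`()).[x].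
  by rewrite derivXn hornerMn hornerXn /= mulr_natl.
exact: is_derive_poly.
Qed.

Let deriv_everywhere (F f : R -> R) a b : (forall x : R, is_derive x (1 : R) F (f x)) ->
  derivable_oo_LRcontinuous F a b /\ derive1 F = f.
Proof.
move=> dF; have cF x : {for x, continuous F}.
  by apply: differentiable_continuous; apply/derivable1_diffP; case: (dF x).
split; last by apply/funext => x; rewrite derive1E; apply: derive_val.
split.
- by move=> x _; case: (dF x).
- exact/cvg_at_right_filter/cF.
- exact/cvg_at_left_filter/cF.
Qed.

Let truncated_moment p n :
  (\int[mu]_(x in `[(- n%:R)%R, n%:R%R]) (x ^+ (2 * p) * pdf x)%:E <= (gmom 1 (2 * p))%:E)%E.
Proof.
have m_mom q : measurable_fun [set: R] (fun x => x ^+ (2 * q) * pdf x).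
  by apply: measurable_funM; [exact: exprn_measurable|exact: measurable_normal_pdf].
have mom0 q x : 0 <= x ^+ (2 * q) * pdf x.
  by rewrite mulr_ge0 ?normal_pdf_ge0// exprM exprn_ge0// sqr_ge0.
elim: p => [|p IH].
  apply: le_trans (_ : \int[mu]_x (x ^+ (2 * 0) * pdf x)%:E <= _)%E.
    apply: ge0_subset_integral => //.
    - by apply/measurable_EFinP; exact: (m_mom 0%N).
    - by move=> x _; rewrite lee_fin.
  rewrite le_eqVlt; apply/orP; left; apply/eqP.
  rewrite /= -(integral_normal_pdf 0 1); apply: eq_integral => x _.
  by rewrite muln0 expr0 mul1r.
case: n IH => [|n] IH.
  rewrite oppr0 set_itv1 integral_set1.
  by rewrite lee_fin; apply: gmom_ge0.
set M : R := n.+1%:R.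
have M0 : 0 < M by rewrite ltr0n.
have [D1 D2] := deriv_everywhere (- M) M (is_derive_pow (2 * p)).
have [D3 D4] := deriv_everywhere (- M) M is_derive_pdf.
have cpdf : continuous pdf by apply: continuous_normal_pdf; exact: oner_neq0.
have cid' : continuous (id : R -> R) by move=> x; exact: cvg_id.
have cX q : continuous (fun x : R => x ^+ q) by move=> x; exact: exprn_continuous.
have -> : (\int[mu]_(x in `[(- M)%R, M]) (x ^+ (2 * p.+1) * pdf x)%:E =
  \int[mu]_(x in `[(- M)%R, M]) (x ^+ (2 * p).+1 * (x * pdf x))%:E)%E.
  apply: eq_integral => x _; congr EFin.
  have -> : (2 * p.+1 = (2 * p).+2)%N by lia.
  by rewrite exprSr mulrA.
rewrite (@integration_by_parts R (fun x => x ^+ (2 * p).+1) (fun x => - pdf x)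
   (fun x => (2 * p).+1%:R * x ^+ (2 * p)) (fun x => x * pdf x))//; first last.
- by move=> x _; rewrite D4.
- by apply: continuous_subspaceT => x; apply: cvgM; [exact: cid'|exact: cpdf].
- by move=> x _; rewrite D2.
- by apply: continuous_subspaceT => x; apply: cvgM; [exact: cvg_cst|exact: cX].
- by lra.
have -> : (\int[mu]_(x in `[(- M)%R, M]) ((2 * p).+1%:R * x ^+ (2 * p) * - pdf x)%:E =
   - \int[mu]_(x in `[(- M)%R, M]) ((2 * p).+1%:R%:E * (x ^+ (2 * p) * pdf x)%:E))%E.
  rewrite -integral_ge0N; last by move=> x _; rewrite -EFinM lee_fin mulr_ge0.
  by apply: eq_integral => x _; rewrite -EFinM -EFinN; congr EFin; ring.
rewrite oppeK ge0_integralZl//; last 2 first.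
- by apply/measurable_EFinP; apply: measurable_funTS; exact: (m_mom p).
- by move=> x _; rewrite lee_fin.
have -> : (gmom 1 (2 * p.+1))%:E = ((2 * p).+1%:R%:E * (gmom 1 (2 * p))%:E)%E :> \bar R.
  have -> : (2 * p.+1 = (2 * p).+2)%N by lia.
  by rewrite -EFinM -[RHS]/(((2 * p).+1%:R * gmom 1 (2 * p))%:E) -[(2 * p).+1%:R]mulr1.
rewrite -[leRHS]add0e; apply: leeD; last by rewrite lee_wpmul2l// lee_fin.
rewrite lee_fin.
have -> : (- M) ^+ (2 * p).+1 = - M ^+ (2 * p).+1.
  by rewrite exprNn -signr_odd /= oddM /= expr1 mulN1r.
have := mulr_ge0 (exprn_ge0 (2 * p).+1 (ltW M0)) (normal_pdf_ge0 0 1 M).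
have := mulr_ge0 (exprn_ge0 (2 * p).+1 (ltW M0)) (normal_pdf_ge0 0 1 (- M)).
by rewrite /pdf; lra.
Qed.

Lemma gaussian_moment_le p : (gaussian_moment R (2 * p) <= (gmom 1 (2 * p))%:E)%E.
Proof.
rewrite gaussian_moment_pdf.
have m_mom : measurable_fun [set: R] (fun x => x ^+ (2 * p) * pdf x).
  by apply: measurable_funM; [exact: exprn_measurable|exact: measurable_normal_pdf].
have mom0 x : 0 <= x ^+ (2 * p) * pdf x.
  by rewrite mulr_ge0 ?normal_pdf_ge0// exprM exprn_ge0// sqr_ge0.
pose F n : set R := `[- n%:R, n%:R]%classic.
have FT : \bigcup_n F n = [set: R].
  rewrite -subTset => x _; exists (Num.bound `|x|) => //.
  have := archi_boundP (normr_ge0 x); rewrite /F /= in_itv /= ltr_norml.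
  by move=> /andP[x1 x2]; rewrite !ltW.
have := @ge0_nondecreasing_set_cvg_integral _ (measurableTypeR R) R F (fun x => (x ^+ (2 * p) * pdf x)%:E) mu.
rewrite FT => H.
have {}H : (\int[mu]_(x in F i) (x ^+ (2 * p) * pdf x)%:E @[i --> \oo] -->
    \int[mu]_x (x ^+ (2 * p) * pdf x)%:E)%E.
  apply: H.
  - move=> i j ij; apply/subsetPset => x; rewrite /F /= !in_itv /= => /andP[x1 x2].
    have : (i%:R : R) <= j%:R by rewrite ler_nat.
    by move=> ?; apply/andP; split; lra.
  - by move=> i; exact: measurable_itv.
  - by move=> i; apply/measurable_EFinP; apply: measurable_funTS; exact: m_mom.
  - by move=> i x _; rewrite lee_fin.
apply: (cvge_le _ H); near=> i; exact: truncated_moment.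
Unshelve. all: by end_near.
Qed.
End GaussianMoments.

From mathcomp Require Import finmap.

(** * Means and independence *)

Section Expectation.
Context d (T : measurableType d) (R : realType) (P : probability T R).
Local Open Scope ereal_scope.
Implicit Types (f g : T -> R) (a c : R).

(** Integrability travels with the value, so linear combinations need no side conditions. *)
Definition has_mean (g : T -> R) (c : R) :=
  P.-integrable setT (EFin \o g) /\ \int[P]_x (g x)%:E = c%:E.

Lemma eq_has_mean g g' c : g =1 g' -> has_mean g c -> has_mean g' c.
Proof. by move=> /funext ->. Qed.

Lemma has_mean_ge0 g c : measurable_fun setT g -> (forall x, 0 <= g x)%R ->
  \int[P]_x (g x)%:E = c%:E -> has_mean g c.
Proof.
move=> mg g0 gc; split=> //; apply/integrableP; split; first exact/measurable_EFinP.
under eq_integral do rewrite /= ger0_norm//.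
by rewrite gc ltry.
Qed.

Lemma integrable_has_mean g : P.-integrable setT (EFin \o g) -> exists c, has_mean g c.
Proof.
move=> ig; exists (fine (\int[P]_x (g x)%:E)); split => //.
by rewrite fineK//; exact: integrable_fin_num.
Qed.

Lemma dominated_has_mean f g c : measurable_fun setT f ->
  (forall x, `|f x| <= g x)%R -> has_mean g c -> exists c, has_mean f c.
Proof.
move=> mf fg [ig _]; apply: integrable_has_mean.
apply: (le_integrable measurableT _ _ ig); first exact/measurable_EFinP.
move=> x _ /=; rewrite lee_fin; apply: le_trans (fg x) _; exact: ler_norm.
Qed.

Lemma has_meanB f g a c : has_mean f a -> has_mean g c ->
  has_mean (fun x => f x - g x)%R (a - c)%R.
Proof.
move=> [i1 e1] [i2 e2]; split; last first.
  by rewrite integralB_EFin// e1 e2.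
by apply: eq_integrable (integrableB measurableT i1 i2).
Qed.

Lemma has_meanZ r f a : has_mean f a -> has_mean (fun x => r * f x)%R (r * a)%R.
Proof.
move=> [i1 e1]; split; first exact: eq_integrable (integrableZl measurableT r i1).
under eq_integral do rewrite EFinM.
by rewrite integralZl// e1.
Qed.

Lemma has_meanD f g a c : has_mean f a -> has_mean g c ->
  has_mean (fun x => f x + g x)%R (a + c)%R.
Proof.
move=> fa gc; have := has_meanB fa (has_meanZ (-1) gc).
rewrite mulN1r opprK; apply: eq_has_mean => x.
by rewrite mulN1r opprK.
Qed.

Lemma has_mean_cst r : has_mean (fun=> r) r.
Proof.
split; first exact: finite_measure_integrable_cst.
rewrite integral_cst// -[RHS]mule1; congr (_ * _); exact: probability_setT.
Qed.

Lemma has_mean_sum J (s : seq J) (f : J -> T -> R) (a : J -> R) : (forall j, has_mean (f j) (a j)) ->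
  has_mean (fun x => \sum_(j <- s) f j x)%R (\sum_(j <- s) a j)%R.
Proof.
move=> fa; elim: s => [|j s IH].
  by rewrite big_nil; apply: eq_has_mean (has_mean_cst 0) => x; rewrite big_nil.
rewrite big_cons; apply: eq_has_mean (has_meanD (fa j) IH) => x.
by rewrite big_cons.
Qed.

Lemma has_mean_le f g a c : (forall x, f x <= g x)%R -> has_mean f a -> has_mean g c ->
  (a <= c)%R.
Proof.
move=> fg [i1 e1] [i2 e2]; rewrite -lee_fin -e1 -e2.
by apply: le_integral => // x _; rewrite lee_fin.
Qed.

Lemma has_mean_unique f a c : has_mean f a -> has_mean f c -> a = c.
Proof. by move=> [_ e1] [_]; rewrite e1 => -[]. Qed.

End Expectation.

Section Independence.
Context d (T : measurableType d) (R : realType) (P : probability T R).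
Variables (I : choiceType) (D : set I) (X : I -> {RV P >-> R}).
Hypothesis indep : mutually_independent D X.

(** The variables in [t] are tested by indicators, as in the definition of independence;
    [integral_density] upgrades one indicator at a time to a function. *)
Let indep_ge0 (F : I -> R -> R) c s t (B : I -> set R) : uniq (s ++ t) ->
  (forall i, i \in s ++ t -> D i) ->
  (forall i, measurable_fun setT (F i)) -> (forall i y, 0 <= F i y) ->
  (forall i, i \in s -> has_mean P (fun x => F i (X i x)) (c i)) ->
  (forall i, measurable (B i)) ->
  (\int[P]_x ((\prod_(i <- s) F i (X i x)) * \prod_(i <- t) \1_(B i) (X i x))%:E =
   ((\prod_(i <- s) c i) * \prod_(i <- t) fine (P (X i @^-1` B i)))%:E)%E.
Proof.
move=> + + mF F0 Fc; elim: s t B Fc => [|i s IH] t B Fc ust sD mB.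
  rewrite big_nil mul1r.
  have mBX i : measurable (X i @^-1` B i).
    by rewrite -[X in measurable X]setTI; exact: measurable_funPT.
  pose J : {fset I} := [fset i in t]%fset.
  have Jt i : (i \in J) = (i \in t) by rewrite !inE.
  have := @indep J B _ _.
  have -> : (\prod_(i <- J) P (X i @^-1` B i) =
     (\prod_(i <- t) fine (P (X i @^-1` B i)))%:E)%E.
    rewrite -prodEFin (perm_big t); last by apply: uniq_perm => //; exact: fset_uniq.
    by apply: eq_bigr => i _; rewrite fineK// fin_num_measure.
  move=> <-//; last by move=> i /=; rewrite Jt => it; exact: sD.
  pose A := \bigcap_(i in [set` J]) X i @^-1` B i.
  have mA : measurable A by apply: fin_bigcap_measurable => //; exact: finite_fset.
  transitivity (\int[P]_x (\1_A x)%:E)%E; last by rewrite integral_indic// setIT.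
  apply: eq_integral => x _; congr EFin.
  rewrite big_nil mul1r indicE.
  case: (boolP (x \in _)) => [/set_mem H|/negP H].
    rewrite big_seq big1// => i it; rewrite indicE mem_set//.
    by apply: H => /=; rewrite Jt.
  have [i it iB] : exists2 i, i \in t & ~ B i (X i x).
    apply: contrapT => K; apply: H; apply/mem_set => i /=; rewrite Jt => it.
    by apply: contrapT => iB; apply: K; exists i.
  by rewrite (bigD1_seq i)/= ?indicE ?memNset ?mul0r.
have [iD sD'] : D i /\ forall j, j \in s ++ t -> D j.
  by split => [|j js]; apply: sD; rewrite inE ?eqxx ?js ?orbT.
have /andP[ist ust'] : (i \notin s ++ t) && uniq (s ++ t) by [].
set K := (\prod_(j <- s) c j) * \prod_(j <- t) fine (P (X j @^-1` B j)).
have K0 : 0 <= K.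
  rewrite mulr_ge0//; last by apply: prodr_ge0 => j _; rewrite fine_ge0.
  rewrite big_seq; apply: prodr_ge0 => j js.
  have [_ jc] := Fc j (mem_behead (js : j \in behead (i :: s))).
  by rewrite -lee_fin -jc integral_ge0// => x _; rewrite lee_fin.
pose Z x := (\prod_(j <- s) F j (X j x)) * \prod_(j <- t) \1_(B j) (X j x).
have mZ : measurable_fun setT Z.
  apply: measurable_funM; apply: measurable_prod => j _.
    by apply: measurableT_comp.
  apply: measurableT_comp => //.
have Z0 x : 0 <= Z x by rewrite mulr_ge0 ?prodr_ge0.
(* As a function of the event [B'], the integral is the law of [X i] scaled by the constant [K] of
   the other factors. *)
have H B' : measurable B' ->
    (\int[P]_x (\1_B' (X i x) * Z x)%:E = mscale (NngNum K0) (distribution P (X i)) B')%E.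
  move=> mB'; pose B2 j := if j == i then B' else B j.
  have B2t j : j \in s ++ t -> B2 j = B j.
    by move=> jt; rewrite /B2; case: eqP => // ji; rewrite -ji jt in ist.
  have := IH (i :: t) B2 _ _ _ _.
  have -> : (fun x => ((\prod_(i0 <- s) F i0 (X i0 x)) *
      \prod_(i0 <- (i :: t)) \1_(B2 i0) (X i0 x))%:E) =
      (fun x => (\1_B' (X i x) * Z x)%:E).
    apply/funext => x; rewrite big_cons {1}/B2 eqxx mulrCA; congr EFin; congr (_ * (_ * _)).
    by apply: eq_big_seq => j jt; rewrite B2t// mem_cat jt orbT.
  move=> ->; last first.
  - by move=> j; rewrite /B2; case: ifP.
  - by move=> j; rewrite -cat_rcons mem_cat mem_rcons -mem_cat; exact: sD.
  - by rewrite -cat_rcons (perm_uniq (_ : perm_eq _ (i :: s ++ t)))//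
      perm_sym -cat_cons perm_cat2r perm_sym perm_rcons.
  - by move=> j js; apply: Fc; rewrite inE js orbT.
  rewrite big_cons {1}/B2 eqxx /mscale/= EFinM EFinM.
  rewrite fineK ?fin_num_measure//; last first.
    by rewrite -[X in measurable X]setTI; exact: measurable_funPT.
  rewrite muleA [X in (X * _)%E]muleC -muleA muleC -EFinM; congr (_%E * _)%E; congr EFin; congr (_ * _).
  by apply: eq_big_seq => j jt; rewrite B2t// mem_cat jt orbT.
have := integral_density (measurable_funPT (X i)) mZ Z0 H (mF i) (F0 i).
rewrite ge0_integral_mscale//; last 2 first.
- by apply/measurable_EFinP.
- by move=> y _; rewrite lee_fin.
rewrite ge0_integral_distribution//; last 2 first.
- by apply/measurable_EFinP.
- by move=> y; rewrite lee_fin.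
have [_ /= ->] := Fc i (mem_head _ _).
move=> e; rewrite [in RHS]big_cons -mulrA [in RHS]mulrC EFinM; apply: etrans e.
by apply: eq_integral => x _; rewrite big_cons mulrA.
Qed.

(** Signed factors are split one at a time into positive and negative parts; [t] collects the
    factors already nonnegative. *)
Lemma indep_has_mean (h : I -> R -> R) c s : uniq s -> (forall i, i \in s -> D i) ->
  (forall i, measurable_fun setT (h i)) ->
  (forall i, i \in s -> has_mean P (fun x => h i (X i x)) (c i)) ->
  has_mean P (fun x => \prod_(i <- s) h i (X i x)) (\prod_(i <- s) c i).
Proof.
suff H t : uniq (s ++ t) -> (forall i, i \in s ++ t -> D i) ->
  (forall i, measurable_fun setT (h i)) -> (forall i, i \in t -> forall y, 0 <= h i y) ->
  (forall i, i \in s ++ t -> has_mean P (fun x => h i (X i x)) (c i)) ->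
  has_mean P (fun x => \prod_(i <- s ++ t) h i (X i x)) (\prod_(i <- s ++ t) c i).
  by move=> us sD mh hc; have := H [::]; rewrite cats0; apply.
elim: s t h c => [|i s IH] t h c ust sD mh h0 hc.
  have mp : measurable_fun [set: T] (fun x => \prod_(i <- t) h i (X i x)).
    by apply: measurable_prod => j _; apply: measurableT_comp.
  apply: has_mean_ge0 => //.
    by move=> x; rewrite big_seq; apply: prodr_ge0 => j jt; exact: h0.
  (* [indep_ge0] asks for nonnegativity at every index, whereas [h] has it only on [t]. *)
  pose F j y := Num.max (h j y) 0.
  have Fh j y : j \in t -> F j y = h j y by move=> jt; rewrite /F max_l// h0.
  have := @indep_ge0 F c t [::] (fun=> setT); rewrite cats0 => G.
  have {}G := G ust sD _ _ _ _.
  transitivity (\int[P]_x ((\prod_(i <- t) F i (X i x)) * \prod_(i <- [::]) \1_setT (X i x))%:E)%E.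
    apply: eq_integral => x _; rewrite big_nil mulr1; congr EFin.
    by apply: eq_big_seq => j jt; rewrite Fh.
  rewrite G ?big_nil ?mulr1//.
  - by move=> j; apply: measurable_maxr.
  - by move=> j y; rewrite /F le_max lexx orbT.
  - by move=> j jt; apply: eq_has_mean (hc j jt) => x; rewrite Fh.
have /andP[ist ust'] : (i \notin s ++ t) && uniq (s ++ t) by [].
have key (u : R -> R) e : measurable_fun setT u -> (forall y, 0 <= u y) ->
   has_mean P (fun x => u (X i x)) e ->
   has_mean P (fun x => u (X i x) * \prod_(j <- s ++ t) h j (X j x)) (e * \prod_(j <- s ++ t) c j).
  move=> mu u0 ue.
  pose h2 j := if j == i then u else h j; pose c2 j := if j == i then e else c j.
  have pm : perm_eq (s ++ i :: t) (i :: s ++ t).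
    by rewrite -cat_rcons -cat_cons perm_cat2r perm_rcons.
  have ne j : j \in s ++ t -> (j == i) = false.
    by move=> jt; apply/negP => /eqP ji; rewrite -ji jt in ist.
  have := IH (i :: t) h2 c2 _ _ _ _ _.
  have -> : \prod_(j <- s ++ i :: t) c2 j = e * \prod_(j <- s ++ t) c j.
    rewrite (perm_big _ pm) big_cons {1}/c2 eqxx; congr (_ * _).
    by apply: eq_big_seq => j jt; rewrite /c2 ne.
  rewrite (perm_uniq pm); move=> G; apply: eq_has_mean (G _ _ _ _ _) => //.
  - move=> x; rewrite (perm_big _ pm) big_cons {1}/h2 eqxx; congr (_ * _).
    by apply: eq_big_seq => j jt; rewrite /h2 ne.
  - by move=> j; rewrite (perm_mem pm); exact: sD.
  - by move=> j; rewrite /h2; case: ifP.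
  - move=> j; rewrite inE /h2; case: eqP => //= _ jt; exact: h0.
  - move=> j; rewrite (perm_mem pm) inE /h2 /c2; case: eqP => [->//|_ /= jt].
    by apply: hc; rewrite inE jt orbT.
have hi := hc i (mem_head _ _).
have m1 : measurable_fun setT (fun y => Num.max (h i y) 0) by apply: measurable_maxr.
have m2 : measurable_fun setT (fun y => Num.max (- h i y) 0).
  by apply: measurable_maxr => //; apply: measurableT_comp.
have ih : exists e, has_mean P (fun x => `|h i (X i x)|) e.
  apply: integrable_has_mean; case: hi => /integrable_abse hi _; exact: hi.
have [e he] := ih.
have [e1 he1] : exists e, has_mean P (fun x => Num.max (h i (X i x)) 0) e.
  apply: (dominated_has_mean _ _ he); first exact: (measurableT_comp m1).
  by move=> x; rewrite ger0_norm ?le_max ?lexx ?orbT// ge_max ler_norm normr_ge0.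
have [e2 he2] : exists e, has_mean P (fun x => Num.max (- h i (X i x)) 0) e.
  apply: (dominated_has_mean _ _ he); first exact: (measurableT_comp m2).
  by move=> x; rewrite ger0_norm ?le_max ?lexx ?orbT// ge_max -normrN ler_norm normr_ge0.
have hsplit x : Num.max (h i (X i x)) 0 - Num.max (- h i (X i x)) 0 = h i (X i x).
  by rewrite !maxEle; do 2 case: ifP; lra.
have ec : e1 - e2 = c i.
  by apply: has_mean_unique hi; apply: eq_has_mean (has_meanB he1 he2) => x.
rewrite cat_cons big_cons -ec mulrBl.
apply: eq_has_mean (has_meanB (key _ _ m1 _ he1) (key _ _ m2 _ he2)).
- by move=> x; rewrite big_cons -mulrBl hsplit.
- by move=> y; rewrite le_max lexx orbT.
- by move=> y; rewrite le_max lexx orbT.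
Qed.

End Independence.

(** * Moments of one entry and means of words *)

Section Moments.
Context d (T : measurableType d) (R : realType) (P : probability T R).
Variable X : {RV P >-> R}.
Hypothesis symX : symmetrically_distributed X.
Hypothesis momX : forall p,
  ('E_P[(fun w => X w ^+ (2 * p))%R] <= gaussian_moment R (2 * p)%N)%E.

Let mX := measurable_funPT X.

Let mpow k : measurable_fun setT (fun w => X w ^+ k).
Proof. exact: (measurableT_comp (exprn_measurable k)). Qed.

Let even_moment p : exists c, [/\ has_mean P (fun w => X w ^+ (2 * p)) c,
  0 <= c & c <= gmom 1 (2 * p)].
Proof.
have X0 w : 0 <= X w ^+ (2 * p) by rewrite exprM exprn_ge0// sqr_ge0.
have i0 : (0 <= \int[P]_w (X w ^+ (2 * p))%:E)%E by apply: integral_ge0 => w _; rewrite lee_fin.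
have := le_trans (momX p) (gaussian_moment_le R p); rewrite unlock => H.
have fi : (\int[P]_w (X w ^+ (2 * p))%:E)%E \is a fin_num.
  by rewrite ge0_fin_numE//; apply: le_lt_trans H _; rewrite ltry.
exists (fine (\int[P]_w (X w ^+ (2 * p))%:E)%E); split.
- by apply: has_mean_ge0 (mpow _) _ _ => //; rewrite fineK.
- by rewrite fine_ge0.
- by rewrite -lee_fin fineK.
Qed.

(** Odd moments vanish by symmetry. Nonnegativity is recorded because the bounds get multiplied over
    independent entries. *)
Lemma moment_bounds k : exists c, [/\ has_mean P (fun w => X w ^+ k) c,
  0 <= c & c <= gmom 1 k].
Proof.
have [ok|] := boolP (odd k); last first.
  move=> ek; have -> : (k = 2 * k./2)%N by rewrite mul2n even_halfK.
  exact: even_moment.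
rewrite gmom_odd//; exists 0; split => //.
(* For odd [k], y^k = g(y) - g(-y) with [g] nonnegative, and g(X), g(-X) have the same mean. *)
pose g (y : R) := Num.max y 0 ^+ k.
have mg : measurable_fun setT g.
  by apply: (measurableT_comp (exprn_measurable k)); apply: measurable_maxr.
have g0 y : 0 <= g y by rewrite exprn_ge0// le_max lexx orbT.
have gE (y : R) : g y - g (- y) = y ^+ k.
  have k0 : (0 < k)%N by case: k ok {g mg g0}.
  rewrite /g; case: (boolP (0 <= y)) => [y0|]; last rewrite -ltNge => y0.
    rewrite max_l// max_r; last by rewrite oppr_le0.
    by rewrite expr0n gtn_eqF// subr0.
  rewrite max_r; last exact: ltW.
  rewrite max_l; last by rewrite oppr_ge0 ltW.
  by rewrite exprNn -signr_odd ok expr1 expr0n gtn_eqF// mulN1r sub0r opprK.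
have [c [hc _ _]] := even_moment k.
have dom (y : R) : `|g y| <= 1 + y ^+ (2 * k).
  rewrite ger0_norm// /g.
  have -> : y ^+ (2 * k) = (y ^+ k) ^+ 2 by rewrite -exprM mulnC.
  case: (boolP (0 <= y)) => [y0|]; last rewrite -ltNge => y0.
    by rewrite max_l//; have := sqr_ge0 (y ^+ k - 1); nra.
  rewrite max_r ?(ltW y0)// expr0n.
  by apply: le_trans (_ : 1 <= _); rewrite ?lerDl ?sqr_ge0 ?lern1 ?leq_b1.
have h1 := has_meanD (has_mean_cst P 1) hc.
have [c1 hc1] : exists c, has_mean P (fun w => g (X w)) c.
  by apply: (dominated_has_mean _ _ h1) => // ; apply: measurableT_comp.
have mXN : measurable_fun setT (fun w => - X w) by apply: measurableT_comp.
suff hc2 : has_mean P (fun w => g (- X w)) c1.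
  have := has_meanB hc1 hc2; rewrite subrr; apply: eq_has_mean => w.
  by rewrite gE.
apply: has_mean_ge0 => //; first exact: measurableT_comp.
have [_ <-] := hc1.
transitivity (\int[P]_w (g (- X w) * 1)%:E)%E.
  by apply: eq_integral => w _; rewrite mulr1.
rewrite (integral_density (nu := distribution P X) mXN (Z := fun=> 1))//.
- by rewrite ge0_integral_distribution//; apply/measurable_EFinP.
- move=> B mB; transitivity (P ((fun w => - X w) @^-1` B)); last exact/esym/symX.
  rewrite -[X in P X]setIT -integral_indic//; last first.
    by rewrite -[X in measurable X]setTI; exact: mXN.
  by apply: eq_integral => w _; rewrite mulr1.
Qed.

End Moments.

Section WordMean.
Context d (T : measurableType d) (R : realType) (P : probability T R).
Variables (n : nat) (b : 'I_n -> 'I_n -> R) (xi : 'I_n -> 'I_n -> {RV P >-> R}).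
Hypothesis bC : forall i j, b i j = b j i.
Hypothesis xiC : forall i j, xi i j =1 xi j i.
Hypothesis symX : forall i j, symmetrically_distributed (xi i j).
Hypothesis indep : mutually_independent [set ij : 'I_n * 'I_n | (ij.2 <= ij.1)%N]
  (fun ij => xi ij.1 ij.2).
Hypothesis momX : forall i j (p : nat),
  ('E_P[(fun w => xi i j w ^+ (2 * p))%R] <= gaussian_moment R (2 * p)%N)%E.

Let key (e : 'I_n * 'I_n) := if (e.2 <= e.1)%N then e else (e.2, e.1).
Let coef (a : 'I_n * 'I_n) := (if a.1 == a.2 then Num.sqrt 2 else 1) * b a.1 a.2.

Let gcov_coef e f :
  gcov (fun i j => b i j ^+ 2) e f = coef (key e) ^+ 2 * (key e == key f)%:R.
Proof.
have -> : coef (key e) ^+ 2 = (1 + (e.1 == e.2)%:R) * b e.1 e.2 ^+ 2.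
  have -> : coef (key e) = coef e.
    by rewrite /key; case: ifP => // _; rewrite /coef /= eq_sym bC.
  rewrite /coef exprMn; case: eqP => _ /=; [by rewrite sqr_sqrtr|by rewrite expr1n addr0].
rewrite /gcov [RHS]mulrAC [RHS]mulrC; congr (_ * _); rewrite -natrD -(natrD _ 1) -natrM; congr (_%:R).
case: e f => [i j] [k l]; rewrite /key /=.
case: (leqP j i) => ij; case: (leqP l k) => kl; rewrite !xpair_eqE -!val_eqE /=; lia.
Qed.

(** By independence the mean is a product of moments over lower-triangular positions, bounded factor
    by factor by Gaussian moments; [wick_count] identifies the Gaussian product. *)
Lemma word_mean w : exists c,
  has_mean P (fun o => \prod_(e <- w) random_matrix b xi o e.1 e.2) c /\
  c <= wick (gcov (fun i j => b i j ^+ 2)) w.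
Proof.
rewrite (wick_ext w gcov_coef) (wick_count key (fun a => coef a ^+ 2)).
pose k a := count (fun e => key e == a) w.
have k0 (a : 'I_n * 'I_n) : ~~ (a.2 <= a.1)%N -> k a = 0%N.
  move=> aD; apply/eqP; rewrite -leqn0 leqNgt -has_count; apply/hasPn => -[i j] _.
  rewrite /key /=; apply/negP; case: ifP => ij /eqP E; rewrite -E /= in aD.
    by rewrite ij in aD.
  by move: aD ij; case: leqP => // /ltnW ->.
have E o : \prod_(e <- w) random_matrix b xi o e.1 e.2 =
  \prod_(a : 'I_n * 'I_n) (coef a ^+ k a * xi a.1 a.2 o ^+ k a).
  have rE e : random_matrix b xi o e.1 e.2 = coef (key e) * xi (key e).1 (key e).2 o.
    rewrite mxE /coef /key; case: (leqP e.2 e.1) => _ /=.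
      by case: ifP => _; rewrite ?mul1r.
    by rewrite eq_sym bC xiC; case: ifP => _; rewrite ?mul1r.
  rewrite /k; elim: (w) => [|e v IH].
    by rewrite big_nil big1// => a _; rewrite /= !expr0 mulr1.
  rewrite big_cons IH rE.
  rewrite [in RHS](bigD1 (key e))//= [in LHS](bigD1 (key e))//= eqxx add1n !exprS.
  rewrite mulrA; congr (_ * _); first by ring.
  by apply: eq_bigr => a; rewrite eq_sym => /negPf ->; rewrite add0n.
pose s := [seq a : 'I_n * 'I_n <- enum {: 'I_n * 'I_n} | (a.2 <= a.1)%N].
have prodE (F : 'I_n * 'I_n -> R) : (forall a, k a = 0%N -> F a = 1) ->
    \prod_a F a = \prod_(a <- s) F a.
  move=> F1; rewrite big_filter big_enum_cond /= [LHS](bigID (fun a : 'I_n * 'I_n => (a.2 <= a.1)%N)) /=.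
  by rewrite [X in _ * X]big1 ?mulr1// => a /k0/F1.
have mom a : exists c, [/\ has_mean P (fun o => coef a ^+ k a * xi a.1 a.2 o ^+ k a) c,
    0 <= c & c <= gmom (coef a ^+ 2) (k a)].
  have [c [h c0 cg]] := moment_bounds (symX a.1 a.2) (momX a.1 a.2) (k a).
  have [ok|ek] := boolP (odd (k a)).
    move: cg; rewrite !gmom_odd// => cg; exists 0; split => //.
    have c00 : c = 0 by apply/le_anti/andP.
    by have := has_meanZ (coef a ^+ k a) h; rewrite c00 mulr0.
  have cf0 : 0 <= coef a ^+ k a.
    by rewrite -[k a]even_halfK// -mul2n exprM exprn_ge0// sqr_ge0.
  exists (coef a ^+ k a * c); split; [exact: has_meanZ|exact: mulr_ge0|].
  by rewrite gmom_scale ler_wpM2l.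
have [c cP] := choice mom.
exists (\prod_(a <- s) c a); split; last first.
  rewrite [leRHS]prodE; last by move=> a; rewrite -/(k a) => ->.
  by apply: ler_prod => a _; have [_ -> ->] := cP a.
have mh (a : 'I_n * 'I_n) : measurable_fun setT (fun y : R => coef a ^+ k a * y ^+ k a).
  by apply: measurable_funM => //; exact: exprn_measurable.
have := indep_has_mean indep (h := fun a y => coef a ^+ k a * y ^+ k a) (c := c) (s := s).
move=> H; apply: eq_has_mean (H _ _ mh _).
- by move=> o; rewrite E prodE// => a ->; rewrite !expr0 mulr1.
- by rewrite filter_uniq// enum_uniq.
- by move=> a; rewrite mem_filter => /andP[].
- by move=> a _; have [] := cP a.
Qed.

Lemma has_mean_wsum N (h : seq 'I_n) (F : seq 'I_n -> T -> R) c :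
  (forall h, has_mean P (F h) (c h)) ->
  has_mean P (fun o => wsum N h (fun h => F h o)) (wsum N h c).
Proof.
move=> Fc; elim: N h => [|N IH] h /=; first exact: Fc.
exact: has_mean_sum.
Qed.

Lemma trace_mean m N : (forall i j, b i j ^+ 2 <= 1) ->
  (forall i, \sum_j b i j ^+ 2 <= m.+1%:R) ->
  exists c, has_mean P (fun o => \tr (random_matrix b xi o ^+ N)) c /\
    c <= n%:R * Gn R m 1 N.
Proof.
move=> b1 bm; have [c cP] := choice word_mean.
have hx x := @has_mean_wsum N [:: x]
  (fun h o => (nth x h N == x)%:R * \prod_(e <- edges x h N) random_matrix b xi o e.1 e.2)
  (fun h => (nth x h N == x)%:R * c (edges x h N))
  (fun h => has_meanZ _ (cP (edges x h N)).1).
exists (\sum_(x <- index_enum 'I_n) wsum N [:: x] (fun h => (nth x h N == x)%:R * c (edges x h N))).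
split.
  apply: eq_has_mean (has_mean_sum (index_enum 'I_n) hx) => o.
  by rewrite /mxtrace; apply: eq_bigr => x _; rewrite mxpow_wsum.
apply: le_trans (_ : \sum_(x < n) Gn R m 1 N <= _); last first.
  by rewrite sumr_const card_ord mulr_natl.
apply: ler_sum => x _; rewrite -goe_walks.
apply: le_trans (@walk_compare R n m N (fun i j => b i j ^+ 2) x _ bm).
- by apply: wsum_le => h _; rewrite ler_wpM2l//; have [] := cP (edges x ([:: x] ++ h) N).
- by move=> i j; rewrite sqr_ge0 b1.
Qed.

End WordMean.

(** * Spectral norm *)

Section SpectralNorm.
Variables (R : realType) (n : nat).
Implicit Types A : 'M[R]_n.

Lemma sum_cauchy_schwarz (I : finType) (a b : I -> R) :
  (\sum_i a i * b i) ^+ 2 <= (\sum_i a i ^+ 2) * \sum_i b i ^+ 2.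
Proof.
have : 0 <= \sum_i \sum_j (a i * b j - a j * b i) ^+ 2.
  by apply: sumr_ge0 => i _; apply: sumr_ge0 => j _; exact: sqr_ge0.
have -> : \sum_i \sum_j (a i * b j - a j * b i) ^+ 2 =
    \sum_i \sum_j (a i ^+ 2 * b j ^+ 2 + a j ^+ 2 * b i ^+ 2 - 2 * (a i * b i * (a j * b j))).
  by apply: eq_bigr => i _; apply: eq_bigr => j _; ring.
under eq_bigr do rewrite sumrB big_split /=.
rewrite sumrB big_split /=.
have S1 : \sum_i \sum_j a i ^+ 2 * b j ^+ 2 = (\sum_i a i ^+ 2) * \sum_i b i ^+ 2.
  by rewrite mulr_suml; apply: eq_bigr => i _; rewrite mulr_sumr.
have S2 : \sum_i \sum_j a j ^+ 2 * b i ^+ 2 = (\sum_i a i ^+ 2) * \sum_i b i ^+ 2.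
  by rewrite exchange_big.
have S3 : \sum_i \sum_j 2 * (a i * b i * (a j * b j)) = 2 * (\sum_i a i * b i) ^+ 2.
  rewrite expr2 mulr_suml mulr_sumr; apply: eq_bigr => i _.
  by rewrite !mulr_sumr.
by rewrite S1 S2 S3; lra.
Qed.

Lemma trmx_exp A N : A^T = A -> (A ^+ N)^T = A ^+ N.
Proof.
move=> AT; elim: N => [|N IH]; first by rewrite !expr0 trmx1.
by rewrite [in LHS]exprS trmx_mul IH AT [in RHS]exprSr.
Qed.

Lemma scalemx_exp (a : R) A N : (a *: A) ^+ N = a ^+ N *: A ^+ N.
Proof.
elim: N => [|N IH]; first by rewrite !expr0 scale1r.
by rewrite !exprS IH -[LHS]scalemxAl -[X in _ *: X]scalemxAr scalerA.
Qed.

Lemma trace_even_exp A p : A^T = A -> \tr (A ^+ (2 * p)) = \sum_j \sum_i (A ^+ p) i j ^+ 2.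
Proof.
move=> AT; rewrite mul2n -addnn exprD -{1}(trmx_exp p AT) /mxtrace.
by apply: eq_bigr => j _; rewrite mxE; apply: eq_bigr => i _; rewrite mxE expr2.
Qed.

Lemma trace_even_exp_ge0 A p : A^T = A -> 0 <= \tr (A ^+ (2 * p)).
Proof.
by move=> AT; rewrite trace_even_exp// sumr_ge0// => j _; apply: sumr_ge0 => i _; exact: sqr_ge0.
Qed.

(** For an eigenvector [v], s^(2p) |v|^2 = |v A^p|^2; by Cauchy-Schwarz this is at most |v|^2 times
    the sum of the squared entries of A^p, which is the trace. *)
Lemma singular_value_trace A s p : A^T = A -> singular_value A s ->
  s ^+ (2 * p) <= \tr (A ^+ (2 * p)).
Proof.
move=> AT [s0 /eigenvalueP[v vA v0]].
have {}vA : v *m (A ^+ 2) = s ^+ 2 *: v by rewrite expr2 -vA AT.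
have vAp : v *m (A ^+ (2 * p)) = s ^+ (2 * p) *: v.
  rewrite !exprM; elim: p => [|p IH]; first by rewrite !expr0 mulmx1 scale1r.
  by rewrite exprSr mulmxA IH -scalemxAl vA scalerA -exprSr.
have [i vi] : exists i, v 0 i != 0.
  apply/existsP; apply: contraNT v0; rewrite negb_exists => /forallP H.
  by apply/eqP/rowP => i; rewrite mxE; apply/eqP; move: (H i); rewrite negbK.
set V := \sum_i v 0 i ^+ 2.
have V0 : 0 < V.
  rewrite /V (bigD1 i)//= ltr_pwDl ?sumr_ge0// => [|j _]; last exact: sqr_ge0.
  by rewrite lt0r sqrf_eq0 vi sqr_ge0.
rewrite -(ler_pM2r V0).
have -> : s ^+ (2 * p) * V = \sum_j (\sum_i v 0 i * (A ^+ p) i j) ^+ 2.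
  have -> : s ^+ (2 * p) * V = (v *m A ^+ (2 * p) *m v^T) 0 0.
    by rewrite vAp mxE mulr_sumr; apply: eq_bigr => j _; rewrite !mxE expr2 mulrA.
  rewrite mul2n -addnn exprD mulmxA -mulmxA -{2}(trmx_exp p AT) -trmx_mul mxE.
  by apply: eq_bigr => j _; rewrite !mxE expr2.
rewrite trace_even_exp// mulr_suml; apply: ler_sum => j _.
by rewrite mulrC; exact: sum_cauchy_schwarz.
Qed.

(** The supremum of the empty set is 0, so a norm above some [c >= 0] has a witness. *)
Lemma lt_spectral_norm A (c : R) : 0 <= c -> c < spectral_norm A ->
  exists2 s, singular_value A s & c < s.
Proof.
move=> c0 cA; apply: sup_gt => //.
apply: contrapT => /set0P/negP; rewrite negbK => /eqP S0.
by move: cA; rewrite /spectral_norm S0 sup0 ltNge c0.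
Qed.

Lemma spectral_norm_trace A (c : R) p : A^T = A -> 0 <= c -> c < spectral_norm A ->
  c ^+ (2 * p) <= \tr (A ^+ (2 * p)).
Proof.
move=> AT c0 /(lt_spectral_norm c0)[s sA cs].
apply: le_trans (singular_value_trace p AT sA).
by apply: lerXn2r (ltW cs); rewrite nnegrE//; apply: le_trans (ltW cs).
Qed.

(** The event becomes the existence of a root beyond c^2, the form that [measurable_root_gt]
    handles. *)
Lemma lt_spectral_normP A (c : R) : A^T = A -> 0 <= c ->
  c < spectral_norm A <-> exists2 l, c ^+ 2 < l & root (char_poly (A^T *m A)) l.
Proof.
move=> AT c0; split.
  move=> /(lt_spectral_norm c0)[s [s0 es] cs].
  exists (s ^+ 2); last by rewrite -eigenvalue_root_char.
  by rewrite ltr_pXn2r// nnegrE.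
move=> [l cl rl].
have l0 : 0 <= l by apply: le_trans (ltW cl); exact: sqr_ge0.
have cs : c < Num.sqrt l by rewrite -(ltr_pXn2r (_ : 0 < 2)%N)// ?nnegrE ?sqrtr_ge0// sqr_sqrtr.
apply: lt_le_trans cs _; apply: ub_le_sup.
  (* Singular values are bounded: s <= (1 + s^2) / 2, and s^2 is at most the trace. *)
  exists (1 + \tr (A ^+ (2 * 1))) => s /(singular_value_trace 1 AT); rewrite muln1.
  by move=> H; have := sqr_ge0 (s - 1); nra.
by split; rewrite ?sqrtr_ge0// sqr_sqrtr// eigenvalue_root_char.
Qed.

End SpectralNorm.

(** * Measurability of the deviation event *)

Section Measurability.
Context d (T : measurableType d) (R : realType).

(* By compactness, [f o] vanishes on a segment as soon as it takes arbitrarily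
   small values at rational points of that segment. *)
Lemma measurable_root_gt (f : T -> R -> R) (a : R) :
  (forall l, measurable_fun setT (f^~ l)) -> (forall o, continuous (f o)) ->
  measurable [set o | exists2 l, a < l & f o l = 0].
Proof.
move=> mf cf.
pose lo k : R := a + k.+1%:R^-1.
pose G k j (q : rat) := if (lo k <= ratr q) && (ratr q <= k%:R :> R) then
  [set o | `|f o (ratr q)| < j.+1%:R^-1 :> R] else set0.
have -> : [set o | exists2 l, a < l & f o l = 0] =
    \bigcup_k \bigcap_j \bigcup_q G k j q.
  apply/seteqP; split => o; [move=> [l al fl]|move=> [k _ H]].
    pose k := maxn (Num.bound ((l - a)^-1)) (Num.bound `|l|).
    have la : 0 < l - a by rewrite subr_gt0.
    have lok : lo k < l.
      rewrite /lo -ltrBrDl invf_plt ?posrE//.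
      apply: lt_le_trans (archi_boundP _) _; first by rewrite invr_ge0 ltW.
      by rewrite ler_nat; apply: leqW; exact: leq_maxl.
    have lk : l < k%:R.
      apply: le_lt_trans (ler_norm _) _; apply: lt_le_trans (archi_boundP (normr_ge0 _)) _.
      by rewrite ler_nat leq_maxr.
    exists k => // j _.
    have j0 : 0 < j.+1%:R^-1 :> R by rewrite invr_gt0.
    have /cvgrPdist_lt/(_ _ j0)[e /= e0 He] := cf o l.
    have le : l < Num.min (l + e) k%:R by rewrite lt_min lk ltrDl e0.
    have [q] := rat_in_itvoo le; rewrite in_itv /= lt_min => /and3P[lq qe qk].
    exists q => //; rewrite /G (ltW (lt_trans lok lq)) ltW//=.
    have := He (ratr q); rewrite /= fl sub0r normrN; apply.
    by rewrite ltr_norml; apply/andP; split; lra.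
  have [q0 _ G0] := H 0%N I.
  have lok : lo k <= k%:R.
    by move: G0; rewrite /G; case: ifP => // /andP[? ?] _; apply: le_trans; eassumption.
  have cN : {within `[lo k, k%:R], continuous (fun l => `|f o l|)}.
    by apply: continuous_subspaceT => l; apply: (cvg_comp _ _ (cf o l)); exact: norm_continuous.
  have [c cI cmin] := EVT_min lok cN.
  exists c.
    move: cI; rewrite in_itv /= => /andP[+ _]; apply: lt_le_trans.
    by rewrite /lo ltrDl invr_gt0.
  apply/eqP; apply: contraT => fc0.
  have nfc : 0 < `|f o c| by rewrite normr_gt0.
  have [q _] := H (Num.bound (`|f o c|^-1)) I.
  rewrite /G; case: ifP => // qI /= fq.
  have qI' : ratr q \in `[lo k, k%:R] by rewrite in_itv.
  have := le_lt_trans (cmin _ qI') fq; rewrite ltNge => /negP; case.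
  rewrite invf_ple ?posrE//; apply: le_trans (ltW (archi_boundP _)) _; first by rewrite invr_ge0.
  by rewrite ler_nat.
apply: bigcupT_measurable => k; apply: bigcap_measurableType => j _.
apply: bigcupT_measurable_rat => q; rewrite /G; case: ifP => // _.
have mn : measurable_fun setT (fun o => `|f o (ratr q)|) by apply: measurableT_comp.
have := mn measurableT `]-oo, j.+1%:R^-1[%classic (measurable_itv _).
by rewrite setTI; congr measurable; apply/seteqP; split => o; rewrite /= in_itv.
Qed.

Lemma measurable_det n (M : T -> 'M[R]_n) : (forall i j, measurable_fun setT (fun o => M o i j)) ->
  measurable_fun setT (fun o => \det (M o)).
Proof.
move=> mM; rewrite /determinant; apply: measurable_sum => s.
by apply: measurable_funM => //; apply: measurable_prod => i _.
Qed.

Lemma horner_char_poly n (M : 'M[R]_n) l : (char_poly M).[l] = \det (l%:M - M).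
Proof.
rewrite /char_poly -[_.[l]]/(horner_eval l _) -det_map_mx; congr (\det _).
apply/matrixP => i j; rewrite !mxE /=. 
by rewrite /horner_eval hornerD hornerN hornerMn hornerX hornerC.
Qed.

Lemma measurable_spectral_norm_gt n (M : T -> 'M[R]_n) (c : R) :
  (forall i j, measurable_fun setT (fun o => M o i j)) ->
  (forall o, (M o)^T = M o) -> 0 <= c ->
  measurable [set o | c < spectral_norm (M o)].
Proof.
move=> mM MT c0.
pose f o l := (char_poly ((M o)^T *m M o)).[l].
have -> : [set o | c < spectral_norm (M o)] = [set o | exists2 l, c ^+ 2 < l & f o l = 0].
  apply/seteqP; split => o /=.
    by move=> /(lt_spectral_normP (MT o) c0)[l cl /rootP fl]; exists l.
  by move=> [l cl fl]; apply/(lt_spectral_normP (MT o) c0); exists l => //; apply/rootP.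
apply: measurable_root_gt => [l|o]; last exact: continuous_horner.
have -> : f^~ l = fun o => \det (l%:M - (M o)^T *m M o).
  by apply/funext => o; rewrite /f horner_char_poly.
apply: measurable_det => i j.
have -> : (fun o => (l%:M - (M o)^T *m M o) i j) =
    fun o => l *+ (i == j) - \sum_k M o k i * M o k j.
  by apply/funext => o; rewrite !mxE; congr (_ - _); apply: eq_bigr => k _; rewrite mxE.
apply: measurable_funB => //; apply: measurable_sum => k.
exact: measurable_funM.
Qed.

End Measurability.

(** * Choice of the exponent *)

Section TailConstants.
Variables (R : realType) (kap : R).
Hypothesis kap0 : 0 < kap.
Hypothesis kap1 : 100 * (60 * kap) <= 1.
Hypothesis kap2 : 432 * 291 ^+ 2 * kap ^+ 2 <= 8^-1.

(** In this section x^3 stands for sigma / sigma_*, r^2 for t, and P is about kap max(1, r) x^4. The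
    factor e^14 pays for the exponents 13 and 1 in [tail_large]; 100 covers both the 32 there and
    the square of the threshold 10; kap^2 comes from P^(3/2). [kap1] puts P in the range of
    [Gn_exists], [kap2] keeps its loss below half the gain. *)
Definition tail_const : R := kap ^+ 2 * expR (- 14) / 100.
Notation C := tail_const.

Lemma tail_const_gt0 : 0 < C.
Proof. by rewrite !mulr_gt0 ?exprn_gt0 ?expR_gt0 ?invr_gt0. Qed.

Let e14 : expR (- 14) <= 1 :> R. Proof. by rewrite -[leRHS]expR0 ler_expR; lra. Qed.

Let C_le : C <= kap ^+ 2 / 100.
Proof.
by rewrite /C ler_wpM2r ?invr_ge0// ler_piMr// sqr_ge0.
Qed.

(** Here x^6 <= (x^4)^2 <= 100 / kap^2, so the probability bound is at least 1. *)
Lemma tail_small (x r : R) : 1 <= x -> 0 <= r -> r <= x ^+ 2 -> kap * x ^+ 4 < 10 ->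
  1 <= (C * x ^+ 6)^-1 * expR (- C * r ^+ 3).
Proof.
move=> x1 r0 rx kx; have C0 := tail_const_gt0.
have x0 : 0 < x by lra.
have x60 : 0 < x ^+ 6 by apply: exprn_gt0.
have r3 : r ^+ 3 <= x ^+ 6 by rewrite (exprM x 2 3) lerXn2r// nnegrE// sqr_ge0.
have x68 : x ^+ 6 <= (x ^+ 4) ^+ 2 by rewrite -exprM ler_weXn2l.
have kx2 : kap ^+ 2 * (x ^+ 4) ^+ 2 <= 100.
  have -> : 100 = 10 ^+ 2 :> R by rewrite -natrX.
  by rewrite -exprMn lerXn2r ?nnegrE ?mulr_ge0 ?exprn_ge0 ?(ltW kap0) ?(ltW x0) ?(ltW kx).
have Cx : C * x ^+ 6 <= expR (- 14).
  rewrite /C mulrAC ler_pdivrMr// mulrAC mulrC ler_wpM2l ?expR_ge0//.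
  by apply: le_trans kx2; rewrite ler_wpM2l// sqr_ge0.
have Cx1 : C * x ^+ 6 <= 1 by apply: le_trans e14.
rewrite ler_pdivlMl ?mulr_gt0// mulr1.
apply: le_trans Cx _; rewrite ler_expR.
have : C * r ^+ 3 <= C * x ^+ 6 by rewrite ler_wpM2l// ltW.
by lra.
Qed.

(** Gain against loss: raising the level by t multiplies its power 2p by at least exp(kap r^3 / 4),
    while the correction P^3 / m^2 costs at most exp(kap r^3 / 8) up to a constant. *)
Lemma tail_large (x r : R) j : 1 <= x -> 0 <= r -> r <= x ^+ 2 -> 10 <= kap * x ^+ 4 ->
  x ^+ 6 <= j.+1%:R -> j.+1%:R <= x ^+ 6 + 1 ->
  exists p, Gn R j 1 (2 * p) <=
    (C * x ^+ 6)^-1 * expR (- C * r ^+ 3) * (2 * x ^+ 3 + r ^+ 2 / x) ^+ (2 * p).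
Proof.
move=> x1 r0 rx kx dm md; have C0 := tail_const_gt0.
have k0 := kap0; have k1 := kap1.
have x0 : 0 < x by lra.
have x20 : 0 < x ^+ 2 by apply: exprn_gt0.
have x40 : 0 < x ^+ 4 by apply: exprn_gt0.
have x60 : 0 < x ^+ 6 by apply: exprn_gt0.
have x21 : 1 <= x ^+ 2 by apply: exprn_ege1.
set M : R := j.+1%:R in dm md *.
have M0 : 0 < M by rewrite ltr0n.
pose rho := Num.max 1 r.
have rho1 : 1 <= rho by rewrite le_max lexx.
have rhor : r <= rho by rewrite le_max lexx orbT.
have rhox : rho <= x ^+ 2 by rewrite ge_max x21.
have rho3 : rho ^+ 3 <= 1 + r ^+ 3.
  rewrite /rho; case: (leP 1 r) => _; last by rewrite expr1n lerDl exprn_ge0.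
  by rewrite lerDr.
pose Y := kap * rho * x ^+ 4.
have Y10 : 10 <= Y.
  by apply: le_trans kx _; rewrite /Y mulrAC ler_peMr// mulr_ge0 ?(ltW kap0) ?(ltW x40).
have YE : Y <= kap * x ^+ 6.
  rewrite /Y -mulrA ler_wpM2l ?(ltW kap0)//.
  by rewrite (exprD x 2 4) ler_wpM2r// ltW.
pose P := Num.truncn Y.
have /andP[PY YP] : P%:R <= Y < P.+1%:R by apply: truncn_itv; lra.
have P9 : (9 <= P)%N.
  by rewrite -ltnS -(ltr_nat R); apply: le_lt_trans YP; lra.
have P0 : 0 < P%:R :> R by rewrite ltr0n; apply: leq_trans P9.
have PY2 : Y / 2 <= P%:R by move: YP; rewrite -natr1; lra.
have Pj : (100 * (60 * P) <= j.+1)%N.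
  rewrite -(ler_nat R) !natrM; apply: le_trans dm.
  apply: le_trans (_ : 100 * (60 * (kap * x ^+ 6)) <= _); first by lra.
  have -> : 100 * (60 * (kap * x ^+ 6)) = (100 * (60 * kap)) * x ^+ 6 by ring.
  by rewrite ler_piMl// ltW.
have Px6 : 2 * P%:R <= x ^+ 6.
  have : 100 * (60 * P%:R) <= x ^+ 6 + 1.
    by apply: le_trans md; rewrite -!natrM ler_nat.
  have : 9 <= P%:R :> R by rewrite ler_nat.
  by lra.
have [p /andP[Pp pP] H] := Gn_exists R P9 Pj.
exists p; apply: le_trans H _; rewrite -/M.
have pP' : p%:R <= 2 * P%:R :> R by rewrite -natrM ler_nat.
have Pp' : P%:R <= p%:R :> R by rewrite ler_nat.
have X4 : 0 <= (4 * x ^+ 6) ^+ p by apply/exprn_ge0/mulr_ge0 => //; exact: ltW.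
have kx6 : 0 <= (kap ^+ 2 * x ^+ 6)^-1.
  by rewrite invr_ge0; apply: mulr_ge0; [exact: sqr_ge0|exact: ltW].
(* Rounding x^6 up to the matrix size costs at most a factor e, since p <= 2 P <= x^6. *)
have step1 : (4 * M) ^+ p <= (4 * x ^+ 6) ^+ p * expR 1.
  apply: le_trans (_ : (4 * x ^+ 6 * expR ((x ^+ 6)^-1)) ^+ p <= _).
    apply: lerXn2r; rewrite ?nnegrE; [lra|by rewrite !mulr_ge0 ?expR_ge0// ltW|].
    rewrite -mulrA ler_wpM2l//; apply: le_trans md _.
    apply: le_trans (ler_wpM2l (ltW x60) (expR_ge1Dx _)).
    by rewrite mulrDr mulr1 mulfV ?gt_eqF.
  rewrite [leLHS]exprMn ler_wpM2l//.
  rewrite -expRM_natl ler_expR ler_pdivrMr// mul1r; lra.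
(* The relative excess of the level over 2 x^3; tau <= 1/2 gives exp(tau) <= (1 + tau)^2. *)
pose tau := r ^+ 2 / (2 * x ^+ 4).
have tau0 : 0 <= tau by rewrite mulr_ge0 ?sqr_ge0// invr_ge0 mulr_ge0// ltW.
have tau1 : tau <= 2^-1.
  rewrite /tau ler_pdivrMr ?mulr_gt0// mulrA mulVf// mul1r.
  by rewrite (exprM x 2 2) lerXn2r ?nnegrE// ltW.
have tauE : 2 * x ^+ 3 + r ^+ 2 / x = 2 * x ^+ 3 * (1 + tau).
  by rewrite /tau; field; rewrite gt_eqF.
have etau : expR tau <= (1 + tau) ^+ 2.
  have h1 : 1 - tau <= expR (- tau) by have := expR_ge1Dx (- tau); lra.
  have h2 : expR tau * expR (- tau) = 1 by rewrite -expRD subrr expR0.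
  have h3 : expR tau * (1 - tau) <= 1 by rewrite -[leRHS]h2 ler_wpM2l// expR_ge0.
  have h4 : 1 <= (1 + tau) ^+ 2 * (1 - tau) by rewrite expr2; nra.
  rewrite -(ler_pM2r (_ : 0 < 1 - tau)); last by lra.
  by apply: le_trans h3 h4.
have step2 : (4 * x ^+ 6) ^+ p * expR (kap * r ^+ 3 / 4) <= (2 * x ^+ 3 + r ^+ 2 / x) ^+ (2 * p).
  have -> : (2 * x ^+ 3 + r ^+ 2 / x) ^+ (2 * p) = (4 * x ^+ 6) ^+ p * ((1 + tau) ^+ 2) ^+ p.
    by rewrite tauE exprM -exprMn; congr (_ ^+ p); ring.
  rewrite ler_wpM2l//.
  apply: le_trans (_ : expR tau ^+ p <= _); last first.
    by apply: lerXn2r => //; rewrite nnegrE ?expR_ge0 ?sqr_ge0.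
  rewrite -expRM_natl ler_expR.
  apply: le_trans (_ : Y / 2 * tau <= _); last first.
    by rewrite ler_wpM2r//; lra.
  have -> : Y / 2 * tau = kap * (rho * r ^+ 2) / 4 by rewrite /Y /tau; field; rewrite gt_eqF.
  by rewrite ler_pM2r ?invr_gt0// ler_pM2l// exprS ler_wpM2r// sqr_ge0.
have step3 : 12 + 432 * P%:R * (291 * P%:R / M) ^+ 2 <= 13 + kap * r ^+ 3 / 8.
  have [Q QE] : exists Q : R, Q = 432 * 291 ^+ 2 by eexists.
  have Q0 : 0 <= Q by rewrite QE; apply: mulr_ge0; [exact: ler0n|exact: sqr_ge0].
  have kq : Q * kap ^+ 2 <= 8^-1 by rewrite QE.
  have -> : 432 * P%:R * (291 * P%:R / M) ^+ 2 = Q * (P%:R ^+ 3 / M ^+ 2).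
    by rewrite QE; field; rewrite gt_eqF.
  have r30 : 0 <= r ^+ 3 by exact: exprn_ge0.
  have h : P%:R ^+ 3 / M ^+ 2 <= kap ^+ 3 * rho ^+ 3.
    rewrite ler_pdivrMr ?exprn_gt0//.
    apply: le_trans (_ : Y ^+ 3 <= _).
      by apply: lerXn2r PY; rewrite nnegrE; [exact: ltW|exact: le_trans Y10].
    have -> : Y ^+ 3 = kap ^+ 3 * rho ^+ 3 * (x ^+ 6) ^+ 2 by rewrite /Y; ring.
    rewrite ler_wpM2l//; last by apply: lerXn2r dm; rewrite nnegrE; exact: ltW.
    by apply: mulr_ge0; apply: exprn_ge0; [exact: ltW|lra].
  have h' : Q * (P%:R ^+ 3 / M ^+ 2) <= Q * (kap ^+ 3 * (1 + r ^+ 3)).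
    apply: ler_wpM2l => //; apply: le_trans h _.
    by apply: ler_wpM2l => //; apply: exprn_ge0; exact: ltW.
  have h2 : Q * (kap ^+ 3 * (1 + r ^+ 3)) <= 8^-1 * (kap * (1 + r ^+ 3)).
    have -> : Q * (kap ^+ 3 * (1 + r ^+ 3)) = (Q * kap ^+ 2) * (kap * (1 + r ^+ 3)) by ring.
    by apply: ler_wpM2r => //; apply: mulr_ge0; [exact: ltW|lra].
  have kap_le : kap <= 1 by lra.
  have := le_trans h' h2.
  have -> : 8^-1 * (kap * (1 + r ^+ 3)) = kap / 8 + kap * r ^+ 3 / 8 by field.
  move: (Q * _) (kap * r ^+ 3 / 8) => X1 X2; lra.
(* P^(3/2) is at least of order kap^2 x^6: this is where sigma_*^2 / sigma^2 enters the
   prefactor. *)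
have step4 : 8 / (P%:R * Num.sqrt P%:R) <= 32 / (kap ^+ 2 * x ^+ 6).
  have hP : kap / 2 * x ^+ 4 <= P%:R.
    apply: le_trans PY2; rewrite /Y.
    have : kap * x ^+ 4 <= kap * rho * x ^+ 4.
      by rewrite ler_wpM2r ?(ltW x40)// ler_peMr// ltW.
    lra.
  have hS : kap / 2 * x ^+ 2 <= Num.sqrt P%:R.
    have -> : kap / 2 * x ^+ 2 = Num.sqrt ((kap / 2 * x ^+ 2) ^+ 2).
      by rewrite sqrtr_sqr ger0_norm// mulr_ge0 ?(ltW x20)//; lra.
    rewrite ler_sqrt//; apply: le_trans hP.
    have -> : (kap / 2 * x ^+ 2) ^+ 2 = (kap / 2) * (kap / 2 * x ^+ 4) by ring.
    by apply: ler_piMl; [apply: mulr_ge0; [lra|exact: ltW]|lra].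
  have h : (kap / 2) ^+ 2 * x ^+ 6 <= P%:R * Num.sqrt P%:R.
    have -> : (kap / 2) ^+ 2 * x ^+ 6 = (kap / 2 * x ^+ 4) * (kap / 2 * x ^+ 2) by ring.
    by apply: ler_pM => //; rewrite mulr_ge0 ?(ltW x20) ?(ltW x40)//; lra.
  have -> : 32 / (kap ^+ 2 * x ^+ 6) = 8 / ((kap / 2) ^+ 2 * x ^+ 6).
    by field; rewrite !gt_eqF.
  rewrite ler_wpM2l// lef_pV2 ?posrE// mulr_gt0 ?exprn_gt0 ?sqrtr_gt0//; lra.
have step5 : 32 / (kap ^+ 2 * x ^+ 6) * expR 14 <= (C * x ^+ 6)^-1.
  have -> : (C * x ^+ 6)^-1 = 100 / (kap ^+ 2 * x ^+ 6) * expR 14.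
    rewrite /C expRN; field; rewrite !gt_eqF ?expR_gt0//.
  by apply: ler_wpM2r; [exact: expR_ge0|apply: ler_wpM2r; [exact: kx6|lra]].
have P8 : 0 <= 8 / (P%:R * Num.sqrt P%:R) :> R.
  by apply: divr_ge0; [exact: ler0n|apply: mulr_ge0; [exact: ler0n|exact: sqrtr_ge0]].
apply: le_trans (_ : (4 * x ^+ 6) ^+ p * expR 1 *
  (32 / (kap ^+ 2 * x ^+ 6) * expR (13 + kap * r ^+ 3 / 8)) <= _).
  apply: ler_pM.
  - by apply/exprn_ge0/mulr_ge0; [exact: ler0n|exact: ltW].
  - by apply: mulr_ge0; [exact: P8|exact: expR_ge0].
  - exact: step1.
  - by apply: ler_pM; [exact: P8|exact: expR_ge0|exact: step4|rewrite ler_expR].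
have Cx0 : 0 <= (C * x ^+ 6)^-1 by rewrite invr_ge0; apply: mulr_ge0; exact: ltW.
apply: le_trans (ler_wpM2l (mulr_ge0 Cx0 (expR_ge0 _)) step2).
have -> : (4 * x ^+ 6) ^+ p * expR 1 *
  (32 / (kap ^+ 2 * x ^+ 6) * expR (13 + kap * r ^+ 3 / 8)) =
  (4 * x ^+ 6) ^+ p * ((32 / (kap ^+ 2 * x ^+ 6) * expR 14) * expR (kap * r ^+ 3 / 8)).
  have -> : expR 14 = expR 1 * expR 13 :> R by rewrite -expRD; congr expR; lra.
  by rewrite expRD; ring.
rewrite [leRHS]mulrCA ler_wpM2l//.
rewrite -[leRHS]mulrA; apply: ler_pM.
- by apply: mulr_ge0; [apply: mulr_ge0; [exact: ler0n|exact: kx6]|exact: expR_ge0].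
- exact: expR_ge0.
- exact: step5.
rewrite -expRD ler_expR.
have : C * r ^+ 3 <= kap / 8 * r ^+ 3.
  apply: ler_wpM2r; first exact: exprn_ge0.
  apply: le_trans C_le _; have := kap0; have := kap1; nra.
lra.
Qed.

End TailConstants.

Section Variances.
Variables (R : realType) (n : nat) (b : 'I_n -> 'I_n -> R).
Hypothesis b_nonzero : exists i j, b i j != 0.

Let sqb0 i j : 0 <= b i j ^+ 2. Proof. exact: sqr_ge0. Qed.

Lemma sqr_sigma_star : sigma_star b ^+ 2 = \big[Num.max/0]_(i < n) \big[Num.max/0]_(j < n) b i j ^+ 2.
Proof. by rewrite sqr_sqrtr// bigmax_ge_id. Qed.

Lemma sqr_sigma : sigma b ^+ 2 = \big[Num.max/0]_(i < n) \sum_(j < n) b i j ^+ 2.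
Proof. by rewrite sqr_sqrtr// bigmax_ge_id. Qed.

Lemma sigma_star_ge i j : b i j ^+ 2 <= sigma_star b ^+ 2.
Proof.
rewrite sqr_sigma_star; apply: le_trans (le_bigmax _ _ i).
exact: (le_bigmax _ (fun j => b i j ^+ 2) j).
Qed.

Lemma sigma_ge i : \sum_j b i j ^+ 2 <= sigma b ^+ 2.
Proof. by rewrite sqr_sigma; exact: le_bigmax. Qed.

Lemma sigma_star_gt0 : 0 < sigma_star b.
Proof.
have [i [j bij]] := b_nonzero.
rewrite lt0r sqrtr_ge0 andbT; apply/eqP => s0; have := sigma_star_ge i j.
by rewrite s0 expr0n leNgt lt0r sqrf_eq0 bij sqb0.
Qed.

Lemma sigma_star_le : sigma_star b <= sigma b.
Proof.
rewrite -(ler_pXn2r (_ : 0 < 2)%N) ?nnegrE ?sqrtr_ge0// sqr_sigma_star.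
apply: bigmax_le => [|i _]; first exact: sqr_ge0.
apply: bigmax_le => [|j _]; first exact: sqr_ge0.
by apply: le_trans (sigma_ge i); rewrite (bigD1 j)//= lerDl sumr_ge0.
Qed.

End Variances.

(** * Markov's inequality and conclusion *)

Section TailBound.
Context d (T : measurableType d) (R : realType) (P : probability T R).
Variables (n : nat) (b : 'I_n -> 'I_n -> R) (xi : 'I_n -> 'I_n -> {RV P >-> R}).
Hypothesis bC : forall i j, b i j = b j i.
Hypothesis xiC : forall i j, xi i j =1 xi j i.

Lemma random_matrix_sym o : (random_matrix b xi o)^T = random_matrix b xi o.
Proof. by apply/matrixP => i j; rewrite !mxE eq_sym bC xiC. Qed.

Lemma measurable_norm_gt (c : R) : 0 <= c ->
  measurable [set o | c < spectral_norm (random_matrix b xi o)].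
Proof.
apply: measurable_spectral_norm_gt; last exact: random_matrix_sym.
move=> i j; have -> : (fun o => random_matrix b xi o i j) =
    fun o => (if i == j then Num.sqrt 2 * b i j else b i j) * xi i j o.
  by apply/funext => o; rewrite mxE; case: eqP.
by apply: measurable_funM => //; exact: measurable_funPT.
Qed.

(** Markov's inequality for the matrix divided by [s]: on the event the trace is at least L^(2p),
    and elsewhere the trace of an even power is nonnegative. *)
Lemma norm_tail_le_trace (s L c : R) p : 0 < s -> 0 < L ->
  has_mean P (fun o => \tr (random_matrix (fun i j => b i j / s) xi o ^+ (2 * p))) c ->
  (P [set o | (s * L < spectral_norm (random_matrix b xi o))%R] <= (c / L ^+ (2 * p))%:E)%E.
Proof.
move=> s0 L0 hc; set E := [set o | _]; pose X o := random_matrix (fun i j => b i j / s) xi o.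
have sL : 0 <= s * L by apply: mulr_ge0; exact: ltW.
have mE : measurable E by exact: measurable_norm_gt.
have XE o : random_matrix b xi o = s *: X o.
  apply/matrixP => i j; rewrite !mxE; case: eqP => _.
    by field; rewrite gt_eqF.
  by field; rewrite gt_eqF.
have XT o : (X o)^T = X o.
  by apply/matrixP => i j; rewrite !mxE eq_sym bC xiC.
have h1 : has_mean P (\1_E : T -> R) (fine (P E)).
  apply: has_mean_ge0; [exact: measurable_indic|by []|].
  by rewrite integral_indic// setIT fineK// fin_num_measure.
have L2 : 0 < L ^+ (2 * p) by apply: exprn_gt0.
have := has_mean_le _ (has_meanZ (L ^+ (2 * p)) h1) hc.
move=> /(_ _) H; rewrite -[P E]fineK ?fin_num_measure// lee_fin ler_pdivlMr// mulrC.
apply: H => o; rewrite indicE; case: (boolP (o \in E)) => [/set_mem oE|_]; last first.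
  by rewrite mulr0; exact: trace_even_exp_ge0.
rewrite mulr1.
have := spectral_norm_trace p (random_matrix_sym o) sL oE.
rewrite XE scalemx_exp mxtraceZ exprMn ler_pM2l//.
exact: exprn_gt0.
Qed.

End TailBound.

Lemma powR_third_cube (R : realType) (a : R) : 0 <= a -> (a `^ 3^-1) ^+ 3 = a.
Proof.
move=> a0; rewrite -powR_mulrn ?powR_ge0// -powRrM mulVf// powRr1//.
Qed.

Theorem theorem3p4 (R : realType) :
  exists C : R, 0 < C /\
  forall (n : nat) (b : 'I_n -> 'I_n -> R)
    (d : measure_display) (T : measurableType d) (P : probability T R)
    (xi : 'I_n -> 'I_n -> {RV P >-> R}),
    (forall i j, b i j = b j i) ->
    (forall i j, 0 <= b i j) ->
    (exists i j, b i j != 0) ->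
    (forall i j, xi i j =1 xi j i) ->
    (forall i j, symmetrically_distributed (xi i j)) ->
    mutually_independent [set ij : 'I_n * 'I_n | (ij.2 <= ij.1)%N]
      (fun ij => xi ij.1 ij.2) ->
    (forall i j (p : nat),
      ('E_P[(fun w => xi i j w ^+ (2 * p))%R] <= gaussian_moment R (2 * p)%N)%E) ->
    forall t : R, 0 <= t ->
      t <= sigma b `^ (4 / 3) / sigma_star b `^ (4 / 3) ->
      (P [set w | (2 * sigma b
                   + sigma_star b `^ (4 / 3) * sigma b `^ (- (1 / 3)) * t
                   < spectral_norm (random_matrix b xi w))%R]
       <= (n%:R * sigma_star b ^+ 2 / (C * sigma b ^+ 2)
           * expR (- C * t `^ (3 / 2)))%:E)%E.
Proof.
have [kap [k0 k1 k2]] : exists kap : R, [/\ 0 < kap, 100 * (60 * kap) <= 1 &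
    432 * 291 ^+ 2 * kap ^+ 2 <= 8^-1].
  (* The value 1/20000 gives 0.3 and about 0.0915 in the two constraints. *)
  exists (200^-1 * 100^-1); split; [by rewrite mulr_gt0// invr_gt0 ltr0n|lra|lra].
have C0 := tail_const_gt0 k0; set C := tail_const kap in C0.
exists C; split=> // n b d T P xi bC b0 bN xiC symX indep momX t t0 tle.
have s0 := sigma_star_gt0 bN; have ss := sigma_star_le b.
set s := sigma_star b in s0 ss tle *; set S := sigma b in ss tle *.
have S0 : 0 < S by exact: lt_le_trans ss.
(* The cube root turns every fractional power into an integer power of [x]: sigma^2 / sigma_*^2 =
   x^6 and the range of t is t <= x^4. *)
pose x : R := (S / s) `^ 3^-1.
have xx : x ^+ 3 = S / s by rewrite powR_third_cube// divr_ge0// ltW.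
have x0 : 0 < x by rewrite powR_gt0// divr_gt0.
have x1 : 1 <= x.
  rewrite leNgt; apply/negP => xl.
  have : x ^+ 3 < 1 by rewrite exprn_ilt1// ltW.
  by rewrite xx ltr_pdivrMr// mul1r ltNge ss.
have SE : S = s * x ^+ 3 by rewrite xx mulrCA divff ?mulr1// gt_eqF.
have xp (a : R) : (x ^+ 3) `^ (a / 3) = x `^ a.
  by rewrite -(powR_mulrn 3 (ltW x0)) -powRrM; congr (x `^ _); lra.
have x4 : S `^ (4 / 3) / s `^ (4 / 3) = x ^+ 4.
  rewrite SE powRM ?exprn_ge0 ?(ltW s0) ?(ltW x0)// xp mulrAC divff ?mul1r ?gt_eqF ?powR_gt0//.
  by rewrite powR_mulrn ?(ltW x0).
have sx : s `^ (4 / 3) * S `^ (- (1 / 3)) = s / x.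
  rewrite SE powRM ?exprn_ge0 ?(ltW s0) ?(ltW x0)// -mulNr xp mulrA -powRD; last first.
    by rewrite (gt_eqF s0) implybT.
  rewrite powRN powRr1 ?(ltW x0)//; congr (_ / _).
  by rewrite (_ : 4 / 3 + -1 / 3 = 1) ?powRr1 ?(ltW s0)//; lra.
pose r := Num.sqrt t; have r0 : 0 <= r by exact: sqrtr_ge0.
have tE : t = r ^+ 2 by rewrite sqr_sqrtr.
have rx : r <= x ^+ 2.
  rewrite -(ler_pXn2r (_ : 0 < 2)%N) ?nnegrE ?sqr_ge0// -tE -exprM.
  by move: tle; rewrite x4.
have t32 : t `^ (3 / 2) = r ^+ 3.
  by rewrite mulrC powRrM powR12_sqrt// powR_mulrn.
rewrite sx t32.
have -> : n%:R * s ^+ 2 / (C * S ^+ 2) * expR (- C * r ^+ 3) =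
   n%:R * ((C * x ^+ 6)^-1 * expR (- C * r ^+ 3)).
  rewrite mulrA; congr (_ * _).
  by rewrite SE; field; rewrite !gt_eqF.
have [kx|kx] := ltP (kap * x ^+ 4) 10.
  apply: le_trans (probability_le1 _ _) _.
    apply: measurable_norm_gt => //; apply: addr_ge0.
      by apply: mulr_ge0; [exact: ler0n|exact: ltW].
    by apply: mulr_ge0 => //; apply: divr_ge0; exact: ltW.
  rewrite lee_fin; apply: le_trans (tail_small k0 x1 r0 rx kx) _.
  have x6 : 0 <= C * x ^+ 6 by apply: mulr_ge0; [exact: ltW|apply: exprn_ge0; exact: ltW].
  apply: ler_peMl; first by apply: mulr_ge0; [rewrite invr_ge0|exact: expR_ge0].
  by rewrite ler1n; have [[i ?] _] := bN; apply: leq_ltn_trans (leq0n i) _.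
(* The comparison ensemble has size m + 1, the least integer above x^6, so the normalised row sums
   of squares are at most its size. *)
pose m := Num.truncn (x ^+ 6).
have x60 : 0 <= x ^+ 6 by rewrite exprn_ge0// ltW.
have /andP[ml mu] := truncn_itv x60.
have mx : m.+1%:R <= x ^+ 6 + 1 by rewrite -natr1 lerD2r.
have [p pP] := tail_large k0 k1 k2 x1 r0 rx kx (ltW mu) mx.
have bs i j : (b i j / s) ^+ 2 = b i j ^+ 2 / s ^+ 2 by rewrite exprMn exprVn.
have [||| c [hc cG]] := @trace_mean _ _ _ P n (fun i j => b i j / s) xi _ xiC symX indep momX m (2 * p) _ _.
- by move=> i j; rewrite bC.
- by move=> i j; rewrite bs ler_pdivrMr ?exprn_gt0// mul1r sigma_star_ge.
- move=> i; under eq_bigr do rewrite bs.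
  rewrite -mulr_suml ler_pdivrMr ?exprn_gt0//; apply: le_trans (sigma_ge b i) _.
  rewrite -/S SE exprMn mulrC ler_wpM2r ?sqr_ge0// -exprM; exact: ltW.
pose L := 2 * x ^+ 3 + r ^+ 2 / x.
have L0 : 0 < L by rewrite ltr_pwDl ?mulr_gt0 ?exprn_gt0// divr_ge0 ?sqr_ge0// ltW.
have -> : 2 * S + s / x * t = s * L by rewrite SE tE /L; field; rewrite gt_eqF.
apply: le_trans (norm_tail_le_trace bC xiC s0 L0 hc) _.
rewrite lee_fin ler_pdivrMr ?exprn_gt0//; apply: le_trans cG _.
by rewrite -mulrA; apply: ler_wpM2l; [exact: ler0n|exact: pP].
Qed.
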